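(* Let $\Omega\subset\mathbb{R}^3$ be a bounded Lipschitz domain with connected complement $\mathbb{R}^3\setminus\overline\Omega$, let $\varepsilon_0,\mu_0>0$, let $\varepsilon,\mu\in L^\infty(\Omega;\mathbb{R}_+)$ and $\sigma\in L^\infty(\Omega;\mathbb{R}_+^0)$, and let $\omega>0$ be an interior transmission eigenvalue with a corresponding pair of eigenfunctions $(\mathbf{E}^t,\mathbf{H}^t)$ and $(\mathbf{E}^0,\mathbf{H}^0)$, i.e. nontrivial $H(\mathrm{curl})$ fields satisfying, with $\gamma:=\varepsilon+\mathrm{i}\sigma/\omega$, $$\nabla\wedge\mathbf{E}^t-\mathrm{i}\omega\mu\mathbf{H}^t=0,\quad \nabla\wedge\mathbf{H}^t+\mathrm{i}\omega\gamma\mathbf{E}^t=0\quad\text{in }\Omega,$$ $$\nabla\wedge\mathbf{E}^0-\mathrm{i}\omega\mu_0\mathbf{H}^0=0,\quad \nabla\wedge\mathbf{H}^0+\mathrm{i}\omega\varepsilon_0\mathbf{E}^0=0\quad\text{in }\Omega,$$ $$\nu\wedge\mathbf{E}^t=\nu\wedge\mathbf{E}^0,\quad \nu\wedge\mathbf{H}^t=\nu\wedge\mathbf{H}^0\quad\text{on }\partial\Omega.$$ Assume that $\Omega$ possesses a corner $\mathcal{K}^{r_0}_{x_0}$ and that $$(\mu-\mu_0)\mathbf{H}^t,\ (\gamma-\varepsilon_0)\mathbf{E}^t\in C^\alpha(\overline{\mathcal{K}^{r_0}_{x_0}})^3$$ for some $\alpha\in(0,1)$. Then $$(\mu-\mu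_0)(x_0)\mathbf{H}^t(x_0)=(\gamma-\varepsilon_0)(x_0)\mathbf{E}^t(x_0)=0.$$
   Context: Convex polyhedral cone: let $w_1,\ldots,w_n\in\mathbb{S}^2$ (unit sphere of $\mathbb{R}^3$), $n\ge3$, be unit vectors any three of which are linearly independent, and let $x_0\in\mathbb{R}^3$. Put $\mathcal{K}_{x_0}=\mathcal{K}_{w_1,\ldots,w_n;x_0}:=\{x_0+\sum_{j=1}^n c_jw_j:\ c_j>0\}$. It is assumed that this set is strictly convex (convex and contained in a spherical cone with apex $x_0$ of opening angle less than $\pi$) and that no $w_j$ is redundant. $\mathcal{K}^{r_0}_{x_0}:=\mathcal{K}_{x_0}\cap B_{r_0}(x_0)$, where $B_r(x_0)$ is the open ball. ''$\Omega$ possesses a corner $\mathcal{K}^{r_0}_{x_0}$'' means that $\Omega\cap B_{r_0}(x_0)=\mathcal{K}_{x_0}\cap B_{r_0}(x_0)$ for such a cone with apex $x_0\in\partial\Omega$. $\wedge$ is the cross product, $\nabla\wedge$ the curl, $\nu$ the exterior unit normal; boundary conditions are in the sense of tangential traces of $H(\mathrm{curl},\Omega)$ fields. $\mathbb{R}_+$ and $\mathbb{R}_+^0$ denote the positive and nonnegative reals. The quantities $(\mu-\mu_0)(x_0)\mathbf{H}^t(x_0)$ and $(\gamma-\varepsilon_0)(x_0)\mathbf{E}^t(x_0)$ are the values at $x_0$ of the (Hölder continuous) products $(\mu-\mu_0)\mathbf{H}^t$ and $(\gamma-\varepsilon_0)\mathbf{E}^t$. *)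

(* Defs.v *)
From HB Require Import structures.
From mathcomp Require Import all_boot all_order all_algebra.
From mathcomp Require Import complex.
From mathcomp Require Import all_classical all_reals all_analysis.

Set Implicit Arguments.
Unset Strict Implicit.
Unset Printing Implicit Defensive.

Import Order.TTheory GRing.Theory Num.Theory.
Import numFieldNormedType.Exports.

Local Open Scope classical_set_scope.
Local Open Scope ring_scope.
Local Open Scope complex_scope.

(* Points of R^3 are row vectors.  Their library norm is the sup norm, which
   gives the usual topology; Euclidean quantities are defined explicitly. *)

Definition dot {R : realType} (u v : 'rV[R]_3) : R := \sum_i u 0 i * v 0 i.

Definition enorm {R : realType} (u : 'rV[R]_3) : R := Num.sqrt (dot u u).

Definition eball {R : realType} (x : 'rV[R]_3) (r : R) : set 'rV[R]_3 :=
  [set y | enorm (y - x) < r].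

Definition cnorm {R : realType} (u : 'rV[R[i]]_3) : R :=
  Num.sqrt (\sum_i ((complex.Re (u 0 i)) ^+ 2 + (complex.Im (u 0 i)) ^+ 2)).

Definition boundary {T : topologicalType} (A : set T) : set T :=
  closure A `\` interior A.

(* Lebesgue measure on R^3.  Row vectors carry no sigma-algebra in the library,
   so measure-theoretic notions for functions of a row vector are pulled back
   to R * R * R along the coordinate bijection pt. *)

Definition leb3 (R : realType) :
    {measure set (measurableTypeR R * measurableTypeR R * measurableTypeR R)
       -> \bar R} :=
  ((@lebesgue_measure R \x @lebesgue_measure R) \x @lebesgue_measure R)%E.
Arguments leb3 R : clear implicits.

Definition pt {R : realType} (p : R * R * R) : 'rV[R]_3 :=
  \row_j [:: p.1.1; p.1.2; p.2]`_j.

Definition ae_in {R : realType} (A : set 'rV[R]_3) (P : 'rV[R]_3 -> Prop) :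
  Prop := {ae leb3 R, forall p, A (pt p) -> P (pt p)}.

Definition measurable_in {R : realType} (A : set 'rV[R]_3)
  (f : 'rV[R]_3 -> R) : Prop := measurable_fun (pt @^-1` A) (f \o pt).

Definition cintegral {R : realType} (A : set 'rV[R]_3)
    (f : 'rV[R]_3 -> R[i]) : R[i] :=
  (\int[leb3 R]_(p in pt @^-1` A) complex.Re (f (pt p))) +i*
  (\int[leb3 R]_(p in pt @^-1` A) complex.Im (f (pt p))).

Definition Linfty {R : realType} (A : set 'rV[R]_3) (f : 'rV[R]_3 -> R) : Prop :=
  measurable_in A f /\ exists M : R, ae_in A (fun x => `|f x| <= M).

Definition L2field {R : realType} (A : set 'rV[R]_3)
    (u : 'rV[R]_3 -> 'rV[R[i]]_3) : Prop :=
  (forall i, measurable_in A (fun x => complex.Re (u x 0 i)) /\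
             measurable_in A (fun x => complex.Im (u x 0 i))) /\
  (leb3 R).-integrable (pt @^-1` A) (fun p => ((cnorm (u (pt p))) ^+ 2)%:E).

(* Test fields *)

Definition partial {R : realType} (i : 'I_3) (f : 'rV[R]_3 -> R) :
  'rV[R]_3 -> R := fun x => 'D_(delta_mx 0 i) f x.

Definition partials {R : realType} (s : seq 'I_3) (f : 'rV[R]_3 -> R) :
  'rV[R]_3 -> R := foldr partial f s.

(* C^oo: all iterated partial derivatives exist and are continuous. *)
Definition smooth {R : realType} (f : 'rV[R]_3 -> R) : Prop :=
  forall s : seq 'I_3, continuous (partials s f) /\
    forall i x, derivable (partials s f) x (delta_mx 0 i).

(* C_c^oo(A)^3 *)
Definition test_field {R : realType} (A : set 'rV[R]_3)
    (phi : 'rV[R]_3 -> 'rV[R]_3) : Prop :=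
  (forall i, smooth (fun x => phi x 0 i)) /\
  compact (closure [set x | phi x != 0]) /\
  closure [set x | phi x != 0] `<=` A.

(* Indices are added modulo 3. *)
Definition scurl {R : realType} (phi : 'rV[R]_3 -> 'rV[R]_3) :
    'rV[R]_3 -> 'rV[R]_3 := fun x =>
  \row_i (partial (i + 1) (fun y => phi y 0 (i + 2)) x
          - partial (i + 2) (fun y => phi y 0 (i + 1)) x).

Definition cdot {R : realType} (u : 'rV[R[i]]_3) (v : 'rV[R]_3) : R[i] :=
  \sum_i u 0 i * (v 0 i)%:C.

(* Distributional curl.  Real test fields suffice for complex fields, since
   the identity is linear in the test field. *)
Definition is_weak_curl {R : realType} (A : set 'rV[R]_3)
    (u g : 'rV[R]_3 -> 'rV[R[i]]_3) : Prop :=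
  forall phi, test_field A phi ->
    cintegral A (fun x => cdot (u x) (scurl phi x)) =
    cintegral A (fun x => cdot (g x) (phi x)).

Definition L2curl {R : realType} (A : set 'rV[R]_3)
    (u : 'rV[R]_3 -> 'rV[R[i]]_3) : set ('rV[R]_3 -> 'rV[R[i]]_3) :=
  [set g | L2field A g /\ is_weak_curl A u g].

Definition Hcurl {R : realType} (A : set 'rV[R]_3)
    (u : 'rV[R]_3 -> 'rV[R[i]]_3) : Prop := L2field A u /\ L2curl A u !=set0.

(* A representative of the L^2 weak curl; determined a.e. in an open A. *)
Definition curl {R : realType} (A : set 'rV[R]_3)
    (u : 'rV[R]_3 -> 'rV[R[i]]_3) : 'rV[R]_3 -> 'rV[R[i]]_3 :=
  xget (fun=> 0) (L2curl A u).

(* Tangential trace of u in H(curl, A), as the functional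
     phi |-> <nu /\ u, phi>_{boundary A}
           = int_A ((curl u) . phi - u . (curl phi))
   (Green's formula, nu exterior) on restrictions to A of smooth compactly
   supported fields on R^3.  For a Lipschitz domain these are dense in
   H^1(A)^3, so this functional determines the trace in H^(-1/2). *)
Definition tangential_trace {R : realType} (A : set 'rV[R]_3)
    (u : 'rV[R]_3 -> 'rV[R[i]]_3) (phi : 'rV[R]_3 -> 'rV[R]_3) : R[i] :=
  cintegral A (fun x => cdot (curl A u x) (phi x) - cdot (u x) (scurl phi x)).

Definition same_tangential_trace {R : realType} (A : set 'rV[R]_3)
    (u v : 'rV[R]_3 -> 'rV[R[i]]_3) : Prop :=
  forall phi, test_field setT phi ->
    tangential_trace A u phi = tangential_trace A v phi.

(* Near every boundary point, in suitable orthonormal coordinates centred at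
   that point, A is the strict epigraph of a Lipschitz function. *)
Definition lipschitz_boundary {R : realType} (A : set 'rV[R]_3) : Prop :=
  forall p, boundary A p ->
    exists (Q : 'M[R]_3) (phi : 'rV[R]_2 -> R) (r : R),
      [/\ Q *m Q^T = 1%:M, lipschitz phi, 0 < r &
          forall x, eball p r x ->
            let y : 'rV[R]_(2 + 1) := (x - p) *m Q in
            A x <-> phi (lsubmx y) < rsubmx y 0 0].

Definition bounded_lipschitz_domain {R : realType} (A : set 'rV[R]_3) : Prop :=
  [/\ open A, connected A, A !=set0, bounded_set A & lipschitz_boundary A].

(* Polyhedral cones and corners *)

(* The open cone with apex x0 generated by the w j with P j. *)
Definition pcone {R : realType} n (w : 'I_n -> 'rV[R]_3) (P : pred 'I_n)
    (x0 : 'rV[R]_3) : set 'rV[R]_3 :=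
  [set x | exists2 c : 'I_n -> R, (forall j, 0 < c j) &
             x = x0 + \sum_(j | P j) c j *: w j].

Definition cone {R : realType} n (w : 'I_n -> 'rV[R]_3) (x0 : 'rV[R]_3) :
  set 'rV[R]_3 := pcone w xpredT x0.

(* Contained in a circular cone with apex x0, axis v and full opening angle
   theta < pi. *)
Definition strictly_convex_cone {R : realType} (x0 : 'rV[R]_3)
    (K : set 'rV[R]_3) : Prop :=
  convex_set (K : set (convex_lmodType 'rV[R]_3)) /\
  exists (v : 'rV[R]_3) (theta : R),
    [/\ enorm v = 1, 0 < theta < pi &
        K `<=` [set x | enorm (x - x0) * cos (theta / 2) <= dot (x - x0) v]].

Definition polyhedral_cone {R : realType} n (w : 'I_n -> 'rV[R]_3)
    (x0 : 'rV[R]_3) : Prop :=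
  [/\ (3 <= n)%N,
      forall j, enorm (w j) = 1,
      forall i j k, i != j -> j != k -> i != k -> free [:: w i; w j; w k],
      strictly_convex_cone x0 (cone w x0) &
      forall j, pcone w (predC1 j) x0 <> cone w x0].

Definition tcone {R : realType} n (w : 'I_n -> 'rV[R]_3) (x0 : 'rV[R]_3)
  (r0 : R) : set 'rV[R]_3 := cone w x0 `&` eball x0 r0.

Definition has_corner {R : realType} (Om : set 'rV[R]_3) n
    (w : 'I_n -> 'rV[R]_3) (x0 : 'rV[R]_3) (r0 : R) : Prop :=
  [/\ polyhedral_cone w x0, 0 < r0, boundary Om x0 &
      Om `&` eball x0 r0 = tcone w x0 r0].

Definition holder {R : realType} (alpha : R) (A : set 'rV[R]_3)
    (F : 'rV[R]_3 -> 'rV[R[i]]_3) : Prop :=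
  exists C : R, forall x y, A x -> A y ->
    cnorm (F x - F y) <= C * enorm (x - y) `^ alpha.

(* The L^2 field f is C^alpha on closure A, with continuous version F; thus
   "f(x0)" for x0 in closure A means F x0. *)
Definition holder_version {R : realType} (alpha : R) (A : set 'rV[R]_3)
    (f F : 'rV[R]_3 -> 'rV[R[i]]_3) : Prop :=
  holder alpha (closure A) F /\ ae_in A (fun x => f x = F x).

(* Transmission eigenfunctions *)

Definition gam {R : realType} (eps sigma : 'rV[R]_3 -> R) (omega : R)
  (x : 'rV[R]_3) : R[i] := eps x +i* (sigma x / omega).

(* curl E - i omega m H = 0 and curl H + i omega g E = 0 a.e. in A *)
Definition maxwell {R : realType} (A : set 'rV[R]_3) (omega : R)
    (m g : 'rV[R]_3 -> R[i]) (E H : 'rV[R]_3 -> 'rV[R[i]]_3) : Prop :=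
  ae_in A (fun x => curl A E x - ((0 +i* omega) * m x) *: H x = 0) /\
  ae_in A (fun x => curl A H x + ((0 +i* omega) * g x) *: E x = 0).

(* Nontrivial: the four fields do not all vanish a.e. in A. *)
Definition transmission_eigenfunctions {R : realType} (A : set 'rV[R]_3)
    (eps0 mu0 : R) (eps mu sigma : 'rV[R]_3 -> R) (omega : R)
    (Et Ht E0 H0 : 'rV[R]_3 -> 'rV[R[i]]_3) : Prop :=
  [/\ [/\ Hcurl A Et, Hcurl A Ht, Hcurl A E0 & Hcurl A H0],
      ~ ae_in A (fun x => [/\ Et x = 0, Ht x = 0, E0 x = 0 & H0 x = 0]),
      maxwell A omega (fun x => (mu x)%:C) (gam eps sigma omega) Et Ht,
      maxwell A omega (fun=> mu0%:C) (fun=> eps0%:C) E0 H0 &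
      same_tangential_trace A Et E0 /\ same_tangential_trace A Ht H0].

(* Main.v *)
(* Let E and H be the differences of the two pairs of fields, and P, Q the differences of
   their curls. Equal tangential traces mean that the weak curl identities of E and H hold
   for test functions that do not vanish on the boundary. Near x0 we test with a cutoff
   times exp(-tau rho.(x - x0)), where rho = u + iv, rho.rho = 0 and u is positive on the
   cone. Writing ^ for the resulting integrals over the cone,
     P^ = tau rho x E^ + r,  Q^ = tau rho x H^ + q,
   with r, q rapidly decreasing since the cutoff is constant near x0. By Maxwell's equations
   P = i omega (F + mu0 H) and Q = -i omega (G + eps0 E) in the cone, so that
   rho.F^ = -mu0 rho.H^ + O(r). Solving for rho.H^ in terms of Q^, and then for the component
   of E^ that occurs in terms of P^, gives rho.F^ = O(tau^(-7/2)). On the other hand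
   rho.F^ = (rho.F(x0)) L(tau) + o(tau^-3), where L is the Laplace transform of the cone,
   and |L(tau)| >= c tau^-3 when u is nearly orthogonal to an extremal ray. Hence
   rho.F(x0) = 0 for a family of vectors rho that spans C^3. The argument for G is the same. *)
From HB Require Import structures.
Require Import Defs.
From mathcomp Require Import all_boot all_order all_algebra.
From mathcomp Require Import complex.
From mathcomp Require Import all_classical all_reals all_analysis.
From mathcomp Require Import measurable_realfun.
From mathcomp Require Import ring lra.
Set Implicit Arguments.
Unset Strict Implicit.
Unset Printing Implicit Defensive.
Import Order.TTheory GRing.Theory Num.Theory.
Import numFieldNormedType.Exports.
Local Open Scope classical_set_scope.
Local Open Scope ring_scope.
Local Open Scope complex_scope.

(** The obstacle is that [E] and [H] are only square integrable. Their transforms are O(tau^(-3/2)),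
    while F(x0) becomes visible at order tau^(-3). Each of the two curl identities gains a factor
    tau^(-1), and -3/2 - 1 - 1 = -7/2 is just enough. Between the two gains one passes from Q^ back
    to E^, up to the transform of the bounded field G, which is O(tau^(-3)). The null vectors come
    from the rational parametrisation u = (1 - s^2) d + 2 s a, v = (1 + s^2) a x d, where a is an
    extremal generator and d a unit vector orthogonal to a and positive on the other generators. So
    rho.a = 2 s, and the conditions on F(x0) are polynomial in s. A cone with many generators splits
    into pieces whose transforms might cancel; for small s the simplicial piece at a has a transform
    of order 1/(s tau^3) and dominates. Its size is found by removing translates of the piece, which
    multiplies the transform by explicit factors and ends in a small parallelepiped on which the
    wave has real part at least 1/2. *)

Notation P3 R := (measurableTypeR R * measurableTypeR R * measurableTypeR R)%type.

(** * Coordinates and measurability in R^3 *)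

Lemma ptE0 {R : realType} (p : R * R * R) : pt p 0 0 = p.1.1.
Proof. by rewrite /pt mxE. Qed.

Lemma ptE1 {R : realType} (p : R * R * R) : pt p 0 1 = p.1.2.
Proof. by rewrite /pt mxE. Qed.

Lemma ptE2 {R : realType} (p : R * R * R) : pt p 0 2 = p.2.
Proof. by rewrite /pt mxE. Qed.

Definition ptE := (@ptE0, @ptE1, @ptE2).

Lemma ord3P (P : 'I_3 -> Prop) : P 0 -> P 1 -> P 2 -> forall i, P i.
Proof.
move=> P0 P1 P2 [[|[|[|//]]] Hi].
- by rewrite (_ : Ordinal Hi = 0)//; exact: val_inj.
- by rewrite (_ : Ordinal Hi = 1)//; exact: val_inj.
- by rewrite (_ : Ordinal Hi = 2)//; exact: val_inj.
Qed.

Lemma sum3 {V : nmodType} (F : 'I_3 -> V) : \sum_i F i = F 0 + F 1 + F 2.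
Proof.
rewrite !big_ord_recl big_ord0 addr0 addrA.
by congr (F _ + F _ + F _); apply: val_inj.
Qed.

Definition tp {R : realType} (x : 'rV[R]_3) : R * R * R := (x 0 0, x 0 1, x 0 2).

Lemma tpK {R : realType} : cancel (@tp R) pt.
Proof. by move=> x; apply/rowP; apply: ord3P; rewrite ptE. Qed.

Lemma measurable_pt_coord {R : realType} (i : 'I_3) :
  measurable_fun [set: P3 R]
    (fun p => pt p 0 i : measurableTypeR R).
Proof.
move: i; apply: ord3P.
- under eq_fun do rewrite ptE0.
  exact: (measurableT_comp measurable_fst measurable_fst).
- under eq_fun do rewrite ptE1.
  exact: (measurableT_comp measurable_snd measurable_fst).
- under eq_fun do rewrite ptE2.
  exact: measurable_snd.
Qed.

Lemma rV3_ballP {R : realType} (x y : 'rV[R]_3) (e : R) : 0 < e ->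
  (forall i, `|x 0 i - y 0 i| < e) -> ball x e y.
Proof.
move=> e0 xy; rewrite -ball_normE /ball_ /= /Num.norm /= mx_normrE.
by apply/bigmax_ltP; split => // -[i j] _ /=; rewrite (ord1 i) !mxE; exact: xy.
Qed.

(** An open set is the union of the cubes with rational centre and rational half-side that it
    contains. There are countably many, and each is a finite intersection of measurable conditions
    on single coordinates. *)
Lemma open_measurable_pt {R : realType} (A : set 'rV[R]_3) : open A ->
  measurable (pt @^-1` A : set (P3 R)).
Proof.
move=> oA.
pose rv (q : rat * rat * rat) : 'rV[R]_3 := pt (ratr q.1.1, ratr q.1.2, ratr q.2).
pose Box (u : (rat * rat * rat) * rat) : set (R * R * R) :=
  [set p | forall i, `|rv u.1 0 i - pt p 0 i| < ratr u.2].
pose F u := if asbool (Box u `<=` pt @^-1` A) then Box u else set0.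
rewrite (_ : _ @^-1` _ = \bigcup_u F u); last first.
  apply/seteqP; split => [p /= Ap|p [u _]]; last first.
    by rewrite /F; case: asboolP => // BA /BA.
  have /nbhs_ballP[e /= e0 eA] : nbhs (pt p) A by apply: open_nbhs_nbhs; split.
  have [r /andP[r0 re]] : exists r : rat, (0 < ratr r :> R) && (ratr r < e / 2).
    have := @rat_in_itvoo R 0 (e / 2); case; first by rewrite divr_gt0.
    by move=> r; rewrite in_itv/= => ?; exists r.
  have [q hq] : exists q : rat * rat * rat, forall i, `|rv q 0 i - pt p 0 i| < ratr r.
    have H : forall x : R, exists q : rat, `|ratr q - x| < ratr r.
      move=> x; have [|q] := @rat_in_itvoo R (x - ratr r) (x + ratr r).
        by rewrite ltrBlDr -addrA ltrDl addr_gt0.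
      rewrite in_itv/= => /andP[h1 h2]; exists q.
      by rewrite ltr_norml; lra.
    have [q0 H0] := H p.1.1; have [q1 H1] := H p.1.2; have [q2 H2] := H p.2.
    by exists (q0, q1, q2); apply: ord3P; rewrite /rv !ptE.
  exists (q, r) => //; rewrite /F; case: asboolP => [_|]; first exact: hq.
  case => z zB; apply: eA; apply: rV3_ballP => // i.
  have := hq i; have := zB i => /=; rewrite !ltr_norml.
  lra.
apply: countable_bigcupT_measurable => [|u]; first exact: countableP.
rewrite /F; case: asboolP => // _.
rewrite (_ : Box u = \bigcap_(i in [set: 'I_3]) [set p | `|rv u.1 0 i - pt p 0 i| < ratr u.2]); last first.
  by apply/seteqP; split => [p H i _ //|p H i]; exact: H.
apply: fin_bigcap_measurable => // i _.
rewrite -[X in measurable X]setTI.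
have mf : measurable_fun [set: P3 R]
   (fun p => `|rv u.1 0 i - pt p 0 i| : measurableTypeR R).
  apply: measurableT_comp => //; apply: measurable_funB => //.
  exact: measurable_pt_coord.
have := mf measurableT `]-oo, ratr u.2[%classic (measurable_itv _).
congr measurable; apply/seteqP; split => z /=; rewrite in_itv//=.
Qed.

Lemma continuous_measurable_pt {R : realType} (f : 'rV[R]_3 -> R)
   (D : set (P3 R)) :
  continuous f -> measurable D ->
  measurable_fun D (f \o pt : _ -> measurableTypeR R).
Proof.
move=> cf mD; apply: (@measurable_funS _ _ _ _ setT) => //.
apply: (measurability _ (RGenOpens.measurableE R)) => _ [_ [a [b ->] <-]].
rewrite setTI comp_preimage; apply: open_measurable_pt.
by apply: open_comp => // x _; exact: cf.
Qed.

(** * Translation invariance of Lebesgue measure on R^3 *)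

(** The product measure integrates the measures of sections. The section of the preimage over [x] is
    the preimage under [g] of the section over [f x]: the invariance of [m2] removes [g], that of
    [m1] removes [f] from the outer integral. *)
Lemma product_measure1_pushforward d1 d2 (T1 : measurableType d1)
    (T2 : measurableType d2) (R : realType) (m1 : {measure set T1 -> \bar R})
    (m2 : {sigma_finite_measure set T2 -> \bar R}) (f : T1 -> T1) (g : T2 -> T2) :
  measurable_fun setT f -> measurable_fun setT g ->
  (forall A, measurable A -> m1 (f @^-1` A) = m1 A) ->
  (forall A, measurable A -> m2 (g @^-1` A) = m2 A) ->
  forall A : set (T1 * T2), measurable A ->
    ((m1 \x m2) ((fun p => (f p.1, g p.2)) @^-1` A) = (m1 \x m2) A)%E.
Proof.
move=> mf mg fE gE A mA; rewrite /product_measure1.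
transitivity (\int[m1]_x (((m2 \o xsection A) \o f) x))%E.
  apply: eq_integral => x _ /=.
  rewrite -(gE (xsection A (f x))); last exact: measurable_xsection.
  by congr (m2 _); apply/seteqP; split => y /=; rewrite /xsection/= !inE.
rewrite -[LHS](_ : \int[pushforward m1 f]_(x in setT) (m2 \o xsection A) x = _)%E; last first.
  rewrite ge0_integral_pushforward//.
  exact: measurable_fun_xsection.
apply: eq_measure_integral => B mB _.
exact: fE.
Qed.

(** Uniqueness of Lebesgue measure: the pushforward by the translation has the right value on
    half-open intervals. *)
Lemma lebesgue_measure_shift (R : realType) (a : R) (A : set (measurableTypeR R)) :
  measurable A ->
  lebesgue_measure ((fun x : measurableTypeR R => x + a : measurableTypeR R) @^-1` A) =
  lebesgue_measure A.
Proof.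
move=> mA.
have mf : measurable_fun [set: measurableTypeR R] (fun x : measurableTypeR R => x + a : measurableTypeR R).
  by apply: measurable_funD.
apply/esym.
pose m : measure (measurableTypeR R) R := pushforward (@lebesgue_measure R) (fun x : measurableTypeR R => x + a : measurableTypeR R).
apply: (@lebesgue_measure_unique R (m mf) _ _ mA) => X [[b c] /= bc <-].
rewrite /m /pushforward.
rewrite (_ : _ @^-1` _ = `]b - a, c - a]%classic); last first.
  by apply/seteqP; split => x /=; rewrite !in_itv/= ltrBlDr lerBrDr.
rewrite !lebesgue_measure_itv/= !lte_fin ltrD2r.
case: ifPn => // _.
by rewrite -!EFinB; congr EFin; ring.
Qed.

Definition shift3 {R : realType} (y : 'rV[R]_3) (p : P3 R) : P3 R :=
  (p.1.1 + y 0 0, p.1.2 + y 0 1, p.2 + y 0 2).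

Lemma pt_shift3 {R : realType} (y : 'rV[R]_3) p : pt (shift3 y p) = pt p + y.
Proof. by apply/rowP; apply: ord3P; rewrite [RHS]mxE !ptE. Qed.

Lemma measurable_shift3 {R : realType} (y : 'rV[R]_3) :
  measurable_fun setT (shift3 y).
Proof.
have H i : measurable_fun [set: P3 R] (fun p => pt p 0 i + y 0 i : measurableTypeR R).
  by apply: measurable_funD => //; exact: measurable_pt_coord.
rewrite (_ : shift3 y = fun p => (pt p 0 0 + y 0 0, pt p 0 1 + y 0 1, pt p 0 2 + y 0 2)); last first.
  by apply/funext => p; rewrite !ptE.
by apply: measurable_fun_pair => //; apply: measurable_fun_pair => //.
Qed.

Lemma leb3_shift (R : realType) (y : 'rV[R]_3) (A : set (P3 R)) : measurable A ->
  leb3 R (shift3 y @^-1` A) = leb3 R A.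
Proof.
move=> mA.
have ms (a : R) : measurable_fun [set: measurableTypeR R] (fun x : measurableTypeR R => x + a : measurableTypeR R).
  by apply: measurable_funD.
rewrite /leb3/=.
have := @product_measure1_pushforward _ _ _ _ R (@lebesgue_measure R \x @lebesgue_measure R)%E
  (@lebesgue_measure R) (fun p => (p.1 + y 0 0, p.2 + y 0 1)) (fun x => x + y 0 2) _ (ms _) _ _ A mA.
apply.
- apply: measurable_fun_pair; apply: measurable_funD => //.
- move=> B mB.
  have := @product_measure1_pushforward _ _ _ _ R (@lebesgue_measure R)
    (@lebesgue_measure R) (fun x => x + y 0 0) (fun x => x + y 0 1) (ms _) (ms _) _ _ B mB.
  by apply; exact: lebesgue_measure_shift.
- exact: lebesgue_measure_shift.
Qed.

(** * Cubes and integrals of exponentials *)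

Definition box3 {R : realType} (x : 'rV[R]_3) (r : R) : set 'rV[R]_3 :=
  [set y | forall i, `|y 0 i - x 0 i| < r].

Lemma box3E {R : realType} (x : 'rV[R]_3) (r : R) :
  pt @^-1` box3 x r = ((ball (x 0 0) r `*` ball (x 0 1) r) `*` ball (x 0 2) r : set (P3 R)).
Proof.
apply/seteqP; split => [[[a b] c] /= H|[[a b] c] /= [[Ha Hb] Hc]].
  have := (H 0, H 1, H 2).
  rewrite !ptE/= -ball_normE/= ![`|x _ _ - _|]distrC => -[[-> ->] ->]//.
move: Ha Hb Hc; rewrite -ball_normE/= => Ha Hb Hc.
by apply: ord3P; rewrite !ptE/= distrC.
Qed.

Lemma measurable_box3 {R : realType} (x : 'rV[R]_3) (r : R) :
  measurable (pt @^-1` box3 x r : set (P3 R)).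
Proof.
by rewrite box3E; apply: measurableX; [apply: measurableX|]; exact: measurable_ball.
Qed.

Lemma leb3_box3 {R : realType} (x : 'rV[R]_3) (r : R) : 0 <= r ->
  leb3 R (pt @^-1` box3 x r) = ((2 * r) ^+ 3)%:E.
Proof.
move=> r0; rewrite box3E /leb3.
rewrite [LHS]product_measure1E; [|by apply: measurableX; exact: measurable_ball|exact: measurable_ball].
rewrite [X in (X * _)%E]product_measure1E; [|exact: measurable_ball..].
transitivity (lebesgue_measure (ball (x 0%R 0%R) r) * lebesgue_measure (ball (x 0%R 1%R) r) * lebesgue_measure (ball (x 0%R 2%R) r))%E; first by [].
rewrite !lebesgue_measure_ball// -!EFinM.
by congr EFin; rewrite -mulr_natl; ring.
Qed.

(** The l1 norm, chosen because [expR (- a * S1 x)] is a product of functions of one coordinate and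
    can be integrated exactly. Multiples of this exponential are the majorants for the transforms
    below. *)
Definition S1 {R : realType} (x : 'rV[R]_3) : R := `|x 0 0| + `|x 0 1| + `|x 0 2|.

Lemma integral_exp_abs {R : realType} (a : R) : 0 < a ->
  (\int[@lebesgue_measure R]_x (expR (- a * `|x|))%:E = (2 / a)%:E)%E.
Proof.
move=> a0.
rewrite ge0_symfun_integralT; [|by move=> x; exact: expR_ge0| |by move=> x /=; rewrite normrN]; last first.
  move=> x; apply: continuous_comp; last exact: continuous_expR.
  by apply: continuousM; [exact: cst_continuous|exact: norm_continuous].
have : (\int[@lebesgue_measure R]_(x in `[0%R, +oo[) (a * expR (- a * x))%:E = 1)%E.
  rewrite -(integral_exponential_pdf a0) integral_mkcond; apply: eq_integral => x _.
  by rewrite /exponential_pdf /patch; case: ifP.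
under eq_integral do rewrite EFinM.
rewrite ge0_integralZl//; last 2 first.
- apply/measurable_EFinP; apply: measurableT_comp => //.
- by rewrite lee_fin ltW.
rewrite (_ : [set x | 0 <= x] = `[0, +oo[%classic); last by apply/seteqP; split => x /=; rewrite in_itv/= andbT.
move=> H.
rewrite (_ : \int[lebesgue_measure]_(x in `[0%R, +oo[) (expR (- a * `|x|))%:E = a^-1%:E)%E; first by rewrite -EFinM.
have -> : (\int[lebesgue_measure]_(x in `[0%R, +oo[) (expR (- a * `|x|))%:E = \int[lebesgue_measure]_(x in `[0%R, +oo[) (expR (- a * x))%:E)%E.
  by apply: eq_integral => x; rewrite inE/= in_itv/= andbT => x0; rewrite ger0_norm.
rewrite -[LHS]mul1e -(mulVf (lt0r_neq0 a0)) EFinM -muleA.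
by move: H => /= ->; rewrite mule1.
Qed.

Lemma measurable_S1 {R : realType} (D : set (P3 R)) :
  measurable D -> measurable_fun D (fun p => S1 (pt p) : measurableTypeR R).
Proof.
move=> mD; apply: (@measurable_funS _ _ _ _ setT) => //.
have H i : measurable_fun [set: P3 R] (fun p => `|pt p 0 i| : measurableTypeR R).
  by apply: measurableT_comp => //; exact: measurable_pt_coord.
by apply: measurable_funD; [apply: measurable_funD|]; exact: H.
Qed.

(* An alias: the library keys its sigma-finiteness instances for product measures on
   subprobabilities. *)
Definition leb2 {R : realType} : set (measurableTypeR R * measurableTypeR R) -> \bar R :=
  (@lebesgue_measure R \x @lebesgue_measure R)%E.

HB.instance Definition _ (R : realType) := Measure.copy (@leb2 R)
  (@lebesgue_measure R \x @lebesgue_measure R)%E.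

Lemma sigma_finite_lebesgue2 {R : realType} :
  sigma_finite setT (@leb2 R).
Proof.
exists (fun n : nat => ball 0 n%:R `*` ball 0 n%:R : set (measurableTypeR R * measurableTypeR R)).
  apply/esym/seteqP; split => // -[x y] _.
  exists (Num.bound (`|x| + `|y|)) => //.
  have := archi_boundP (addr_ge0 (normr_ge0 x) (normr_ge0 y)) => H.
  split; rewrite -ball_normE /ball_/= sub0r normrN; apply: le_lt_trans H.
    by rewrite lerDl.
  by rewrite lerDr.
move=> n; split; first by apply: measurableX; exact: measurable_ball.
rewrite /leb2 product_measure1E; [|exact: measurable_ball..].
have E : lebesgue_measure (ball (0 : R) n%:R) = (n%:R *+ 2)%:E by rewrite lebesgue_measure_ball.
by rewrite [X in (X * _)%E]E [X in (_ * X)%E]E -EFinM ltry.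
Qed.

HB.instance Definition _ (R : realType) :=
  @Measure_isSigmaFinite.Build _ _ R (@leb2 R) sigma_finite_lebesgue2.

Lemma integral_expS1 {R : realType} (a : R) : 0 < a ->
  (\int[leb3 R]_p (expR (- a * S1 (pt p)))%:E = ((2 / a) ^+ 3)%:E)%E.
Proof.
move=> a0; rewrite /leb3.
pose e (t : R) := expR (- a * `|t|).
have me : measurable_fun [set: measurableTypeR R] (EFin \o e).
  apply/measurable_EFinP; apply: measurableT_comp => //.
  by apply: measurable_funM => //.
have e0 t : (0 <= (e t)%:E)%E by rewrite lee_fin expR_ge0.
have E1 := integral_exp_abs a0.
have E2 : (\int[@lebesgue_measure R \x @lebesgue_measure R]_p (e p.1 * e p.2)%:E = ((2 / a) ^+ 2)%:E)%E.
  rewrite fubini_tonelli1//=; last 2 first.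
  - apply/measurable_EFinP; apply: measurable_funM.
    + by apply: (measurableT_comp (f := e)) => //; exact/measurable_EFinP.
    + by apply: (measurableT_comp (f := e)) => //; exact/measurable_EFinP.
  - by move=> x; rewrite lee_fin mulr_ge0// expR_ge0.
  rewrite /fubini_F/=.
  under eq_integral.
    move=> x _.
    under eq_integral do rewrite EFinM.
    rewrite ge0_integralZl//.
    rewrite E1 muleC; over.
  rewrite ge0_integralZl//; last by rewrite lee_fin divr_ge0// ltW.
  by rewrite E1 -EFinM expr2.
rewrite (_ : (fun p => _) = (fun p => ((e p.1.1 * e p.1.2) * e p.2)%:E)); last first.
  by apply/funext => p; rewrite /S1 !ptE !mulrDr !expRD.
have mF : measurable_fun [set: P3 R] (fun p => ((e p.1.1 * e p.1.2) * e p.2)%:E).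
  apply/measurable_EFinP; apply: measurable_funM; last first.
    by apply: (measurableT_comp (f := e)) => //; exact/measurable_EFinP.
  apply: measurable_funM.
    apply: (measurableT_comp (f := e)); first exact/measurable_EFinP.
    exact: (measurableT_comp measurable_fst measurable_fst).
  apply: (measurableT_comp (f := e)); first exact/measurable_EFinP.
  exact: (measurableT_comp measurable_snd measurable_fst).
have F0 (p : P3 R) : (0 <= ((e p.1.1 * e p.1.2) * e p.2)%:E)%E.
  by rewrite lee_fin !mulr_ge0// expR_ge0.
transitivity (\int[@leb2 R]_x fubini_F (@lebesgue_measure R) (fun p : P3 R => ((e p.1.1 * e p.1.2) * e p.2)%:E) x)%E.
  exact: (@fubini_tonelli1 _ _ _ _ R (@leb2 R) (@lebesgue_measure R) _ mF F0).
rewrite /fubini_F/=.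
under eq_integral.
  move=> x _.
  under eq_integral do rewrite EFinM.
  rewrite ge0_integralZl//; last by rewrite lee_fin mulr_ge0// expR_ge0.
  rewrite E1 muleC; over.
rewrite ge0_integralZl//; last 3 first.
- apply/measurable_EFinP; apply: measurable_funM.
    by apply: (measurableT_comp (f := e)) => //; exact/measurable_EFinP.
  by apply: (measurableT_comp (f := e)) => //; exact/measurable_EFinP.
- by move=> x _; rewrite lee_fin mulr_ge0// expR_ge0.
- by rewrite lee_fin divr_ge0// ltW.
by rewrite E2 -EFinM -exprS.
Qed.
(** The l1 norm of a complex number, with values in [R]. It is comparable with the modulus and
    submultiplicative, and suits integrals taken separately over real and imaginary parts. *)
Definition n1 {R : realType} (z : R[i]) : R := `|complex.Re z| + `|complex.Im z|.

(** * Integrals of complex functions *)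

Section complex_parts.
Context {R : realType}.
Implicit Types z w : R[i].

Lemma complex_eqP z w : complex.Re z = complex.Re w -> complex.Im z = complex.Im w -> z = w.
Proof. by case: z => a b; case: w => c d /= -> ->. Qed.

Lemma ReD z w : complex.Re (z + w) = complex.Re z + complex.Re w.
Proof. by case: z => a b; case: w. Qed.

Lemma ImD z w : complex.Im (z + w) = complex.Im z + complex.Im w.
Proof. by case: z => a b; case: w. Qed.

Lemma ReN z : complex.Re (- z) = - complex.Re z.
Proof. by case: z. Qed.

Lemma ImN z : complex.Im (- z) = - complex.Im z.
Proof. by case: z. Qed.

Lemma ReM z w : complex.Re (z * w) =
  complex.Re z * complex.Re w - complex.Im z * complex.Im w.
Proof. by case: z => a b; case: w. Qed.

Lemma ImM z w : complex.Im (z * w) =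
  complex.Re z * complex.Im w + complex.Im z * complex.Re w.
Proof. by case: z => a b; case: w. Qed.

Definition ReImE := (ReD, ImD, ReN, ImN, ReM, ImM).

Lemma n1_ge0 z : 0 <= n1 z.
Proof. by rewrite addr_ge0. Qed.

Lemma n1_eq0 z : n1 z = 0 -> z = 0.
Proof.
case: z => a b; rewrite /n1/= => /eqP.
by rewrite paddr_eq0// !normr_eq0 => /andP[/eqP -> /eqP ->].
Qed.

Lemma n10 : n1 (0 : R[i]) = 0.
Proof. by rewrite /n1/= normr0 addr0. Qed.

Lemma n1D z w : n1 (z + w) <= n1 z + n1 w.
Proof.
rewrite /n1 !ReImE.
have := ler_normD (complex.Re z) (complex.Re w).
have := ler_normD (complex.Im z) (complex.Im w).
lra.
Qed.

Lemma n1N z : n1 (- z) = n1 z.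
Proof. by rewrite /n1 !ReImE !normrN. Qed.

Lemma n1B z w : n1 (z - w) <= n1 z + n1 w.
Proof. by rewrite -(n1N w) n1D. Qed.

Lemma n1M z w : n1 (z * w) <= n1 z * n1 w.
Proof.
rewrite /n1 !ReImE.
have := ler_normB (complex.Re z * complex.Re w) (complex.Im z * complex.Im w).
have := ler_normD (complex.Re z * complex.Im w) (complex.Im z * complex.Re w).
rewrite !normrM; lra.
Qed.

Lemma n1R (a : R) : n1 (a%:C) = `|a|.
Proof. by rewrite /n1/= normr0 addr0. Qed.

End complex_parts.

Section complex_integral.
Context {R : realType}.
Notation mu := (leb3 R).
Implicit Types (D : set (P3 R)) (f g : P3 R -> R[i]).

Definition cint D f : R[i] :=
  (\int[mu]_(p in D) complex.Re (f p)) +i* (\int[mu]_(p in D) complex.Im (f p)).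

Definition cintegrable D f : Prop :=
  mu.-integrable D (fun p => (complex.Re (f p))%:E) /\
  mu.-integrable D (fun p => (complex.Im (f p))%:E).

Definition cmeasurable D f : Prop :=
  measurable_fun D (fun p => complex.Re (f p) : measurableTypeR R) /\
  measurable_fun D (fun p => complex.Im (f p) : measurableTypeR R).

Lemma cmeasurableM D f g : cmeasurable D f -> cmeasurable D g ->
  cmeasurable D (fun p => f p * g p).
Proof.
move=> [f1 f2] [g1 g2]; split.
- under eq_fun do rewrite ReM.
  by apply: measurable_funB; exact: measurable_funM.
- under eq_fun do rewrite ImM.
  by apply: measurable_funD; exact: measurable_funM.
Qed.

Lemma cintegrable_le D f (h : P3 R -> R) : measurable D -> cmeasurable D f ->
  mu.-integrable D (EFin \o h) -> (forall p, D p -> n1 (f p) <= h p) ->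
  cintegrable D f.
Proof.
move=> mD [f1 f2] ih fh; split.
- apply: (le_integrable mD _ _ ih); first exact/measurable_EFinP.
  move=> p Dp /=; rewrite lee_fin; apply: le_trans (ler_norm _).
  by apply: le_trans (fh _ Dp); rewrite /n1 lerDl.
- apply: (le_integrable mD _ _ ih); first exact/measurable_EFinP.
  move=> p Dp /=; rewrite lee_fin; apply: le_trans (ler_norm _).
  by apply: le_trans (fh _ Dp); rewrite /n1 lerDr.
Qed.

Lemma cintegrableD D f g : measurable D -> cintegrable D f -> cintegrable D g ->
  cintegrable D (fun p => f p + g p).
Proof.
move=> mD [f1 f2] [g1 g2]; split.
- have := integrableD mD f1 g1; apply: eq_integrable => // p _ /=.
  by rewrite ReD.
- have := integrableD mD f2 g2; apply: eq_integrable => // p _ /=.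
  by rewrite ImD.
Qed.

Lemma cintegrableZ D f (c : R[i]) : measurable D -> cintegrable D f ->
  cintegrable D (fun p => c * f p).
Proof.
move=> mD [f1 f2]; split.
- have := integrableD mD (integrableZl mD (complex.Re c) f1) (integrableZl mD (- complex.Im c) f2).
  by apply: eq_integrable => // p _ /=; rewrite ReM -EFinD mulNr.
- have := integrableD mD (integrableZl mD (complex.Re c) f2) (integrableZl mD (complex.Im c) f1).
  by apply: eq_integrable => // p _ /=; rewrite ImM -EFinD.
Qed.

Lemma cintegrableN D f : measurable D -> cintegrable D f -> cintegrable D (fun p => - f p).
Proof.
by move=> mD /(cintegrableZ (-1) mD); under eq_fun do rewrite mulN1r.
Qed.

Lemma cintegrableB D f g : measurable D -> cintegrable D f -> cintegrable D g ->
  cintegrable D (fun p => f p - g p).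
Proof. by move=> mD fi gi; apply: cintegrableD => //; exact: cintegrableN. Qed.

Lemma cintegrableS D E f : measurable D -> measurable E -> E `<=` D ->
  cintegrable D f -> cintegrable E f.
Proof. by move=> mD mE ED [f1 f2]; split; apply: (@integrableS _ _ _ _ D). Qed.

Lemma cintD D f g : measurable D -> cintegrable D f -> cintegrable D g ->
  cint D (fun p => f p + g p) = cint D f + cint D g.
Proof.
move=> mD [f1 f2] [g1 g2]; rewrite /cint; apply: complex_eqP => /=.
- by under eq_Rintegral do rewrite ReD; rewrite RintegralD.
- by under eq_Rintegral do rewrite ImD; rewrite RintegralD.
Qed.

Lemma cintZ D f (c : R[i]) : measurable D -> cintegrable D f ->
  cint D (fun p => c * f p) = c * cint D f.
Proof.
move=> mD [f1 f2]; rewrite /cint; apply: complex_eqP; rewrite !ReImE/=.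
- under eq_Rintegral do rewrite ReM.
  by rewrite RintegralB ?RintegralZl//; [exact: (integrableZl mD (complex.Re c) f1)|exact: (integrableZl mD (complex.Im c) f2)].
- under eq_Rintegral do rewrite ImM.
  by rewrite RintegralD ?RintegralZl//; [exact: (integrableZl mD (complex.Re c) f2)|exact: (integrableZl mD (complex.Im c) f1)].
Qed.

Lemma cintN D f : measurable D -> cintegrable D f ->
  cint D (fun p => - f p) = - cint D f.
Proof.
by move=> mD fi; rewrite -mulN1r -cintZ//; congr cint; apply/funext => p; rewrite mulN1r.
Qed.

Lemma cintB D f g : measurable D -> cintegrable D f -> cintegrable D g ->
  cint D (fun p => f p - g p) = cint D f - cint D g.
Proof.
by move=> mD fi gi; rewrite cintD ?cintN//; exact: cintegrableN.
Qed.

Lemma eq_cint D f g : (forall p, D p -> f p = g p) -> cint D f = cint D g.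
Proof.
by move=> fg; congr (_ +i* _); apply: eq_Rintegral => p /set_mem Dp; rewrite fg.
Qed.

Lemma eq_cintegrable D f g : measurable D -> (forall p, D p -> f p = g p) ->
  cintegrable D f -> cintegrable D g.
Proof.
move=> mD fg [f1 f2]; split.
- by move: f1; apply: eq_integrable => // p /set_mem Dp; rewrite fg.
- by move: f2; apply: eq_integrable => // p /set_mem Dp; rewrite fg.
Qed.

Lemma cint_setU D E f : measurable D -> measurable E -> cintegrable (D `|` E) f ->
  [disjoint D & E] -> cint (D `|` E) f = cint D f + cint E f.
Proof.
move=> mD mE [f1 f2] DE; apply: complex_eqP; rewrite ?ReImE /=.
- by rewrite Rintegral_setU.
- by rewrite Rintegral_setU.
Qed.

Lemma cint_mkcondr D E f :
  cint (D `&` E) f = cint D (fun p => if p \in E then f p else 0).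
Proof.
rewrite /cint; congr (_ +i* _).
- rewrite Rintegral_mkcondr; apply: eq_Rintegral => p _.
  by rewrite /patch; case: ifP.
- rewrite Rintegral_mkcondr; apply: eq_Rintegral => p _.
  by rewrite /patch; case: ifP.
Qed.

(** The minimum of [f] and [g] is below [g] everywhere and differs from [f] only on a null set. *)
Lemma ae_le_Rintegral D (f g : P3 R -> R) : measurable D ->
  mu.-integrable D (EFin \o f) -> mu.-integrable D (EFin \o g) ->
  {ae mu, forall p, D p -> f p <= g p} ->
  \int[mu]_(p in D) f p <= \int[mu]_(p in D) g p.
Proof.
move=> mD fi gi fg.
have mf : measurable_fun D f by apply/measurable_EFinP; exact: measurable_int fi.
have mg : measurable_fun D g by apply/measurable_EFinP; exact: measurable_int gi.
have mi : mu.-integrable D (EFin \o (fun p => Num.min (f p) (g p))).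
  have h := integrableD mD (integrable_norm fi) (integrable_norm gi).
  apply: (le_integrable mD _ _ h).
    by apply/measurable_EFinP; exact: measurable_minr.
  move=> p Dp /=; rewrite lee_fin [leRHS]ger0_norm ?addr_ge0//.
  by rewrite /Num.min; case: ifP => _; rewrite ?lerDl ?lerDr.
rewrite (_ : \int[mu]_(p in D) f p = \int[mu]_(p in D) Num.min (f p) (g p)).
  by apply: le_Rintegral => // p Dp; rewrite ge_min lexx orbT.
congr fine; apply: ae_eq_integral => //.
- exact/measurable_EFinP.
- by apply/measurable_EFinP; exact: measurable_minr.
- by move: fg; apply: filterS => p H Dp; rewrite min_l// H.
Qed.

Lemma cint_le D f (h : P3 R -> R) : measurable D -> cintegrable D f ->
  mu.-integrable D (EFin \o h) -> {ae mu, forall p, D p -> n1 (f p) <= h p} ->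
  n1 (cint D f) <= 2 * \int[mu]_(p in D) h p.
Proof.
move=> mD [f1 f2] ih fh; rewrite /n1/= mulr2n mulrDl !mul1r lerD//.
- apply: le_trans (le_normr_Rintegral mD f1) _.
  apply: ae_le_Rintegral => //; first exact: integrable_norm f1.
  by move: fh; apply: filterS => p H Dp; apply: le_trans (H Dp); rewrite /n1 lerDl.
- apply: le_trans (le_normr_Rintegral mD f2) _.
  apply: ae_le_Rintegral => //; first exact: integrable_norm f2.
  by move: fh; apply: filterS => p H Dp; apply: le_trans (H Dp); rewrite /n1 lerDr.
Qed.

Lemma cint_shift (y : 'rV[R]_3) D f : measurable D -> cmeasurable setT f ->
  cintegrable (shift3 y @^-1` D) (f \o shift3 y) ->
  cint D f = cint (shift3 y @^-1` D) (f \o shift3 y).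
Proof.
move=> mD [f1 f2] [i1 i2].
have E (g : P3 R -> R) : measurable_fun [set: P3 R] (g : P3 R -> measurableTypeR R) ->
    mu.-integrable (shift3 y @^-1` D) (EFin \o (g \o shift3 y)) ->
    \int[mu]_(p in D) g p = \int[mu]_(p in shift3 y @^-1` D) g (shift3 y p).
  move=> mg ig; congr fine.
  have mg' : measurable_fun [set: P3 R] (EFin \o g) by exact/measurable_EFinP.
  transitivity (\int[pushforward mu (shift3 y)]_(p in D) (g p)%:E)%E; last first.
    exact: (@integral_pushforward _ _ _ _ R (shift3 y) (measurable_shift3 y) mu D (EFin \o g) mg' ig mD).
  apply: eq_measure_integral; first exact: measurable_shift3.
  by move=> ? A mA _; apply/esym; exact: leb3_shift.
by rewrite /cint (E _ f1 i1) (E _ f2 i2).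
Qed.

End complex_integral.

(** * Smooth functions and cutoffs *)

Section smooth_functions.
Context {R : realType}.
Implicit Types (f g : 'rV[R]_3 -> R) (h : R -> R).

(** Derivatives are supplied as witnesses, so that closure under products, inverses and composition
    is an induction on [k] that exhibits the derivative. [Cinf_smooth] returns to iterated partial
    derivatives. *)
Fixpoint Ck k f : Prop := continuous f /\
  if k is k'.+1 then
    forall i, exists2 g, (forall x, is_derive x (delta_mx 0 i) f (g x)) & Ck k' g
  else True.

Fixpoint Dk k h : Prop := continuous h /\
  if k is k'.+1 then exists2 g, (forall x, is_derive x (1 : R) h (g x)) & Dk k' g
  else True.

Definition Cinf f := forall k, Ck k f.
Definition Dinf h := forall k, Dk k h.

Lemma CkW k f : Ck k.+1 f -> Ck k f.
Proof.
elim: k f => [|k IH] f [cf fd]; split => // i.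
by have [g fg gk] := fd i; exists g => //; exact: IH.
Qed.

Lemma is_derive_partial i f g : (forall x, is_derive x (delta_mx 0 i) f (g x)) ->
  partial i f = g.
Proof. by move=> fg; apply/funext => x; rewrite /partial; exact: (@derive_val _ _ _ _ _ _ _ (fg x)). Qed.

Lemma Cinf_partial i f : Cinf f -> Cinf (partial i f).
Proof.
move=> fC k; have [cf /(_ i)[g fg gk]] := fC k.+1.
by rewrite (is_derive_partial fg).
Qed.

Lemma Cinf_is_derive i f x : Cinf f -> is_derive x (delta_mx 0 i) f (partial i f x).
Proof.
by move=> /(_ 1%N)[cf /(_ i)[g fg gk]]; rewrite (is_derive_partial fg).
Qed.

Lemma Cinf_continuous f : Cinf f -> continuous f.
Proof. by move=> /(_ 0%N)[]. Qed.

Lemma Cinf_smooth f : Cinf f -> smooth f.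
Proof.
move=> fC s; have sC : Cinf (partials s f).
  by elim: s => //= i s IH; exact: Cinf_partial.
split; first exact: Cinf_continuous.
by move=> i x; exact: (@ex_derive _ _ _ _ _ _ _ (Cinf_is_derive i x sC)).
Qed.

Lemma Ck_cst k (c : R) : Ck k (fun=> c).
Proof.
elim: k c => [|k IH] c; (split; first exact: cst_continuous) => // i.
by exists (fun=> 0) => // x; exact: is_derive_cst.
Qed.

Lemma CkD k f g : Ck k f -> Ck k g -> Ck k (fun x => f x + g x).
Proof.
elim: k f g => [|k IH] f g [cf fd] [cg gd];
  (split; first by move=> x; exact: (continuousD (cf x) (cg x))) => // i.
have [f' ff' fk] := fd i; have [g' gg' gk] := gd i.
exists (fun x => f' x + g' x); last exact: IH.
by move=> x; exact: is_deriveD.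
Qed.

Lemma CkM k f g : Ck k f -> Ck k g -> Ck k (fun x => f x * g x).
Proof.
elim: k f g => [|k IH] f g.
  by move=> [cf _] [cg _]; split => // x; exact: (continuousM (cf x) (cg x)).
move=> fk' gk'; have [fk gk] := (CkW fk', CkW gk').
case: fk' gk' => [cf fd] [cg gd].
split; first by move=> x; exact: (continuousM (cf x) (cg x)).
move=> i.
have [f' ff' f'k] := fd i; have [g' gg' g'k] := gd i.
exists (fun x => f x * g' x + g x * f' x); last by apply: CkD; exact: IH.
by move=> x; exact: is_deriveM.
Qed.

(** The two difference quotients are the same function of [t]. This transfers the chain rule from
    one variable to directional derivatives. *)
Lemma is_derive_line (f : 'rV[R]_3 -> R) (x v : 'rV[R]_3) (d : R) :
  is_derive x v f d <-> is_derive (0 : R) (1 : R) (fun t : R => f (t *: v + x)) d.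
Proof.
have E : (fun t : R => t^-1 *: (((fun t : R => f (t *: v + x)) \o shift 0) (t *: (1 : R)) - f (0 *: v + x)))
   = (fun t : R => t^-1 *: ((f \o shift x) (t *: v) - f x)).
  by apply/funext => t /=; rewrite addr0 scale0r add0r [t *: 1]mulr1.
split => -[h1 h2]; split.
- by rewrite /derivable E.
- by rewrite -h2 /derive E.
- by move: h1; rewrite /derivable E.
- by rewrite -h2 /derive E.
Qed.

Lemma is_derive_comp1 h f x v (a b : R) : is_derive (f x) (1 : R) h a ->
  is_derive x v f b -> is_derive x v (fun y => h (f y)) (a * b).
Proof.
move=> ha /is_derive_line fb; apply/is_derive_line.
apply: (@is_derive1_comp _ h (fun t : R => f (t *: v + x))) => //.
by rewrite scale0r add0r.
Qed.

Lemma Ck_comp k h f : Dk k h -> Ck k f -> Ck k (fun x => h (f x)).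
Proof.
elim: k h f => [|k IH] h f.
  by move=> [ch _] [cf _]; split => // x; apply: continuous_comp; [exact: cf|exact: ch].
move=> hk' fk'; have fk := CkW fk'.
case: hk' fk' => [ch [h' hh' h'k]] [cf fd].
split; first by move=> x; apply: continuous_comp; [exact: cf|exact: ch].
move=> i; have [f' ff' f'k] := fd i.
exists (fun x => h' (f x) * f' x); last by apply: CkM => //; exact: IH.
by move=> x; exact: is_derive_comp1.
Qed.

Lemma CkV k f : (forall x, 0 < f x) -> Ck k f -> Ck k (fun x => (f x)^-1).
Proof.
move=> f0; elim: k f f0 => [|k IH] f f0.
  by move=> [cf _]; split => // x; exact: (continuousV (lt0r_neq0 (f0 x)) (cf x)).
move=> fk'; have fk := CkW fk'.
case: fk' => [cf fd].
split; first by move=> x; exact: (continuousV (lt0r_neq0 (f0 x)) (cf x)).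
move=> i; have [f' ff' f'k] := fd i.
exists (fun x => (- 1 * ((f x)^-1 * (f x)^-1)) * f' x); last first.
  by apply: CkM => //; apply: CkM; [exact: Ck_cst|apply: CkM; exact: IH].
move=> x; apply: (@is_derive_comp1 (fun t => t^-1)) => //.
have := @is_deriveV R id (f x) 1 1; rewrite /= gt_eqF// => /(_ isT (is_derive_id _ _)).
by rewrite scaler1 mulN1r -invfM expr2.
Qed.

Lemma Ck_coord k (i : 'I_3) : Ck k (fun x => x 0 i).
Proof.
case: k => [|k]; (split; first by move=> x; exact: coord_continuous) => // j.
exists (fun=> @delta_mx R 1 3 0 j 0 i); last exact: Ck_cst.
move=> x; apply/is_derive_line.
rewrite (_ : (fun t : R => _) = (fun t : R => t * @delta_mx R 1 3 0 j 0 i + x 0 i)); last first.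
  by apply/funext => t; rewrite mxE [in LHS]mxE.
rewrite -[X in is_derive _ _ _ X]addr0; apply: is_deriveD.
rewrite -[X in is_derive _ _ _ X](_ : 0 *: 0 + (@delta_mx R 1 3 0 j 0 i) *: 1 = _); last first.
  by rewrite scaler0 add0r [_ *: 1]mulr1.
exact: is_deriveM.
Qed.

Lemma Cinf_cst (c : R) : Cinf (fun=> c).
Proof. by move=> k; exact: Ck_cst. Qed.

Lemma CinfD f g : Cinf f -> Cinf g -> Cinf (fun x => f x + g x).
Proof. by move=> fC gC k; exact: CkD. Qed.

Lemma CinfM f g : Cinf f -> Cinf g -> Cinf (fun x => f x * g x).
Proof. by move=> fC gC k; exact: CkM. Qed.

Lemma CinfV f : (forall x, 0 < f x) -> Cinf f -> Cinf (fun x => (f x)^-1).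
Proof. by move=> f0 fC k; exact: CkV. Qed.

Lemma Cinf_comp h f : Dinf h -> Cinf f -> Cinf (fun x => h (f x)).
Proof. by move=> hC fC k; exact: Ck_comp. Qed.

Lemma Cinf_coord (i : 'I_3) : Cinf (fun x => x 0 i).
Proof. by move=> k; exact: Ck_coord. Qed.

Lemma Dinf_expR : Dinf (@expR R).
Proof.
elim => [|k IH]; (split; first exact: continuous_expR) => //.
by exists expR => //; exact: is_derive_expR.
Qed.

(** The span of cosine and sine is closed under differentiation, as the induction on [k]
    requires. *)
Lemma Dinf_trig (a b : R) : Dinf (fun t => a * cos t + b * sin t).
Proof.
move=> k; elim: k a b => [|k IH] a b;
  (split; first by move=> t; exact: (continuousD (continuousM (@cst_continuous _ _ a t) (@continuous_cos R t))
    (continuousM (@cst_continuous _ _ b t) (@continuous_sin R t)))) => //.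
exists (fun t => b * cos t + (- a) * sin t) => // t.
rewrite (_ : b * cos t + - a * sin t = (a *: (- sin t) + cos t *: 0) + (b *: cos t + sin t *: 0)).
  by apply: is_deriveD; apply: is_deriveM.
by rewrite !scaler0 !addr0 mulNr addrC [_ *: _]mulrN.
Qed.

End smooth_functions.

(** * A smooth cutoff around the apex *)

Section cutoff.
Context {R : realType}.

(** The functions p(1/t) exp(-1/t), extended by 0 to t <= 0. The family is closed under
    differentiation, [p] becoming X^2 (p - p'), so all its members are smooth, in particular
    [flat 1]. *)
Definition flat (p : {poly R}) (t : R) : R :=
  if 0 < t then p.[t^-1] * expR (- t^-1) else 0.

(** Induction on the polynomial with [a] general: for q X + c, half of the exponent controls q, and
    the other half the new factor [s], since s exp(-a s / 2) <= 2 / a. *)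
Lemma poly_expR_bounded (p : {poly R}) (a : R) : 0 < a ->
  exists2 C, 0 <= C & forall s, 0 <= s -> `|p.[s]| * expR (- (a * s)) <= C.
Proof.
elim/poly_ind: p a => [|p c IH] a a0.
  by exists 0 => // s _; rewrite horner0 normr0 mul0r.
have a20 : 0 < a / 2 by rewrite divr_gt0.
have [C C0 HC] := IH _ a20.
exists (C * (a / 2)^-1 + `|c|) => [|s s0].
  by rewrite addr_ge0// mulr_ge0// invr_ge0 ltW.
rewrite hornerMXaddC.
have e1 : expR (- (a * s)) <= 1 by rewrite expR_le1 oppr_le0 mulr_ge0// ltW.
apply: (@le_trans _ _ ((`|p.[s]| * s + `|c|) * expR (- (a * s)))).
  rewrite ler_wpM2r ?expR_ge0//; apply: le_trans (ler_normD _ _) _.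
  by rewrite normrM (ger0_norm s0).
rewrite mulrDl lerD//; last by rewrite ler_piMr.
rewrite (_ : - (a * s) = - (a / 2 * s) + - (a / 2 * s)); last by field.
rewrite expRD mulrACA; apply: ler_pM; rewrite ?(mulr_ge0, expR_ge0, normr_ge0)//.
- exact: HC.
- rewrite expRN ler_pdivrMr ?expR_gt0//.
  rewrite -ler_pdivrMl ?invr_gt0// invrK.
  by have := expR_ge1Dx (a / 2 * s); lra.
Qed.

Lemma flat_mulX (p : {poly R}) (t : R) : t != 0 -> t^-1 * flat p t = flat ('X * p) t.
Proof.
by move=> t0; rewrite /flat; case: ifP => _; rewrite ?mulr0// hornerM hornerX mulrA.
Qed.

(** Applied to ['X * p], whose [flat] function is the difference quotient of [flat p] at 0: the
    bound makes that quotient tend to 0. *)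
Lemma flat_le (p : {poly R}) : exists2 C, 0 <= C & forall t, `|flat p t| <= C * `|t|.
Proof.
have [C C0 HC] := poly_expR_bounded ('X * p) ltr01.
exists C => // t; rewrite /flat; case: ifPn => [t0|_]; last by rewrite normr0 mulr_ge0.
have := HC t^-1; rewrite invr_ge0 (ltW t0) mul1r => /(_ isT).
rewrite hornerM hornerX !normrM normfV [`|t|]gtr0_norm// [`|expR _|]ger0_norm ?expR_ge0//.
by move=> H; rewrite -ler_pdivrMr// mulrC mulrA.
Qed.

Lemma is_derive_flat (p : {poly R}) (t : R) :
  is_derive t (1 : R) (flat p) (flat ('X^2 * (p - p^`())) t).
Proof.
have [t0|t0|->] := ltgtP t 0.
- rewrite {2}/flat ltNge (ltW t0)/=.
  have d0 : is_derive t (1 : R) (cst (0 : R)) 0 by exact: is_derive_cst.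
  apply: near_eq_is_derive d0.
  by near=> s; rewrite /flat /cst ltNge ltW//=; near: s; exact: lt_nbhsl.
- rewrite {2}/flat t0.
  pose g (s : R) := p.[s^-1] * expR (- s^-1).
  apply: (@near_eq_is_derive _ _ _ g).
    by near=> s; rewrite /flat /g ifT//; near: s; exact: lt_nbhsr.
  have dV : is_derive t (1 : R) (fun s : R => s^-1) (- t ^- 2 *: 1).
    by have := @is_deriveV R id t 1 1; rewrite /= gt_eqF// => /(_ isT (is_derive_id _ _)).
  have d1 := @is_derive1_comp R (horner p) (fun s => s^-1) t _ _ (is_derive_poly p t^-1) dV.
  have d2 := @is_derive1_comp R (fun s => expR (- s)) (fun s => s^-1) t (- expR (- t^-1)) _ _ dV.
  have d3 : is_derive (t^-1) (1 : R) (fun s : R => expR (- s)) (- expR (- t^-1)).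
    have := @is_derive1_comp R expR (fun s => - s) t^-1 _ (- 1) (is_derive_expR _) (is_deriveN (is_derive_id _ _)).
    by rewrite mulrN1.
  have scE (a b : R) : a *: (b : R^o) = a * b by [].
  apply: (@is_derive_eq _ _ _ _ _ _ _ _ (is_deriveM d1 (d2 d3))).
  rewrite !scE hornerM hornerXn hornerD hornerN /=.
  by rewrite -!exprVn; ring.
- have -> : flat ('X^2 * (p - p^`())) 0 = 0 by rewrite /flat ltxx.
  have H : (fun h : R => h^-1 *: ((flat p \o shift 0) (h *: (1 : R)) - flat p 0)) @ 0^' --> (0 : R).
    have [C C0 HC] := flat_le ('X * p).
    apply/cvgr0Pnorm_lt => e e0.
    near=> h.
    have h0 : h != 0 by near: h; exact: nbhs_dnbhs_neq.
    rewrite /= addr0 [h *: 1]mulr1 {2}/flat ltxx subr0 [_ *: _]flat_mulX//.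
    apply: le_lt_trans (HC h) _.
    apply: (@le_lt_trans _ _ ((C + 1) * `|h|)); first by rewrite ler_wpM2r// lerDl.
    rewrite -ltr_pdivlMl ?ltr_wpDl//.
    near: h; apply: dnbhs0_lt; rewrite mulr_gt0// invr_gt0 ltr_wpDl//.
  split; first by apply/cvg_ex; exists 0.
  exact: cvg_lim H.
Unshelve. all: by end_near.
Qed.

Lemma Dinf_flat (p : {poly R}) : Dinf (flat p).
Proof.
have c p' : continuous (flat p').
  move=> t; apply/differentiable_continuous/derivable1_diffP.
  exact: (@ex_derive _ _ _ _ _ _ _ (is_derive_flat p' t)).
move=> k; elim: k p => [|k IH] p; split => //.
by exists (flat ('X^2 * (p - p^`()))) => //; exact: is_derive_flat.
Qed.

Lemma flat1_ge0 t : 0 <= flat 1 t.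
Proof. by rewrite /flat; case: ifP => // _; rewrite hornerC mul1r expR_ge0. Qed.

Lemma flat1_gt0 t : 0 < t -> 0 < flat 1 t.
Proof. by rewrite /flat => ->; rewrite hornerC mul1r expR_gt0. Qed.

Lemma flat1_eq0 t : t <= 0 -> flat 1 t = 0.
Proof. by rewrite /flat ltNge => ->. Qed.

Variables (x0 : 'rV[R]_3) (r : R).
Hypothesis r0 : 0 < r.

Definition sqdist (x : 'rV[R]_3) : R := dot (x - x0) (x - x0).

Lemma sqdistE x : sqdist x = (x 0 0 - x0 0 0) ^+ 2 + (x 0 1 - x0 0 1) ^+ 2 + (x 0 2 - x0 0 2) ^+ 2.
Proof. by rewrite /sqdist /dot sum3 !mxE -!expr2. Qed.

Lemma Cinf_sqdist : Cinf sqdist.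
Proof.
have H i : Cinf (fun x : 'rV[R]_3 => (x 0 i - x0 0 i) * (x 0 i - x0 0 i)).
  by apply: CinfM; apply: CinfD; [exact: Cinf_coord|exact: Cinf_cst|exact: Cinf_coord|exact: Cinf_cst].
rewrite (_ : sqdist = fun x => (x 0 0 - x0 0 0) * (x 0 0 - x0 0 0) + (x 0 1 - x0 0 1) * (x 0 1 - x0 0 1)
   + (x 0 2 - x0 0 2) * (x 0 2 - x0 0 2)); last by apply/funext => x; rewrite sqdistE !expr2.
by apply: CinfD; first apply: CinfD.
Qed.

(** The usual quotient of [flat] functions, equal to 1 up to distance [r] from [x0] and to 0 from
    distance [2 * r] on. Using the squared distance keeps it smooth at [x0]. *)
Definition cutoff (x : 'rV[R]_3) : R :=
  flat 1 (4 * r ^+ 2 - sqdist x) *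
  (flat 1 (4 * r ^+ 2 - sqdist x) + flat 1 (sqdist x - r ^+ 2))^-1.

Lemma cutoff_den_gt0 x : 0 < flat 1 (4 * r ^+ 2 - sqdist x) + flat 1 (sqdist x - r ^+ 2).
Proof.
have r20 : 0 < r ^+ 2 by rewrite exprn_gt0.
have [h|h] := ltP (sqdist x) (4 * r ^+ 2).
  by rewrite ltr_wpDr ?flat1_ge0// flat1_gt0// subr_gt0.
by rewrite ltr_wpDl ?flat1_ge0// flat1_gt0//; lra.
Qed.

Lemma Cinf_cutoff : Cinf cutoff.
Proof.
have H1 : Cinf (fun x => flat 1 (4 * r ^+ 2 - sqdist x)).
  apply: (Cinf_comp (Dinf_flat 1)).
  rewrite (_ : (fun x => _) = (fun x => 4 * r ^+ 2 + (- 1) * sqdist x)); last first.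
    by apply/funext => x; rewrite mulN1r.
  by apply: CinfD; [exact: Cinf_cst|apply: CinfM; [exact: Cinf_cst|exact: Cinf_sqdist]].
have H2 : Cinf (fun x => flat 1 (sqdist x - r ^+ 2)).
  apply: (Cinf_comp (Dinf_flat 1)).
  by apply: CinfD; [exact: Cinf_sqdist|exact: Cinf_cst].
apply: CinfM => //; apply: CinfV; first exact: cutoff_den_gt0.
exact: CinfD.
Qed.

Lemma cutoff_ge0 x : 0 <= cutoff x.
Proof. by rewrite mulr_ge0 ?flat1_ge0// invr_ge0 ltW// cutoff_den_gt0. Qed.

Lemma cutoff_le1 x : cutoff x <= 1.
Proof. by rewrite /cutoff ler_pdivrMr ?cutoff_den_gt0// mul1r lerDl flat1_ge0. Qed.

Lemma cutoff_eq1 x : sqdist x <= r ^+ 2 -> cutoff x = 1.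
Proof.
move=> h; rewrite /cutoff (flat1_eq0 (t := sqdist x - r ^+ 2)) ?subr_le0// addr0 divff//.
rewrite gt_eqF// flat1_gt0//; have : 0 < r ^+ 2 by rewrite exprn_gt0.
lra.
Qed.

Lemma cutoff_eq0 x : 4 * r ^+ 2 <= sqdist x -> cutoff x = 0.
Proof. by move=> h; rewrite /cutoff flat1_eq0 ?subr_le0// mul0r. Qed.

Lemma partial_near_cst (f : 'rV[R]_3 -> R) i x (c : R) :
  (\forall y \near x, f y = c) -> partial i f x = 0.
Proof.
move=> H; rewrite /partial (@near_eq_derive _ _ _ f (cst c))//.
exact: derive_cst.
Qed.

Lemma partial_cutoff_in i x : sqdist x < r ^+ 2 -> partial i cutoff x = 0.
Proof.
move=> h; apply: (@partial_near_cst _ _ _ 1).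
have : \forall y \near x, sqdist y < r ^+ 2.
  exact: (@Cinf_continuous _ _ Cinf_sqdist x _ (lt_nbhsl h)).
by apply: filterS => y hy; rewrite cutoff_eq1// ltW.
Qed.

Lemma partial_cutoff_out i x : 4 * r ^+ 2 < sqdist x -> partial i cutoff x = 0.
Proof.
move=> h; apply: (@partial_near_cst _ _ _ 0).
have : \forall y \near x, 4 * r ^+ 2 < sqdist y.
  exact: (@Cinf_continuous _ _ Cinf_sqdist x _ (lt_nbhsr h)).
by apply: filterS => y hy; rewrite cutoff_eq0// ltW.
Qed.

Lemma sqdist_coord (i : 'I_3) (x : 'rV[R]_3) : (x 0 i - x0 0 i) ^+ 2 <= sqdist x.
Proof.
have h0 := sqr_ge0 (x 0 0 - x0 0 0); have h1 := sqr_ge0 (x 0 1 - x0 0 1).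
have h2 := sqr_ge0 (x 0 2 - x0 0 2).
by rewrite sqdistE; move: i; apply: ord3P; lra.
Qed.

Lemma compact_sqdist (d : R) : compact [set x | sqdist x <= d ^+ 2].
Proof.
apply: bounded_closed_compact; last first.
  apply: (@closed_comp _ _ sqdist [set t | t <= d ^+ 2]); last exact: closed_le.
  by move=> x _; exact: (@Cinf_continuous _ _ Cinf_sqdist x).
exists (`|d| + `|x0|); split; first exact: num_real.
move=> M hM x /= xd; apply: le_trans (ltW hM).
rewrite -lerBlDr; apply: (@le_trans _ _ `|x - x0|); first exact: lerB_dist.
rewrite {1}/Num.norm /= mx_normrE; apply/bigmax_leP; split => // -[i j] _ /=.
rewrite (ord1 i) !mxE -sqrtr_sqr -(sqrtr_sqr d) ler_wsqrtr//.
exact: le_trans (sqdist_coord _ _) xd.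
Qed.

Lemma partial_cutoff_bounded : exists2 M : R, 0 <= M & forall i x, `|partial i cutoff x| <= M.
Proof.
have H i : exists M : R, forall x, `|partial i cutoff x| <= M.
  have c : continuous (partial i cutoff).
    by apply: Cinf_continuous; apply: Cinf_partial; exact: Cinf_cutoff.
  have := @compact_bounded _ _ _ (continuous_compact (continuous_subspaceT c) (@compact_sqdist (2 * r))).
  move=> [M [_ HM]]; exists (`|M| + 1) => x.
  have [xr|xr] := leP (sqdist x) ((2 * r) ^+ 2).
    apply: HM; last by exists x.
    by rewrite (le_lt_trans (ler_norm M))// ltrDl.
  rewrite partial_cutoff_out ?normr0 ?addr_ge0//.
  by move: xr; rewrite exprMn -natrX.
have [M0 H0] := H 0; have [M1 H1] := H 1; have [M2 H2] := H 2.
have p0 := le_trans (normr_ge0 _) (H0 0); have p1 := le_trans (normr_ge0 _) (H1 0).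
have p2 := le_trans (normr_ge0 _) (H2 0).
exists (M0 + M1 + M2); first by rewrite !addr_ge0.
apply: ord3P => x.
- by apply: le_trans (H0 x) _; lra.
- by apply: le_trans (H1 x) _; lra.
- by apply: le_trans (H2 x) _; lra.
Qed.

End cutoff.

(** * Geometry of the cone *)

Section geometry.
Context {R : realType}.
Implicit Types u v x y : 'rV[R]_3.

Lemma dotE u v : dot u v = u 0 0 * v 0 0 + u 0 1 * v 0 1 + u 0 2 * v 0 2.
Proof. by rewrite /dot sum3. Qed.

Lemma dotC u v : dot u v = dot v u.
Proof. by rewrite !dotE; ring. Qed.

Lemma dotDr u v x : dot u (v + x) = dot u v + dot u x.
Proof. by rewrite !dotE !mxE; ring. Qed.

Lemma dotZr (c : R) u v : dot u (c *: v) = c * dot u v.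
Proof. by rewrite !dotE !mxE; ring. Qed.

Lemma dotDl u v x : dot (u + v) x = dot u x + dot v x.
Proof. by rewrite !dotE !mxE; ring. Qed.

Lemma dotZl (c : R) u v : dot (c *: u) v = c * dot u v.
Proof. by rewrite !dotE !mxE; ring. Qed.

Lemma dotNr u v : dot u (- v) = - dot u v.
Proof. by rewrite !dotE !mxE; ring. Qed.

Lemma dot0r u : dot u 0 = 0.
Proof. by rewrite !dotE !mxE; ring. Qed.

Lemma dot_sumr n u (c : 'I_n -> R) (w : 'I_n -> 'rV[R]_3) :
  dot u (\sum_j c j *: w j) = \sum_j c j * dot u (w j).
Proof.
have h : {morph dot u : x y / x + y >-> x + y} by move=> x y; rewrite dotDr.
rewrite (big_morph _ h (dot0r u)).
by apply: eq_bigr => j _; rewrite dotZr.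
Qed.

Lemma dot_ge0 u : 0 <= dot u u.
Proof. by rewrite dotE -!expr2 !addr_ge0// sqr_ge0. Qed.

Lemma dot_gt0 u : u != 0 -> 0 < dot u u.
Proof.
move=> u0; rewrite lt_neqAle dot_ge0 andbT eq_sym.
apply: contra u0; rewrite dotE -!expr2 !paddr_eq0 ?addr_ge0 ?sqr_ge0//.
rewrite !sqrf_eq0 => /andP[/andP[/eqP h0 /eqP h1] /eqP h2].
by apply/eqP/rowP; apply: ord3P; rewrite mxE.
Qed.

Lemma enorm_sqr u : enorm u ^+ 2 = dot u u.
Proof. by rewrite /enorm sqr_sqrtr// dot_ge0. Qed.

Lemma enorm_ge0 u : 0 <= enorm u.
Proof. exact: sqrtr_ge0. Qed.

Lemma dot_sqr_le u v : dot u v ^+ 2 <= dot u u * dot v v.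
Proof.
rewrite !dotE -subr_ge0.
rewrite [leRHS](_ : _ = (u 0 0 * v 0 1 - u 0 1 * v 0 0) ^+ 2 +
  (u 0 0 * v 0 2 - u 0 2 * v 0 0) ^+ 2 + (u 0 1 * v 0 2 - u 0 2 * v 0 1) ^+ 2); last by ring.
by rewrite !addr_ge0// sqr_ge0.
Qed.

Lemma dot_le u v : dot u v <= enorm u * enorm v.
Proof.
apply: le_trans (ler_norm _) _.
rewrite -(ler_pXn2r (n := 2)) ?nnegrE ?mulr_ge0 ?enorm_ge0//.
by rewrite exprMn !enorm_sqr real_normK ?num_real// dot_sqr_le.
Qed.

Lemma S1_ge0 u : 0 <= S1 u.
Proof. by rewrite !addr_ge0. Qed.

Lemma S1D u v : S1 (u + v) <= S1 u + S1 v.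
Proof.
rewrite /S1 !mxE.
have := ler_normD (u 0 0) (v 0 0); have := ler_normD (u 0 1) (v 0 1).
by have := ler_normD (u 0 2) (v 0 2); lra.
Qed.

Lemma S1Z (c : R) u : S1 (c *: u) = `|c| * S1 u.
Proof. by rewrite /S1 !mxE !normrM; ring. Qed.

Lemma S10 : S1 (0 : 'rV[R]_3) = 0.
Proof. by rewrite /S1 !mxE normr0 !addr0. Qed.

Lemma S1_sum n (c : 'I_n -> R) (w : 'I_n -> 'rV[R]_3) : (forall j, 0 <= c j) ->
  S1 (\sum_j c j *: w j) <= (\sum_j c j) * (\sum_j S1 (w j)).
Proof.
move=> c0; apply: (@le_trans _ _ (\sum_j c j * S1 (w j))).
  elim/big_ind2 : _ => [|x a y b xa yb|j _]; first by rewrite S10.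
  - exact: le_trans (S1D _ _) (lerD xa yb).
  - by rewrite S1Z ger0_norm.
rewrite mulr_suml; apply: ler_sum => j _; apply: ler_wpM2l => //.
by rewrite (bigD1 j)//= lerDl sumr_ge0// => i _; exact: S1_ge0.
Qed.

Lemma coord_le1 u i : dot u u = 1 -> `|u 0 i| <= 1.
Proof.
move=> u1; rewrite -(ler_pXn2r (n := 2)) ?nnegrE// expr1n real_normK ?num_real//.
rewrite -u1 dotE -!expr2.
have h0 := sqr_ge0 (u 0 0); have h1 := sqr_ge0 (u 0 1); have h2 := sqr_ge0 (u 0 2).
by move: i; apply: ord3P; lra.
Qed.

Lemma dot_le_S1 u x : dot u u = 1 -> `|dot u x| <= S1 x.
Proof.
move=> u1; rewrite dotE.
have H i : `|u 0 i * x 0 i| <= `|x 0 i| by rewrite normrM ler_piMl// coord_le1.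
apply: le_trans (ler_normD _ _) _; apply: lerD => //.
by apply: le_trans (ler_normD _ _) _; apply: lerD.
Qed.

Lemma S1_le_enorm u : S1 u <= 2 * enorm u.
Proof.
rewrite -(ler_pXn2r (n := 2)) ?nnegrE ?S1_ge0 ?mulr_ge0 ?enorm_ge0//.
rewrite exprMn enorm_sqr dotE -!expr2 /S1.
have h i : u 0 i ^+ 2 = `|u 0 i| ^+ 2 by rewrite real_normK ?num_real.
rewrite !h; move: (`|u 0 0|) (`|u 0 1|) (`|u 0 2|) => a b c.
have := sqr_ge0 (a - b); have := sqr_ge0 (a - c); have := sqr_ge0 (b - c).
by have := sqr_ge0 a; have := sqr_ge0 b; have := sqr_ge0 c; rewrite -natrX !expr2; nra.
Qed.

Lemma enorm_le_S1 u : enorm u <= S1 u.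
Proof.
rewrite -(ler_pXn2r (n := 2)) ?nnegrE ?S1_ge0 ?enorm_ge0//.
rewrite enorm_sqr dotE -!expr2 /S1.
have h i : u 0 i ^+ 2 = `|u 0 i| ^+ 2 by rewrite real_normK ?num_real.
rewrite !h.
have := normr_ge0 (u 0 0); have := normr_ge0 (u 0 1); have := normr_ge0 (u 0 2).
move: (`|u 0 0|) (`|u 0 1|) (`|u 0 2|) => a b c c0 b0 a0.
have := mulr_ge0 a0 b0; have := mulr_ge0 a0 c0; have := mulr_ge0 b0 c0.
by rewrite !expr2; nra.
Qed.

Definition cross u v : 'rV[R]_3 := pt
  (u 0 1 * v 0 2 - u 0 2 * v 0 1, u 0 2 * v 0 0 - u 0 0 * v 0 2,
   u 0 0 * v 0 1 - u 0 1 * v 0 0).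

Lemma dot_cross u v : dot (cross u v) (cross u v) = dot u u * dot v v - dot u v ^+ 2.
Proof. by rewrite !dotE !ptE /=; ring. Qed.

Lemma dot_crossl u v : dot (cross u v) u = 0.
Proof. by rewrite !dotE !ptE /=; ring. Qed.

Lemma dot_crossr u v : dot (cross u v) v = 0.
Proof. by rewrite !dotE !ptE /=; ring. Qed.

Definition rows3 u v w : 'M[R]_3 := \matrix_(i, j) [:: u; v; w]`_i 0 j.

Lemma mul_rows3 (c : 'rV[R]_3) u v w :
  c *m rows3 u v w = c 0 0 *: u + c 0 1 *: v + c 0 2 *: w.
Proof. by apply/rowP => j; rewrite !mxE sum3 !mxE. Qed.

(** The three vectors are the rows of a matrix with M M^T = 1, hence M^T M = 1, and the expansion
    reads x = x M^T M. *)
Lemma orthonormal_decomp a d x : dot a a = 1 -> dot d d = 1 -> dot d a = 0 ->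
  x = dot a x *: a + dot d x *: d + dot (cross a d) x *: cross a d.
Proof.
move=> aa dd da; set e := cross a d.
have ad : dot a d = 0 by rewrite dotC.
have ee : dot e e = 1 by rewrite dot_cross aa dd ad expr0n/= mulr1 subr0.
have ea : dot e a = 0 by exact: dot_crossl.
have ed : dot e d = 0 by exact: dot_crossr.
have ae : dot a e = 0 by rewrite dotC.
have de : dot d e = 0 by rewrite dotC.
clearbody e; pose M := rows3 a d e.
have MM : M *m M^T = 1%:M.
  apply/matrixP; apply: ord3P; apply: ord3P; rewrite !mxE sum3 !mxE /= -!dotE ?aa ?ad ?ae ?da ?dd ?de ?ea ?ed ?ee//.
have := mulmx1C MM => MM'.
rewrite -[LHS]mulmx1 -MM' mulmxA mul_rows3.
by congr (_ *: _ + _ *: _ + _ *: _); rewrite !mxE sum3 !mxE /= dotC dotE.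
Qed.

Lemma free3P u v w : free [:: u; v; w] -> forall a b c : R,
  a *: u + b *: v + c *: w = 0 -> [/\ a = 0, b = 0 & c = 0].
Proof.
rewrite !free_cons !span_cons span_nil addv0 => /and3P[u0 v0 w0] a b c.
have {}w0 : w != 0 by move: w0 => /andP[]; rewrite memv0.
move=> h.
have a0 : a = 0.
  apply/eqP; apply: contraNT u0 => a0.
  have -> : u = - (b / a) *: v + - (c / a) *: w.
    apply: (scalerI a0); apply/eqP; rewrite -subr_eq0; apply/eqP; rewrite -[RHS]h.
    rewrite scalerDr !scalerA !mulrN !(mulrC a) !mulfVK// !scaleNr opprD !opprK addrA//.
  by apply: memv_add; apply: memvZ; exact: memv_line.
move: h; rewrite a0 scale0r add0r => h.
have b0 : b = 0.
  apply/eqP; apply: contraNT v0 => b0.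
  have -> : v = - (c / b) *: w.
    apply: (scalerI b0); apply/eqP; rewrite -subr_eq0; apply/eqP; rewrite -[RHS]h.
    by rewrite !scalerA !mulrN !(mulrC b) !mulfVK// !scaleNr !opprK.
  by apply: memvZ; exact: memv_line.
move: h; rewrite b0 scale0r add0r => /eqP; rewrite scaler_eq0 (negbTE w0) orbF => /eqP c0.
by split.
Qed.

End geometry.

(** * The cone near an extremal ray *)

Section cone_geometry.
Context {R : realType}.
Implicit Types u v x y : 'rV[R]_3.

(** The generators need not belong to the open cone, so the opening condition is applied to
    [w j + eta *: s], whose coefficients are positive. Since cos(theta / 2) > 0, a small [eta]
    leaves [dot v (w j)] positive. *)
Lemma strictly_convex_dot_gt0 n (w : 'I_n -> 'rV[R]_3) x0 :
  (forall j, enorm (w j) = 1) -> strictly_convex_cone x0 (cone w x0) ->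
  exists v, forall j, 0 < dot v (w j).
Proof.
move=> w1 [_ [v [theta [v1 /andP[th0 thpi] H]]]]; exists v => j.
set c := cos (theta / 2) in H.
have c0 : 0 < c.
  by apply: cos_gt0_pihalf; apply/andP; split; have := @pi_gt0 R; lra.
pose s := \sum_k w k.
pose m := `|dot (w j) s| + `|dot v s|.
have m0 : 0 <= m by rewrite addr_ge0.
(* Ensures [eta * m * (c + 1) <= c / 2]: the perturbation costs at most half of [c]. *)
pose eta := c / (2 * (c + 1) * (m + 1)).
have eta0 : 0 < eta by rewrite divr_gt0// !mulr_gt0// ltr_wpDl// ltW.
have h : cone w x0 (x0 + (w j + eta *: s)).
  exists (fun k => (k == j)%:R + eta) => [k|]; first by rewrite ltr_wpDl.
  congr (_ + _); rewrite -[LHS]/(w j + eta *: s) /s scaler_sumr.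
  rewrite [RHS](eq_bigr (fun k => (k == j)%:R *: w k + eta *: w k)); last by move=> k _; rewrite scalerDl.
  rewrite big_split/=; congr (_ + _).
  by rewrite (bigD1 j)//= eqxx scale1r big1 ?addr0// => k /negbTE ->; rewrite scale0r.
have := H _ h; rewrite /= addrC addKr => H1.
have H2 : 1 + eta * dot (w j) s <= enorm (w j + eta *: s).
  have := dot_le (w j) (w j + eta *: s).
  by rewrite w1 mul1r dotDr dotZr -enorm_sqr w1 expr1n.
have H3 : (1 + eta * dot (w j) s) * c <= dot v (w j) + eta * dot v s.
  rewrite (_ : dot v (w j) + eta * dot v s = dot (w j + eta *: s) v); last by rewrite (dotC (_ + _) v) dotDr dotZr.
  apply: le_trans H1.
  by rewrite ler_wpM2r// ltW.
have a1 := ler_norm (dot v s).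
have a2 := ler_norm (- dot (w j) s); rewrite normrN in a2.
have b1 : eta * dot v s <= eta * m.
  by rewrite ler_wpM2l ?(ltW eta0)//; apply: le_trans a1 _; rewrite /m lerDr.
have b2 : - (eta * dot (w j) s) * c <= eta * m * c.
  rewrite ler_wpM2r ?(ltW c0)// -mulrN ler_wpM2l ?(ltW eta0)//.
  by apply: le_trans a2 _; rewrite /m lerDl.
have b3 : eta * m * (c + 1) <= c / 2.
  rewrite /eta (_ : _ * (c + 1) = (m / (m + 1)) * (c / 2)); last first.
    by field; rewrite !gt_eqF// ltr_wpDl// ltW.
  rewrite ler_piMl//; first by rewrite divr_ge0// ltW.
  by rewrite ler_pdivrMr ?ltr_wpDl// mul1r lerDl.
nra.
Qed.

Lemma exists_third n (i j : 'I_n) : (2 < n)%N -> exists k, k != i /\ k != j.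
Proof.
move=> n3; have : (0 < #|~: [set i; j]%SET|)%N.
  rewrite cardsCs finset.setCK card_ord cards2 subn_gt0 (leq_trans _ n3)// ltnS.
  by case: (i != j).
by rewrite card_gt0 => /set0Pn[k]; rewrite !inE negb_or => /andP[]; exists k.
Qed.

(** Scale the generators into the plane [dot v x = 1]. The farthest from the origin, [a], is a
    vertex of the section, and d = |a|^2 v - a supports it there: |w'|^2 <= |a|^2 and w' <> a give
    a.w' < |a|^2. Distinctness follows from the independence of triples. *)
Lemma extremal_ray n (w : 'I_n -> 'rV[R]_3) v :
  (3 <= n)%N ->
  (forall i j k, i != j -> j != k -> i != k -> free [:: w i; w j; w k]) ->
  (forall j, 0 < dot v (w j)) ->
  exists j0 d, [/\ dot d d = 1, dot d (w j0) = 0 & forall j, j != j0 -> 0 < dot d (w j)].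
Proof.
move=> n3 wf vw.
have i0 : 'I_n by exact: (Ordinal (leq_trans (isT : 0 < 3)%N n3)).
pose w' j := (dot v (w j))^-1 *: w j.
have vw' j : dot v (w' j) = 1 by rewrite dotZr mulVf// gt_eqF.
pose f j := dot (w' j) (w' j).
pose j0 := [arg max_(j > i0) f j]%O.
have fmax j : f j <= f j0.
  by rewrite /j0; case: (@arg_maxP _ _ _ i0 xpredT f) => // k _ /(_ j isT).
pose a := w' j0.
pose d := f j0 *: v - a.
have dw' j : dot d (w' j) = f j0 - dot a (w' j).
  by rewrite /d dotDl dotZl vw' mulr1 -scaleN1r dotZl mulN1r.
have dlt j : j != j0 -> 0 < dot d (w' j).
  move=> jj0; rewrite dw' subr_gt0.
  have ne : w' j - a != 0.
    have [k [kj kj0]] := exists_third j j0 n3.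
    apply/eqP => /eqP E.
    have := free3P (wf j j0 k jj0 _ _); rewrite eq_sym kj0 eq_sym kj => /(_ isT isT).
    move=> /(_ (dot v (w j))^-1 (- (dot v (w j0))^-1) 0).
    rewrite scale0r addr0 scaleNr => /(_ (eqP E))[/eqP].
    by rewrite invr_eq0 gt_eqF.
  have sub (x y : 'rV[R]_3) : dot (x - y) (x - y) = dot x x - 2 * dot y x + dot y y.
    by rewrite !dotE !mxE; ring.
  have := dot_gt0 ne; rewrite sub.
  have := fmax j; rewrite /f -/a => h1 h2; lra.
have da : dot d a = 0 by rewrite dw' /f -/a subrr.
have sc j c : dot (c *: d) (w j) = (c * dot v (w j)) * dot d (w' j).
  by rewrite dotZl [dot d (w' j)]dotZr mulrA mulfK// gt_eqF.
have [k [kj0 _]] := exists_third j0 j0 n3.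
have d0 : d != 0.
  by apply/eqP => d0; have := dlt _ kj0; rewrite d0 dotC dot0r ltxx.
have ed : 0 < enorm d by rewrite /enorm sqrtr_gt0 dot_gt0.
exists j0, ((enorm d)^-1 *: d); split.
- by rewrite dotZl dotZr -enorm_sqr expr2 mulKf ?mulVf// gt_eqF.
- by rewrite sc da mulr0.
- by move=> j jj0; rewrite sc !mulr_gt0// ?invr_gt0// dlt.
Qed.

(* The ray of [w j0] is extremal, and [w k], [w l] are its two neighbours: modulo [w j0]
   they span the projection of the whole cone. *)
Record cone_frame n (w : 'I_n -> 'rV[R]_3) (j0 k l : 'I_n) (d : 'rV[R]_3)
    (al be ga : 'I_n -> R) : Prop := ConeFrame {
  cf_a : dot (w j0) (w j0) = 1;
  cf_d : dot d d = 1;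
  cf_da : dot d (w j0) = 0;
  cf_pos : forall j, j != j0 -> 0 < dot d (w j);
  cf_dec : forall j, w j = ga j *: w j0 + al j *: w k + be j *: w l;
  cf_ge0 : forall j, 0 <= al j /\ 0 <= be j;
  cf_k : 0 < al k;
  cf_l : 0 < be l;
  cf_free : free [:: w j0; w k; w l] }.

(** Project along [w j0] to the plane of [d] and [e]. All other generators have a positive
    coordinate [D], so their projections are ordered by the slope [sg]; those of least and greatest
    slope span a sector containing all the others. *)
Lemma cone_frame_exists n (w : 'I_n -> 'rV[R]_3) x0 : polyhedral_cone w x0 ->
  exists j0 k l d al be ga, cone_frame w j0 k l d al be ga.
Proof.
move=> [n3 w1 wf sc _].
have [v vw] := strictly_convex_dot_gt0 w1 sc.
have [j0 [d [dd da dpos]]] := extremal_ray n3 wf vw.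
have aa : dot (w j0) (w j0) = 1 by rewrite -enorm_sqr w1 expr1n.
set a := w j0 in aa da.
have [i0 [i00 _]] := exists_third j0 j0 n3.
have [i1 [i10 i1i0]] := exists_third j0 i0 n3.
pose e := cross a d.
pose D j := dot d (w j); pose E j := dot e (w j).
pose sg j := E j / D j.
have D0 j : j != j0 -> D j != 0 by move=> /dpos h; rewrite gt_eqF.
have ES j : j != j0 -> E j = sg j * D j by move=> /D0 h; rewrite /sg mulfVK.
have dec x : x = dot a x *: a + dot d x *: d + dot e x *: e by exact: orthonormal_decomp.
pose k := [arg min_(j < i0 | j != j0) sg j]%O.
pose l := [arg max_(j > i0 | j != j0) sg j]%O.
have [kj0 kmin] : k != j0 /\ forall j, j != j0 -> sg k <= sg j.
  by rewrite /k; case: (@arg_minP _ _ _ i0 (fun j => j != j0) sg) => // i ij0 h; split.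
have [lj0 lmax] : l != j0 /\ forall j, j != j0 -> sg j <= sg l.
  by rewrite /l; case: (@arg_maxP _ _ _ i0 (fun j => j != j0) sg) => // i ij0 h; split.
(* If all slopes agreed, [D i1 *: w i0 - D i0 *: w i1] would be a multiple of [w j0], against the
   independence of three generators. *)
have kl : sg k < sg l.
  rewrite lt_neqAle kmin// andbT; apply/eqP => skl.
  have sE j : j != j0 -> sg j = sg k by move=> h; apply/le_anti; rewrite kmin// skl lmax.
  have := free3P (wf j0 i0 i1 _ _ _); rewrite eq_sym i00 eq_sym i1i0 eq_sym i10 => /(_ isT isT isT).
  move=> /(_ (- dot a (D i1 *: w i0 + (- D i0) *: w i1)) (D i1) (- D i0)) H.
  have : [/\ - dot a (D i1 *: w i0 + (- D i0) *: w i1) = 0, D i1 = 0 & - D i0 = 0].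
    apply: H; rewrite -addrA {2}(dec (D i1 *: w i0 + _)).
    have -> : dot d (D i1 *: w i0 + - D i0 *: w i1) = 0.
      by rewrite dotDr !dotZr -/(D i0) -/(D i1); ring.
    have -> : dot e (D i1 *: w i0 + - D i0 *: w i1) = 0.
      rewrite dotDr !dotZr -/(E i0) -/(E i1) ES// ES// !sE//; ring.
    by rewrite !scale0r !addr0 -scalerDl addNr scale0r.
  by case=> _ /eqP; rewrite (negbTE (D0 _ i10)).
have skl0 : sg l - sg k != 0 by rewrite gt_eqF// subr_gt0.
(* The solution of [D j = al j * D k + be j * D l] and of the same equation for [E]: weights that
   interpolate the slope of [j] between the extreme slopes. The projection of [w j0] is 0. *)
pose al j := if j == j0 then 0 else D j * (sg l - sg j) / (D k * (sg l - sg k)).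
pose be j := if j == j0 then 0 else D j * (sg j - sg k) / (D l * (sg l - sg k)).
pose ga j := dot a (w j - al j *: w k - be j *: w l).
exists j0, k, l, d, al, be, ga; split => //.
- move=> j; rewrite -/a.
  have H : w j - al j *: w k - be j *: w l = ga j *: a.
    rewrite [LHS]dec -/(ga j).
    have -> : dot d (w j - al j *: w k - be j *: w l) = 0.
      rewrite !dotDr !dotNr !dotZr -/(D j) -/(D k) -/(D l) /al /be.
      case: ifPn => [/eqP ->|jj0]; first by rewrite /D -/a da; ring.
      by field; rewrite skl0 !D0.
    have -> : dot e (w j - al j *: w k - be j *: w l) = 0.
      rewrite !dotDr !dotNr !dotZr -/(E j) -/(E k) -/(E l) /al /be.
      case: ifPn => [/eqP ->|jj0]; first by rewrite /E -/a dot_crossl; ring.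
      rewrite !ES//.
      by field; rewrite skl0 !D0.
    by rewrite !scale0r !addr0.
  by rewrite -H -addrA [X in _ + X]addrC addrA !subrK.
- move=> j; rewrite /al /be; case: ifPn => // jj0.
  split; rewrite divr_ge0 ?mulr_ge0 ?subr_ge0 ?(ltW kl) ?kmin ?lmax//; exact/ltW/dpos.
- by rewrite /al (negbTE kj0) divff// mulf_neq0// D0.
- by rewrite /be (negbTE lj0) divff// mulf_neq0// D0.
- apply: wf; rewrite 1?eq_sym//.
  by apply: contraTneq kl => ->; rewrite ltxx.
Qed.

End cone_geometry.

(** * The Laplace transform of a cone *)

(** The number exp(-(a + i b)), so that [wave U V x] is exp(-rho.x) with rho = U + i V. *)
Definition cexp {R : realType} (a b : R) : R[i] :=
  (expR (- a) * cos b) +i* (- (expR (- a) * sin b)).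

Definition wave {R : realType} (U V x : 'rV[R]_3) : R[i] := cexp (dot U x) (dot V x).

Section waves.
Context {R : realType}.
Notation mu := (leb3 R).
Implicit Types (U V x y : 'rV[R]_3) (D : set (P3 R)).

Lemma cexpD (a a' b b' : R) : cexp (a + a') (b + b') = cexp a b * cexp a' b'.
Proof.
by apply: complex_eqP; rewrite ReImE /= opprD expRD ?cosD ?sinD; ring.
Qed.

Lemma n1_cexp (a b : R) : n1 (cexp a b) <= 2 * expR (- a).
Proof.
rewrite /n1/= normrN !normrM ger0_norm ?expR_ge0// -mulrDr mulrC ler_pM ?addr_ge0 ?expR_ge0//.
by have := cos_max b; have := sin_max b; lra.
Qed.

Lemma waveD U V x y : wave U V (x + y) = wave U V y * wave U V x.
Proof. by rewrite /wave !dotDr cexpD mulrC. Qed.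

Lemma Cinf_dot U : Cinf (fun x => dot U x).
Proof.
rewrite (_ : (fun x => _) = fun x => U 0 0 * x 0 0 + U 0 1 * x 0 1 + U 0 2 * x 0 2); last first.
  by apply/funext => x; rewrite dotE.
have H i : Cinf (fun x => U 0 i * x 0 i) by apply: CinfM; [exact: Cinf_cst|exact: Cinf_coord].
by apply: CinfD; first apply: CinfD.
Qed.

Lemma Cinf_wave_Re U V : Cinf (fun x => complex.Re (wave U V x)).
Proof.
rewrite /wave /cexp /=; apply: CinfM.
  apply: (Cinf_comp Dinf_expR).
  rewrite (_ : (fun x => _) = fun x => (- 1) * dot U x); last by apply/funext => x; rewrite mulN1r.
  by apply: CinfM; [exact: Cinf_cst|exact: Cinf_dot].
have := Cinf_comp (Dinf_trig 1 0) (Cinf_dot V).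
by under eq_fun do rewrite mul1r mul0r addr0.
Qed.

Lemma Cinf_wave_Im U V : Cinf (fun x => complex.Im (wave U V x)).
Proof.
rewrite /wave /cexp /=.
rewrite (_ : (fun x => _) = fun x => expR (- 1 * dot U x) * (- sin (dot V x))); last first.
  by apply/funext => x; rewrite mulN1r mulrN.
apply: CinfM.
  by apply: (Cinf_comp Dinf_expR); apply: CinfM; [exact: Cinf_cst|exact: Cinf_dot].
have := Cinf_comp (Dinf_trig 0 (- 1)) (Cinf_dot V).
by under eq_fun do rewrite mul0r mulN1r add0r.
Qed.

Lemma cmeasurable_wave U V D : measurable D -> cmeasurable D (fun p => wave U V (pt p)).
Proof.
move=> mD; split.
- exact: (continuous_measurable_pt (Cinf_continuous (Cinf_wave_Re U V)) mD).
- exact: (continuous_measurable_pt (Cinf_continuous (Cinf_wave_Im U V)) mD).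
Qed.

Lemma measurable_expS1 (x0 : 'rV[R]_3) (a : R) D : measurable D ->
  measurable_fun D (fun p => expR (- a * S1 (pt p - x0)) : measurableTypeR R).
Proof.
move=> mD; apply: (@measurable_funS _ _ _ _ setT) => //.
have h : measurable_fun [set: P3 R] (fun p => S1 (pt (shift3 (- x0) p)) : measurableTypeR R).
  apply: (measurableT_comp (f := fun p => S1 (pt p) : measurableTypeR R)).
    exact: measurable_S1.
  exact: measurable_shift3.
under eq_fun do rewrite -pt_shift3.
apply: (measurableT_comp (f := @expR R : measurableTypeR R -> measurableTypeR R)) => //.
by apply: measurable_funM.
Qed.

Lemma integral_expS1_at (x0 : 'rV[R]_3) (a : R) : 0 < a ->
  (\int[mu]_p (expR (- a * S1 (pt p - x0)))%:E = ((2 / a) ^+ 3)%:E)%E.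
Proof.
move=> a0; rewrite -(integral_expS1 a0).
have mE : measurable_fun [set: P3 R] (fun p : P3 R => (expR (- a * S1 (pt p)))%:E).
  apply/measurable_EFinP.
  by have := @measurable_expS1 0 a setT measurableT; under eq_fun do rewrite subr0.
have E0 : {in [set: P3 R], forall p : P3 R, (0 <= (expR (- a * S1 (pt p)))%:E)%E}.
  by move=> p _; rewrite lee_fin expR_ge0.
transitivity (\int[pushforward mu (shift3 (- x0))]_p (expR (- a * S1 (pt p)))%:E)%E.
  have := @ge0_integral_pushforward _ _ _ _ R _ (measurable_shift3 (- x0)) mu _ _ measurableT mE E0.
  move=> ->; rewrite preimage_setT.
  by apply: eq_integral => p _ /=; rewrite pt_shift3.
apply: eq_measure_integral; first exact: measurable_shift3.
by move=> ? A mA _; exact: leb3_shift.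
Qed.

Lemma integrable_expS1 (x0 : 'rV[R]_3) (a : R) D : 0 < a -> measurable D ->
  mu.-integrable D (EFin \o (fun p => expR (- a * S1 (pt p - x0)))).
Proof.
move=> a0 mD; apply: (@integrableS _ _ _ _ setT) => //.
apply/integrableP; split.
  by apply/measurable_EFinP; exact: measurable_expS1.
under eq_integral do rewrite /= ger0_norm ?expR_ge0//.
by rewrite integral_expS1_at// ltry.
Qed.

Lemma Rintegral_expS1_le (x0 : 'rV[R]_3) (a : R) D : 0 < a -> measurable D ->
  \int[mu]_(p in D) expR (- a * S1 (pt p - x0)) <= (2 / a) ^+ 3.
Proof.
move=> a0 mD.
have E : (2 / a) ^+ 3 = fine (\int[mu]_p (expR (- a * S1 (pt p - x0)))%:E)%E.
  by rewrite integral_expS1_at.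
rewrite E /Rintegral fine_le//.
- exact: (integrable_fin_num mD (integrable_expS1 x0 a0 mD)).
- exact: (integrable_fin_num measurableT (integrable_expS1 x0 a0 measurableT)).
- apply: ge0_subset_integral => //.
  + by apply/measurable_EFinP; exact: measurable_expS1.
Qed.

Lemma cintegrable_wave U V D (a : R) : 0 < a -> measurable D ->
  (forall p, D p -> a * S1 (pt p) <= dot U (pt p)) ->
  cintegrable D (fun p => wave U V (pt p)).
Proof.
move=> a0 mD Ua.
apply: (@cintegrable_le _ _ _ (fun p => 2 * expR (- a * S1 (pt p - 0)))) => //.
- exact: cmeasurable_wave.
- exact: (integrableZl mD 2 (integrable_expS1 0 a0 mD)).
- move=> p Dp; apply: le_trans (n1_cexp _ _) _.
  by rewrite ler_wpM2l// ler_expR mulNr lerN2 subr0 Ua.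
Qed.

Lemma cint_wave_le U V D (a : R) : 0 < a -> measurable D ->
  (forall p, D p -> a * S1 (pt p) <= dot U (pt p)) ->
  n1 (cint D (fun p => wave U V (pt p))) <= 4 * (2 / a) ^+ 3.
Proof.
move=> a0 mD Ua.
have ie := integrable_expS1 0 a0 mD.
apply: (@le_trans _ _ (2 * \int[mu]_(p in D) (2 * expR (- a * S1 (pt p - 0))))).
  apply: cint_le => //; first exact: (cintegrable_wave _ a0).
    exact: (integrableZl mD 2 ie).
  apply: aeW => p Dp; apply: le_trans (n1_cexp _ _) _.
  by rewrite ler_wpM2l// ler_expR mulNr lerN2 subr0 Ua.
rewrite RintegralZl// mulrA.
have -> : 2 * 2 = 4 :> R by rewrite -natrM.
by rewrite ler_wpM2l// Rintegral_expS1_le.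
Qed.

Lemma cint_wave_shift U V y D : measurable D ->
  cintegrable (shift3 y @^-1` D) (fun p => wave U V (pt p)) ->
  cint D (fun p => wave U V (pt p)) =
  wave U V y * cint (shift3 y @^-1` D) (fun p => wave U V (pt p)).
Proof.
move=> mD iD.
have mD' : measurable (shift3 y @^-1` D).
  by rewrite -[X in measurable X]setTI; apply: measurable_shift3.
rewrite -cintZ// (cint_shift (y := y))//.
- by apply: eq_cint => p _ /=; rewrite pt_shift3 waveD.
- exact: cmeasurable_wave.
- apply: (eq_cintegrable (f := fun p => wave U V y * wave U V (pt p))) => //.
    by move=> p _ /=; rewrite pt_shift3 waveD.
  exact: cintegrableZ.
Qed.

(** The wave turns translations into factors, and [B] is the translate of [D] by [y]. Removing
    translates thus relates transforms without evaluating an integral. *)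
Lemma cint_wave_diff U V y D B : measurable D -> measurable B -> B `<=` D ->
  shift3 y @^-1` B = D -> cintegrable D (fun p => wave U V (pt p)) ->
  cint (D `\` B) (fun p => wave U V (pt p)) =
  (1 - wave U V y) * cint D (fun p => wave U V (pt p)).
Proof.
move=> mD mB BD yB iD.
have mDB := measurableD mD mB.
have h : cint D (fun p => wave U V (pt p)) =
    cint B (fun p => wave U V (pt p)) + cint (D `\` B) (fun p => wave U V (pt p)).
  rewrite -cint_setU// ?setDUK//.
  by rewrite disj_set2E setDE setICA setICr setI0.
have hB : cint B (fun p => wave U V (pt p)) = wave U V y * cint D (fun p => wave U V (pt p)).
  by rewrite (cint_wave_shift (y := y))// ?yB.
by rewrite mulrBl mul1r -hB {1}h addrC addKr.
Qed.

End waves.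

(** * Simplicial cones *)

Section simplex.
Context {R : realType}.
Notation mu := (leb3 R).
Variables w1 w2 w3 : 'rV[R]_3.
Hypothesis w_free : free [:: w1; w2; w3].

Let W : 'M[R]_3 := rows3 w1 w2 w3.
Let ws (i : 'I_3) : 'rV[R]_3 := [:: w1; w2; w3]`_i.

Definition scoord (x : 'rV[R]_3) (i : 'I_3) : R := (x *m invmx W) 0 i.

Lemma unit_rows3 : W \in unitmx.
Proof.
rewrite -row_free_unit; apply: inj_row_free => c.
rewrite mul_rows3 => /(free3P w_free)[c0 c1 c2].
by apply/rowP; apply: ord3P; rewrite mxE.
Qed.

Lemma scoord_decomp x : x = scoord x 0 *: w1 + scoord x 1 *: w2 + scoord x 2 *: w3.
Proof. by rewrite -mul_rows3 mulmxKV// unit_rows3. Qed.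

Lemma scoordE a b c (i : 'I_3) : scoord (a *: w1 + b *: w2 + c *: w3) i = [:: a; b; c]`_i.
Proof.
rewrite /scoord (_ : _ + _ = (pt (a, b, c)) *m W) ?mulmxK ?unit_rows3//; last first.
  by rewrite mul_rows3 !ptE.
by move: i; apply: ord3P; rewrite !ptE.
Qed.

Lemma scoordD x y i : scoord (x + y) i = scoord x i + scoord y i.
Proof. by rewrite /scoord mulmxDl mxE. Qed.

Lemma scoordZ a x i : scoord (a *: x) i = a * scoord x i.
Proof. by rewrite /scoord -scalemxAl mxE. Qed.

Lemma scoord_ws i j : scoord (ws i) j = (i == j)%:R.
Proof.
have E1 : ws 0 = 1 *: w1 + 0 *: w2 + 0 *: w3 by rewrite scale1r !scale0r !addr0.
have E2 : ws 1 = 0 *: w1 + 1 *: w2 + 0 *: w3 by rewrite scale1r !scale0r add0r addr0.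
have E3 : ws 2 = 0 *: w1 + 0 *: w2 + 1 *: w3 by rewrite scale1r !scale0r !add0r.
by move: i j; apply: ord3P => j; rewrite (E1, E2, E3) scoordE; move: j; apply: ord3P.
Qed.

Lemma scoord_sum x i : scoord x i = \sum_j x 0 j * invmx W j i.
Proof. by rewrite /scoord mxE. Qed.

Lemma measurable_scoord i : measurable_fun [set: P3 R] (fun p => scoord (pt p) i : measurableTypeR R).
Proof.
under eq_fun do rewrite scoord_sum sum3.
have h j : measurable_fun [set: P3 R] (fun p => pt p 0 j * invmx W j i : measurableTypeR R).
  by apply: measurable_funM => //; exact: measurable_pt_coord.
by apply: measurable_funD; [apply: measurable_funD|]; exact: h.
Qed.

Lemma measurable_scoord_gt i (a : R) :
  measurable (pt @^-1` [set x | a < scoord x i] : set (P3 R)).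
Proof.
rewrite -[X in measurable X]setTI.
have := measurable_scoord i measurableT (measurable_itv `]a, +oo[).
congr measurable; apply/seteqP.
by split => p /=; rewrite in_itv/= andbT.
Qed.

(** Interpolates between the open simplicial cone, for [xpred0], and a half-open parallelepiped with
    edges [h] times the generators, for [xpredT]. *)
Definition prism (h : R) (f : 'I_3 -> bool) : set 'rV[R]_3 :=
  [set x | forall i, 0 < scoord x i /\ (f i -> scoord x i <= h)].

Lemma measurable_prism h f : measurable (pt @^-1` prism h f : set (P3 R)).
Proof.
rewrite (_ : _ @^-1` _ = \bigcap_(i in [set: 'I_3])
  (pt @^-1` [set x | 0 < scoord x i] `&`
   (if f i then ~` (pt @^-1` [set x | h < scoord x i]) else setT)) :> set (P3 R)).
  apply: fin_bigcap_measurable => // i _; apply: measurableI.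
    exact: measurable_scoord_gt.
  by case: ifP => _ //; apply: measurableC; exact: measurable_scoord_gt.
apply/seteqP; split => [p /= H i _ | p /= H i].
  have [h1 h2] := H i; split => //; case: ifPn => // fi.
  by apply/negP; rewrite -leNgt h2.
have [h1] := H i Logic.I; rewrite /= => h2; split => // fi.
by move: h2; rewrite fi => /negP; rewrite -leNgt.
Qed.

(* [prism h g] is [prism h f] minus its translate by [h *: ws i]. *)
Lemma cint_prism (U V : 'rV[R]_3) (h : R) (f g : 'I_3 -> bool) i : 0 < h -> ~~ f i ->
  (forall j, g j = f j || (j == i)) ->
  cintegrable (pt @^-1` prism h f) (fun p => wave U V (pt p)) ->
  cint (pt @^-1` prism h g) (fun p => wave U V (pt p)) =
  (1 - wave U V (h *: ws i)) * cint (pt @^-1` prism h f) (fun p => wave U V (pt p)).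
Proof.
move=> h0 fi gE fint.
pose B : set (P3 R) := pt @^-1` (prism h f `&` [set x | h < scoord x i]).
have mB : measurable B.
  by rewrite /B preimage_setI; apply: measurableI; [exact: measurable_prism|exact: measurable_scoord_gt].
rewrite -(cint_wave_diff (measurable_prism h f) mB)//.
- congr cint; apply/seteqP; split => [p /= H | p /= [H1 H2] j].
    split.
      by move=> j; have [h1 h2] := H j; split => // fj; apply: h2; rewrite gE fj.
    move=> [_ /=]; have [_] := H i.
    by rewrite gE eqxx orbT => /(_ isT); rewrite leNgt => /negbTE ->.
  have [h1 h2] := H1 j; split => //; rewrite gE => /orP[|/eqP ->]; first exact: h2.
  by rewrite leNgt; apply/negP => h3; apply: H2.
- by move=> p [].
- have sc x j : scoord (x + h *: ws i) j = scoord x j + h * (i == j)%:R.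
    by rewrite scoordD scoordZ scoord_ws.
  apply/seteqP; split => [p /= [H1 H2] j | p /= H].
    move: (H1 j) H2; rewrite /= pt_shift3 !sc eqxx mulr1.
    have [<-|ij] := eqVneq i j; last by rewrite mulr0 addr0.
    move=> _; rewrite ltrDr => hh; split => // fi'.
    by rewrite fi' in fi.
  rewrite /B /= pt_shift3; split.
    move=> j; rewrite sc; have [h1 h2] := H j.
    have [ij|ij] := eqVneq i j; last by rewrite mulr0 addr0.
    rewrite mulr1; split; first by rewrite addr_gt0.
    by rewrite -ij (negbTE fi).
  by rewrite /= sc eqxx mulr1 ltrDr; have [] := H i.
Qed.

(** Bounds the volume of the parallelepiped from below without a determinant. At its centre all
    coordinates are [h / 2]; [N] exceeds twice the absolute column sums of the inverse matrix, so
    within the cube each coordinate moves by less than [h / 2]. *)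
Lemma box_sub_prism : exists2 N : R, 0 < N & forall h : R, 0 < h ->
  box3 ((h / 2) *: (w1 + w2 + w3)) (h / N) `<=` prism h xpredT.
Proof.
pose M i := \sum_j `|invmx W j i|.
have M0 i : 0 <= M i by apply: sumr_ge0.
pose N := 2 * (1 + M 0 + M 1 + M 2).
have N0 : 0 < N by have := M0 0; have := M0 1; have := M0 2; rewrite /N; lra.
have MN i : M i < N / 2.
  by rewrite /N; have := M0 0; have := M0 1; have := M0 2; move: i; apply: ord3P; lra.
exists N => // h h0 z zb i.
set c := (h / 2) *: (w1 + w2 + w3) in zb.
have ci : scoord c i = h / 2.
  have E : w1 + w2 + w3 = 1 *: w1 + 1 *: w2 + 1 *: w3 by rewrite !scale1r.
  rewrite /c scoordZ E scoordE.
  by move: i; apply: ord3P; rewrite mulr1.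
have : `|scoord (z - c) i| < h / 2.
  rewrite scoord_sum; apply: (@le_lt_trans _ _ (\sum_j (h / N) * `|invmx W j i|)).
    apply: le_trans (ler_norm_sum _ _ _) _; apply: ler_sum => j _.
    rewrite normrM ler_wpM2r//; have /ltW := zb j.
    by rewrite [(z - c) 0 j]mxE [(- c) 0 j]mxE.
  rewrite -mulr_sumr -/(M i).
  rewrite (_ : h / 2 = (h / N) * (N / 2)); last by field; rewrite gt_eqF.
  by rewrite ltr_pM2l ?divr_gt0.
rewrite scoordD -scaleN1r scoordZ ci ltr_norml => H; split; last by move=> _; lra.
lra.
Qed.

(** Near 0 both factors exceed 3/4, and 9/16 > 1/2. *)
Lemma wave_Re_ge_half : exists2 eta : R, 0 < eta &
  forall a b : R, `|a| <= eta -> `|b| <= eta -> 2^-1 <= complex.Re (cexp a b).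
Proof.
have c1 : \forall t \near (0 : R), 3 / 4 < expR (- t).
  have c : (expR (- t)) @[t --> (0 : R)] --> expR (- (0 : R)).
    by apply: continuous_comp; [exact: (@opp_continuous R)|exact: continuous_expR].
  by apply: (c (fun y => 3 / 4 < y)); rewrite oppr0 expR0; apply: lt_nbhsr; lra.
have c2 : \forall t \near (0 : R), 3 / 4 < cos t.
  have c := @continuous_cos R 0.
  by apply: (c (fun y => 3 / 4 < y)); rewrite cos0; apply: lt_nbhsr; lra.
have /nbhs_ballP[e e0 He] : nbhs (0 : R) [set t | 3 / 4 < expR (- t) /\ 3 / 4 < cos t].
  by near=> t; split; near: t.
exists (e / 2); first by rewrite divr_gt0.
have inb t : `|t| <= e / 2 -> ball (0 : R) e t.
  rewrite -ball_normE /ball_ /= sub0r normrN => h; apply: le_lt_trans h _.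
  by rewrite ltr_pdivrMr// ltr_pMr// ltr1n.
move=> a b /inb/He[h1 _] /inb/He[_ h2] /=.
have := ltr_pM _ _ h1 h2.
by move=> /(_ _ _); rewrite ?divr_ge0// => /(_ isT isT); lra.
Unshelve. all: by end_near.
Qed.

(** Three removals of translates turn the cone into the parallelepiped and produce the three
    factors. On the parallelepiped the exponent is small, so the integral has real part at least
    half the volume of the inscribed cube. *)
Lemma simplex_lower : exists c0 eta0 : R, [/\ 0 < c0, 0 < eta0 &
  forall (h : R) (U V : 'rV[R]_3), 0 < h ->
  (forall i, `|dot U (ws i)| * h <= eta0 /\ `|dot V (ws i)| * h <= eta0) ->
  cintegrable (pt @^-1` prism h xpred0) (fun p => wave U V (pt p)) ->
  c0 * h ^+ 3 <= n1 (1 - wave U V (h *: w1)) * n1 (1 - wave U V (h *: w2)) *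
    n1 (1 - wave U V (h *: w3)) * n1 (cint (pt @^-1` prism h xpred0) (fun p => wave U V (pt p)))].
Proof.
have [eta eta0 Heta] := wave_Re_ge_half.
have [N N0 HN] := box_sub_prism.
(* Half the volume (2 h / N)^3 of the cube; the third of [eta] accounts for three coordinates, each
   at most [h]. *)
exists (4 / N ^+ 3), (eta / 3); split; [by rewrite divr_gt0// exprn_gt0|by rewrite divr_gt0|].
move=> h U V h0 UV i0.
pose f1 (i : 'I_3) := i == 0; pose f2 (i : 'I_3) := (i == 0) || (i == 1).
have E1 := @cint_prism U V h xpred0 f1 0 h0 isT (fun j => erefl) i0.
have sub (f g : 'I_3 -> bool) : (forall i, f i -> g i) -> pt @^-1` prism h g `<=` pt @^-1` prism h f.
  by move=> fg p H i; have [h1 h2] := H i; split => // /fg.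
have i1 : cintegrable (pt @^-1` prism h f1) (fun p => wave U V (pt p)).
  by apply: (cintegrableS (measurable_prism h xpred0)) => //; [exact: measurable_prism|exact: sub].
have E2 := @cint_prism U V h f1 f2 1 h0 isT (fun j => erefl) i1.
have i2 : cintegrable (pt @^-1` prism h f2) (fun p => wave U V (pt p)).
  by apply: (cintegrableS (measurable_prism h xpred0)) => //; [exact: measurable_prism|exact: sub].
have gT j : xpredT j = f2 j || (j == 2) by move: j; apply: ord3P.
have E3 := @cint_prism U V h f2 xpredT 2 h0 isT gT i2.
have i3 : cintegrable (pt @^-1` prism h xpredT) (fun p => wave U V (pt p)).
  by apply: (cintegrableS (measurable_prism h xpred0)) => //; [exact: measurable_prism|exact: sub].
set Q := cint (pt @^-1` prism h xpred0) (fun p => wave U V (pt p)) in E1 *.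
apply: (@le_trans _ _ (n1 (cint (pt @^-1` prism h xpredT) (fun p => wave U V (pt p))))); last first.
  rewrite E3 E2 E1.
  apply: le_trans (n1M _ _) _.
  rewrite (_ : _ * _ * _ * n1 Q = n1 (1 - wave U V (h *: w3)) * (n1 (1 - wave U V (h *: w2)) *
    (n1 (1 - wave U V (h *: w1)) * n1 Q))); last by ring.
  apply: ler_pM; [exact: n1_ge0|exact: n1_ge0|by []|].
  apply: le_trans (n1M _ _) _.
  apply: ler_pM; [exact: n1_ge0|exact: n1_ge0|by []|].
  exact: n1M.
apply: (@le_trans _ _ (complex.Re (cint (pt @^-1` prism h xpredT) (fun p => wave U V (pt p))))); last first.
  by rewrite /n1; apply: le_trans (ler_norm _) _; rewrite lerDl.
set b : set (P3 R) := pt @^-1` box3 ((h / 2) *: (w1 + w2 + w3)) (h / N).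
have mb : measurable b by exact: measurable_box3.
have hN : 0 <= h / N by rewrite divr_ge0// ltW.
have bP : b `<=` pt @^-1` prism h xpredT by move=> p; exact: HN.
have mP := measurable_prism h xpredT.
have Rge p : prism h xpredT (pt p) -> 2^-1 <= complex.Re (wave U V (pt p)).
  move=> H.
  have bd Z : (forall i, `|dot Z (ws i)| * h <= eta / 3) -> `|dot Z (pt p)| <= eta.
    move=> HZ; rewrite (scoord_decomp (pt p)) !dotDr !dotZr.
    have hi i : `|scoord (pt p) i * dot Z (ws i)| <= eta / 3.
      have [l0 /(_ isT) lh] := H i.
      rewrite normrM (gtr0_norm l0); apply: le_trans (HZ i).
      by rewrite mulrC ler_wpM2l.
    rewrite (_ : eta = eta / 3 + eta / 3 + eta / 3); last by field.
    apply: le_trans (ler_normD _ _) _; apply: lerD; last exact: (hi 2).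
    apply: le_trans (ler_normD _ _) _; apply: lerD; [exact: (hi 0)|exact: (hi 1)].
  apply: Heta; apply: bd => i; by have [] := UV i.
rewrite /cint /=.
have [iR _] := i3.
rewrite -(setDUK bP) Rintegral_setU//; last 3 first.
- exact: measurableD.
- by rewrite setDUK.
- by rewrite disj_set2E setDE setICA setICr setI0.
rewrite -[leLHS]addr0; apply: lerD; last first.
  by apply: Rintegral_ge0 => p [Pp _]; apply: le_trans (Rge _ Pp).
have ic : mu.-integrable b (EFin \o cst (2^-1 : R)).
  apply/integrableP; split; first exact/measurable_EFinP.
  rewrite /= integral_cst// /b leb3_box3// -EFinM ltry//.
apply: (@le_trans _ _ (\int[mu]_(p in b) 2^-1)).
  rewrite Rintegral_cst// /b leb3_box3//=.
  rewrite [leRHS](_ : _ = 4 / N ^+ 3 * h ^+ 3)//.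
  by field; rewrite gt_eqF.
apply: le_Rintegral => //.
- exact: (integrableS mP mb bP).
- by move=> p bp; apply: Rge; exact: bP.
Qed.

End simplex.

(** * Lower bound for the transform of the cone *)

Section cone_lower_bound.
Context {R : realType}.
Notation mu := (leb3 R).

(** The reciprocal of 1 plus the sum of the inverses is a bound that makes sense for an empty index
    set too. *)
Lemma fin_pos_lower_bound (I : finType) (P : pred I) (f : I -> R) :
  (forall i, P i -> 0 < f i) -> exists2 m : R, 0 < m & forall i, P i -> m <= f i.
Proof.
move=> f0; pose s := \sum_(i | P i) (f i)^-1.
have s0 : 0 <= s by apply: sumr_ge0 => i /f0 fi; rewrite invr_ge0 ltW.
have s1 : 0 < 1 + s by rewrite ltr_wpDr.
exists (1 + s)^-1 => [|i Pi]; first by rewrite invr_gt0.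
rewrite invf_ple ?posrE ?f0// /s (bigD1 i)//= addrCA lerDl addr_ge0//.
by apply: sumr_ge0 => j /andP[/f0 fj _]; rewrite invr_ge0 ltW.
Qed.

Variables (n : nat) (w : 'I_n -> 'rV[R]_3) (j0 k l : 'I_n) (d : 'rV[R]_3)
  (al be ga : 'I_n -> R).
Hypothesis frame : cone_frame w j0 k l d al be ga.

Notation a := (w j0).
Notation ell := (scoord a (w k) (w l)).
Notation simplex := (prism a (w k) (w l) 1 xpred0).

Lemma cone_decomp (c : 'I_n -> R) : \sum_j c j *: w j =
  (\sum_j c j * ga j) *: a + (\sum_j c j * al j) *: w k + (\sum_j c j * be j) *: w l.
Proof.
rewrite [LHS](eq_bigr (fun j => (c j * ga j) *: a + (c j * al j) *: w k + (c j * be j) *: w l)).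
  by rewrite !big_split/= !scaler_suml.
by move=> j _; rewrite {1}(cf_dec frame j) !scalerDr !scalerA.
Qed.

Lemma ga_j0 : ga j0 = 1.
Proof.
have := free3P (cf_free frame) (a := ga j0 - 1) (b := al j0) (c := be j0).
move=> H; have [] := H; last by move=> /eqP; rewrite subr_eq0 => /eqP.
by rewrite scalerBl scale1r -addrA addrAC addrA -(cf_dec frame j0) subrr.
Qed.

(** Membership in the cone asks for a positive coefficient at every generator. A small multiple
    [eta] of the sum of all generators is split off, and the remainder keeps nonnegative coordinates
    on [a], [w k], [w l]. *)
Lemma simplex_sub_cone : simplex `<=` cone w 0.
Proof.
move=> x sx.
have sx0 i : 0 < ell x i by have [] := sx i.
have [la la0 Hla] := @fin_pos_lower_bound _ xpredT (ell x) (fun i _ => sx0 i).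
pose G (i : 'I_3) := [:: \sum_j ga j; \sum_j al j; \sum_j be j]`_i.
pose T := 1 + `|G 0| + `|G 1| + `|G 2|.
have T0 : 0 < T.
  by rewrite /T; have := normr_ge0 (G 0); have := normr_ge0 (G 1); have := normr_ge0 (G 2); lra.
pose eta := la / T.
have eta0 : 0 < eta by rewrite divr_gt0.
have HG i : 0 <= ell x i - eta * G i.
  rewrite subr_ge0; apply: le_trans (Hla i isT).
  apply: le_trans (ler_norm _) _; rewrite normrM gtr0_norm// /eta mulrAC ler_pdivrMr// ler_pM2l//.
  rewrite /T; have := normr_ge0 (G 0); have := normr_ge0 (G 1); have := normr_ge0 (G 2).
  by move: i; apply: ord3P; lra.
pose r i := ell x i - eta * G i.
exists (fun j => eta + (j == j0)%:R * r 0 + (j == k)%:R * r 1 + (j == l)%:R * r 2).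
  by move=> j; rewrite !ltr_wpDr// mulr_ge0//; exact: HG.
rewrite add0r {1}(scoord_decomp (cf_free frame) x).
have pick (i : 'I_n) (t : R) : \sum_j ((j == i)%:R * t) *: w j = t *: w i.
  rewrite (bigD1 i)//= eqxx mul1r big1 ?addr0// => j /negbTE ->.
  by rewrite mul0r scale0r.
rewrite [RHS](eq_bigr (fun j => eta *: w j + ((j == j0)%:R * r 0) *: w j +
    ((j == k)%:R * r 1) *: w j + ((j == l)%:R * r 2) *: w j)); last first.
  by move=> j _; rewrite !scalerDl.
rewrite !big_split/= !pick -scaler_sumr.
have -> : \sum_j w j = G 0 *: a + G 1 *: w k + G 2 *: w l.
  have := cone_decomp (fun=> 1); under eq_bigr do rewrite scale1r.
  by move=> ->; rewrite /G /=; congr (_ *: _ + _ *: _ + _ *: _); apply: eq_bigr => j _; rewrite mul1r.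
rewrite !scalerDr !scalerA /r !scalerBl.
apply/rowP => i; rewrite !mxE; ring.
Qed.

Lemma mul_ge_34 (c x y : R) : 3 / 4 <= c -> 0 <= y -> y <= x -> 3 / 4 * y <= c * x.
Proof. by move=> h1 h2 h3; apply: ler_pM => //; lra. Qed.

Lemma mul_le_bound (c b x y : R) : 0 <= c -> c <= b -> 0 <= x -> x <= y -> c * x <= b * y.
Proof. by move=> h1 h2 h3 h4; apply: ler_pM. Qed.

Lemma small_coeffs (s : R) : 0 < s -> s < 1 / 2 ->
  [/\ 3 / 4 <= 1 - s ^+ 2, 0 <= 1 - s ^+ 2 <= 1, 0 <= 2 * s <= 1 & 0 <= 1 + s ^+ 2 <= 3].
Proof.
move=> s0 sh; have s2 : s ^+ 2 <= s / 2 by rewrite expr2 ler_wpM2l ?(ltW s0)//; lra.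
have s20 : 0 <= s ^+ 2 by rewrite exprn_ge0// ltW.
by split; lra.
Qed.

(* For small [s] the ray of [a] is almost orthogonal to [u]: the simplicial cone of [a]
   and its two neighbours contributes at least a multiple of [s^-1 tau^-3], and the rest
   of the cone, on which [dot d] is bounded below, at most a multiple of [tau^-3]. *)
Lemma cone_lower_bound : measurable (pt @^-1` cone w 0 : set (P3 R)) ->
  exists2 s1 : R, 0 < s1 & forall s, 0 < s < s1 ->
    let u := (1 - s ^+ 2) *: d + (2 * s) *: a in
    let v := (1 + s ^+ 2) *: cross a d in
    (exists2 del : R, 0 < del & forall x, cone w 0 x -> del * S1 x <= dot u x) /\
    forall tau : R, 0 < tau ->
      1 <= tau ^+ 3 * n1 (cint (pt @^-1` cone w 0) (fun p => wave (tau *: u) (tau *: v) (pt p))).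
Proof.
move=> mK.
have [m m0 Hm] := fin_pos_lower_bound (cf_pos frame).
have aa := cf_a frame; have dd := cf_d frame; have da := cf_da frame.
pose S := 1 + \sum_j S1 (w j).
have sS0 : 0 <= \sum_j S1 (w j) by apply: sumr_ge0 => j _; exact: S1_ge0.
have S0 : 0 < S by rewrite /S; lra.
have S1S j : S1 (w j) <= S.
  rewrite /S (bigD1 j)//= addrCA lerDl addr_ge0//.
  by apply: sumr_ge0 => i _; exact: S1_ge0.
pose Ga := 1 + \sum_j `|ga j|.
have sG0 : 0 <= \sum_j `|ga j| by apply: sumr_ge0.
have Ga0 : 0 < Ga by rewrite /Ga; lra.
have GaG j : `|ga j| <= Ga - 1.
  by rewrite /Ga addrC addKr (bigD1 j)//= lerDl sumr_ge0.
have [c0 [eta0 [c00 eta00 Hlow]]] := simplex_lower (cf_free frame).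
pose del0 := m / (S * Ga).
have del00 : 0 < del0 by rewrite divr_gt0// mulr_gt0.
(* With [h = ka / tau], the values of [tau *: u] and [tau *: v] on the generators, at most
   [3 * S * tau], become at most [eta0] after multiplication by [h]. *)
pose ka := eta0 / (3 * S).
have ka0 : 0 < ka by rewrite divr_gt0// mulr_gt0.
have kaE : 3 * S * ka = eta0 by rewrite /ka mulrC divfK// gt_eqF// mulr_gt0.
clearbody ka.
pose C1 := 4 * (2 / (del0 / 2)) ^+ 3.
have C10 : 0 < C1 by rewrite mulr_gt0// exprn_gt0// divr_gt0// divr_gt0.
(* The four bounds keep [1 - s ^+ 2] above 3/4, absorb the [a] component of [u] outside the simplex,
   absorb it at the generators, and let the simplex outweigh the remainder [C1]. *)
pose s1 := Num.min (1 / 2) (Num.min (del0 / 8) (Num.min (m / (8 * S)) (c0 * ka ^+ 2 / (18 * (1 + C1))))).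
have p1 : 0 < 8 * S by rewrite mulr_gt0.
have p2 : 0 < 18 * (1 + C1) by rewrite mulr_gt0// addr_gt0.
have p3 : 0 < c0 * ka ^+ 2 by rewrite mulr_gt0// exprn_gt0.
have s10 : 0 < s1 by rewrite !lt_min; apply/and4P; split; exact: divr_gt0.
exists s1 => // s /andP[s0]; rewrite !lt_min => /and4P[sh sd sm sc] u v.
have bound (e x : 'rV[R]_3) : dot e e = 1 -> `|dot e x| <= S1 x by exact: dot_le_S1.
pose d' := cross a d.
have dd' : dot d' d' = 1 by rewrite dot_cross aa dd dotC da expr0n/= mulr1 subr0.
have uE (x : 'rV[R]_3) : dot u x = (1 - s ^+ 2) * dot d x + 2 * s * dot a x by rewrite dotDl !dotZl.
have ua : dot u a = 2 * s by rewrite uE da aa mulr0 add0r mulr1.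
have va : dot v a = 0 by rewrite dotZl dot_crossl mulr0.
have vE (x : 'rV[R]_3) : dot v x = (1 + s ^+ 2) * dot d' x by rewrite dotZl.
have [s34 s01 s10' s54] := small_coeffs s0 sh.
clearbody u v d'.
have uw j : j != j0 -> m / 2 <= dot u (w j).
  move=> jj0; rewrite uE; have := Hm j jj0 => h1.
  have := bound a (w j) aa; rewrite ler_norml => /andP[h2 _].
  have h3 : - S <= dot a (w j) by apply: le_trans h2; rewrite lerN2.
  have h4 : s * (8 * S) < m by rewrite -ltr_pdivlMr// mulr_gt0.
  have h5 : s * (- S) <= s * dot a (w j) by rewrite ler_wpM2l// ltW.
  have h6 : 3 / 4 * m <= (1 - s ^+ 2) * dot d (w j).
    by apply: mul_ge_34 => //; exact: ltW.
  by move: h4 h5 h6 h3 m0; clear; intros; lra.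
have uw0 j : 0 <= dot u (w j).
  have [->|jj0] := eqVneq j j0; first by rewrite ua mulr_ge0// ltW.
  by apply: le_trans (uw j jj0); rewrite divr_ge0// ltW.
have coneE x : cone w 0 x -> exists2 c : 'I_n -> R, (forall j, 0 < c j) &
    x = \sum_j c j *: w j.
  by move=> [c c_gt0 ->]; exists c => //; rewrite add0r.
have [del del_gt0 tube] : exists2 del : R, 0 < del & forall x, cone w 0 x -> del * S1 x <= dot u x.
  (* A lower bound for [u] on all generators. It tends to 0 with [s], so it serves only at fixed
     [s]; the comparison of the two pieces rests on [del0]. *)
  pose q := Num.min (2 * s) (m / 2).
  have q0 : 0 < q by rewrite lt_min mulr_gt0// divr_gt0.
  exists (q / S); first by rewrite divr_gt0.
  move=> x /coneE[c c_gt0 ->]; rewrite dot_sumr.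
  apply: (@le_trans _ _ (q * \sum_j c j)).
    rewrite mulrAC ler_pdivrMr// -mulrA ler_wpM2l ?(ltW q0)//.
    apply: le_trans (S1_sum _ _) _; first by move=> j; exact: ltW.
    by rewrite ler_wpM2l ?sumr_ge0// => [j _|]; [exact: ltW|rewrite lerDr].
  rewrite mulr_sumr; apply: ler_sum => j _; rewrite mulrC ler_wpM2l ?(ltW (c_gt0 j))//.
  have [->|jj0] := eqVneq j j0; first by rewrite ua /q ge_min lexx.
  by apply: le_trans (uw j jj0); rewrite /q ge_min lexx orbT.
split; first by exists del.
move=> tau tau0.
set f := fun p : P3 R => _.
pose A : set (P3 R) := pt @^-1` simplex.
have mA : measurable A by exact: measurable_prism.
have AK : A `<=` pt @^-1` cone w 0 by move=> p; exact: simplex_sub_cone.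
have mKA := measurableD mK mA.
(* Outside the simplex the coordinate along [a] is nonpositive, so [c j0] is at most a multiple of
   the sum of the other coefficients. Their generators satisfy [dot d (w j) >= m], whence
   [dot d x >= del0 * S1 x] with [del0] independent of [s]. *)
have diff p : (pt @^-1` cone w 0 `\` A) p -> tau * (del0 / 2) * S1 (pt p) <= dot (tau *: u) (pt p).
  move=> [/coneE[c c_gt0 xE] nA]; rewrite dotZl -mulrA ler_wpM2l ?(ltW tau0)//.
  set x := pt p in xE nA *.
  have ellE : x = (\sum_j c j * ga j) *: a + (\sum_j c j * al j) *: w k + (\sum_j c j * be j) *: w l.
    by rewrite xE cone_decomp.
  have l1 : 0 < ell x 1.
    rewrite ellE scoordE ?(cf_free frame)//= (bigD1 k)//= ltr_wpDr//.
      by apply: sumr_ge0 => j _; have [h _] := cf_ge0 frame j; rewrite mulr_ge0// ltW.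
    by rewrite mulr_gt0// (cf_k frame).
  have l2 : 0 < ell x 2.
    rewrite ellE scoordE ?(cf_free frame)//= (bigD1 l)//= ltr_wpDr//.
      by apply: sumr_ge0 => j _; have [_ h] := cf_ge0 frame j; rewrite mulr_ge0// ltW.
    by rewrite mulr_gt0// (cf_l frame).
  have l0 : ell x 0 <= 0.
    by rewrite leNgt; apply/negP => l0; apply: nA => i; split => //; move: i; apply: ord3P.
  pose so := \sum_(j | j != j0) c j.
  have so0 : 0 <= so by apply: sumr_ge0 => j _; exact: ltW.
  have cj0 : c j0 <= (Ga - 1) * so.
    move: l0; rewrite ellE scoordE ?(cf_free frame)//= (bigD1 j0)//= ga_j0 mulr1 => h.
    have h' : - \sum_(j | j != j0) c j * ga j <= (Ga - 1) * so.
      rewrite -sumrN mulr_sumr; apply: ler_sum => j _.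
      rewrite -mulrN mulrC ler_wpM2r ?(ltW (c_gt0 j))//.
      by apply: le_trans (GaG j); rewrite -normrN ler_norm.
    by move: h; rewrite -lerBrDr sub0r => /le_trans; exact.
  have sc' : \sum_j c j <= Ga * so by rewrite (bigD1 j0)//= -/so -lerBrDr (le_trans cj0)// mulrBl mul1r.
  have dx : m * so <= dot d x.
    rewrite xE dot_sumr (bigD1 j0)//= da mulr0 add0r mulr_sumr.
    by apply: ler_sum => j jj0; rewrite mulrC ler_wpM2l ?(ltW (c_gt0 j))// Hm.
  have Sx : S1 x <= S * Ga * so.
    rewrite xE; apply: le_trans (S1_sum _ _) _; first by move=> j; exact: ltW.
    rewrite mulrC -mulrA; apply: ler_pM => //; last by rewrite lerDr.
    by apply: sumr_ge0 => j _; exact: ltW.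
  have dS : del0 * S1 x <= dot d x.
    apply: le_trans dx; rewrite /del0 mulrAC ler_pdivrMr ?mulr_gt0//.
    by rewrite -mulrA ler_wpM2l ?(ltW m0)// mulrC.
  have := bound a x aa; rewrite ler_norml => /andP[ax _].
  rewrite uE.
  have S1x := S1_ge0 x.
  have h5 : s * (- S1 x) <= s * dot a x by rewrite ler_wpM2l// ltW.
  have h6 : 3 / 4 * (del0 * S1 x) <= (1 - s ^+ 2) * dot d x.
    have dS0 : 0 <= del0 * S1 x by rewrite mulr_ge0// ltW.
    exact: mul_ge_34.
  have h7 : s * S1 x <= del0 / 8 * S1 x by rewrite ler_wpM2r// ltW.
  by move: h5 h6 h7; clear; intros; lra.
have iKA : cintegrable (pt @^-1` cone w 0 `\` A) f.
  by apply: (@cintegrable_wave _ _ _ _ (tau * (del0 / 2))) => //; rewrite mulr_gt0// divr_gt0.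
have hKA : n1 (cint (pt @^-1` cone w 0 `\` A) f) <= C1 / tau ^+ 3.
  have td : 0 < tau * (del0 / 2) by rewrite mulr_gt0// divr_gt0.
  apply: le_trans (@cint_wave_le _ (tau *: u) (tau *: v) _ _ td mKA diff) _.
  rewrite /C1 le_eqVlt; apply/orP; left; apply/eqP.
  by field; rewrite !gt_eqF.
have iK : cintegrable (pt @^-1` cone w 0) f.
  apply: (@cintegrable_wave _ _ _ _ (tau * del)) => //; first by rewrite mulr_gt0.
  by move=> p Kp; rewrite dotZl -mulrA ler_wpM2l ?(ltW tau0)// tube.
have iA : cintegrable A f by exact: cintegrableS iK.
have KE : cint (pt @^-1` cone w 0) f = cint A f + cint (pt @^-1` cone w 0 `\` A) f.
  rewrite -cint_setU// ?setDUK//.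
  by rewrite disj_set2E setDE setICA setICr setI0.
pose h := ka / tau.
have h0 : 0 < h by rewrite divr_gt0.
have pE : prism a (w k) (w l) h xpred0 = simplex.
  by apply/seteqP; split => x H i; have [h1 _] := H i.
have Hu j : `|dot u (w j)| <= 3 * S /\ `|dot v (w j)| <= 3 * S.
  have b1 := le_trans (bound d (w j) dd) (S1S j).
  have b2 := le_trans (bound a (w j) aa) (S1S j).
  have b3 := le_trans (bound d' (w j) dd') (S1S j).
  split.
    rewrite uE; apply: le_trans (ler_normD _ _) _; rewrite !normrM.
    case/andP: s01 => s010 s011; case/andP: s10' => s100 s101.
    rewrite (ger0_norm s010) (@ger0_norm _ 2)// (ger0_norm (ltW s0)).
    have := mul_le_bound s010 s011 (normr_ge0 _) b1.
    have := mul_le_bound s100 s101 (normr_ge0 _) b2.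
    by move: S0; clear; intros; lra.
  case/andP: s54 => s540 s541.
  by rewrite vE normrM (ger0_norm s540) mul_le_bound.
have th : tau * h = ka by rewrite /h mulrC divfK// gt_eqF.
have Htau e (y : 'rV[R]_3) : `|dot e y| <= 3 * S -> `|dot (tau *: e) y| * h <= eta0.
  move=> ey; rewrite dotZl normrM (gtr0_norm tau0) mulrAC th.
  by rewrite -kaE mulrC ler_wpM2r// ltW.
have HH (i : 'I_3) : `|dot (tau *: u) [:: a; w k; w l]`_i| * h <= eta0 /\
    `|dot (tau *: v) [:: a; w k; w l]`_i| * h <= eta0.
  by move: i; apply: ord3P => /=; split; apply: Htau; apply: (Hu _).1 || apply: (Hu _).2.
have := Hlow h (tau *: u) (tau *: v) h0 HH; rewrite pE => /(_ iA).
(* [v] vanishes on [a], so the wave is real along this ray and differs from 1 by at most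
   [2 * s * ka]: this is where the gain from a small [s] comes from. *)
have n1a : n1 (1 - wave (tau *: u) (tau *: v) (h *: a)) <= 2 * s * ka.
  rewrite /wave !dotZl !dotZr ua va !mulr0 mulrA th /cexp cos0 sin0 !mulr0 oppr0 mulr1.
  rewrite /n1 !ReImE /= subr0 normr0 addr0 ger0_norm.
    by rewrite (mulrC _ ka) lerBlDr -lerBlDl expR_ge1Dx.
  by rewrite subr_ge0 expR_le1 oppr_le0 !mulr_ge0// ltW.
have n1w j : n1 (1 - wave (tau *: u) (tau *: v) (h *: w j)) <= 3.
  apply: le_trans (n1B _ _) _.
  have -> : n1 (1 : R[i]) = 1 by rewrite /n1/= normr0 addr0 normr1.
  have e1 : expR (- dot (tau *: u) (h *: w j)) <= 1.
    by rewrite expR_le1 oppr_le0 dotZl dotZr (mulr_ge0 (ltW tau0) (mulr_ge0 (ltW h0) (uw0 j))).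
  have := n1_cexp (dot (tau *: u) (h *: w j)) (dot (tau *: v) (h *: w j)).
  by rewrite -/(wave _ _ _); move: e1; clear; intros; lra.
set I := n1 (cint A f) => HI.
have I0 : 0 <= I by exact: n1_ge0.
have HI' : c0 * h ^+ 3 <= 2 * s * ka * 3 * 3 * I.
  apply: le_trans HI _; rewrite ler_wpM2r//.
  apply: ler_pM; [by rewrite mulr_ge0// n1_ge0|exact: n1_ge0| |exact: n1w].
  by apply: ler_pM; [exact: n1_ge0|exact: n1_ge0| |exact: n1w].
have t3 : 0 < tau ^+ 3 by rewrite exprn_gt0.
have HI2 : c0 * ka ^+ 2 <= 18 * s * (tau ^+ 3 * I).
  have E : c0 * h ^+ 3 = (c0 * ka ^+ 2) * (ka / tau ^+ 3) by rewrite /h; field; rewrite gt_eqF.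
  move: HI'; rewrite E -(ler_pM2r (x := tau ^+ 3 / ka)) ?divr_gt0//.
  have -> : c0 * ka ^+ 2 * (ka / tau ^+ 3) * (tau ^+ 3 / ka) = c0 * ka ^+ 2.
    by field; rewrite !gt_eqF.
  have -> // : 2 * s * ka * 3 * 3 * I * (tau ^+ 3 / ka) = 18 * s * (tau ^+ 3 * I).
  by field; rewrite !gt_eqF.
(* The simplex contributes at least c0 ka^2 / (18 s tau^3); the last bound in [s1] makes [tau ^+ 3]
   times this exceed [1 + C1], so that 1 is left after subtracting the remainder. *)
have HI3 : 1 + C1 <= tau ^+ 3 * I.
  move: sc; rewrite ltr_pdivlMr// => sc.
  rewrite -(ler_pM2l (x := 18 * s)) ?mulr_gt0//.
  apply: le_trans HI2; rewrite (_ : 18 * s * (1 + C1) = s * (18 * (1 + C1))) ?ltW//.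
  by rewrite mulrA (mulrC s).
rewrite KE.
have : I <= n1 (cint A f + cint (pt @^-1` cone w 0 `\` A) f) + C1 / tau ^+ 3.
  apply: le_trans (lerD (lexx _) hKA).
  by rewrite -(n1N (cint (pt @^-1` cone w 0 `\` A) f)); apply: le_trans (n1D _ _); rewrite addrK.
move: (n1 (cint A f + _)) => X HX0.
have HX : tau ^+ 3 * I <= tau ^+ 3 * X + tau ^+ 3 * (C1 / tau ^+ 3).
  by rewrite -mulrDr ler_wpM2l// ltW.
have := le_trans HI3 HX; rewrite [tau ^+ 3 * (C1 / _)]mulrC divfK ?gt_eqF//.
by rewrite lerD2r.
Qed.

End cone_lower_bound.

(** * Weak curl identities *)

Section weak_identity.
Context {R : realType}.
Notation mu := (leb3 R).
Implicit Types (A : set 'rV[R]_3) (u : 'rV[R]_3 -> 'rV[R[i]]_3).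

Lemma leb3_bounded_lty A : open A -> bounded_set A -> (mu (pt @^-1` A) < +oo)%E.
Proof.
move=> oA [M [_ HM]].
pose r := `|M| + 2.
have r0 : 0 <= r by rewrite addr_ge0.
have sub : pt @^-1` A `<=` (pt @^-1` box3 0 r : set (P3 R)).
  move=> p /= Ap; have := HM (`|M| + 1) _ _ Ap => /=.
  rewrite (le_lt_trans (ler_norm M)) ?ltrDl// => /(_ isT) h i.
  have : `|pt p 0 i| <= `|pt p|.
    rewrite [leRHS]/Num.norm /= mx_normrE.
    by apply/bigmax_geP; right => /=; exists (0, i).
  rewrite [X in _ - X]mxE subr0 => h'; apply: le_lt_trans (le_trans h' h) _.
  by rewrite /r ltrD2l ltr1n.
apply: (@le_lt_trans _ _ (mu (pt @^-1` box3 0 r))); last by rewrite leb3_box3// ltry.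
by apply: le_measure => //; rewrite inE; [exact: open_measurable_pt|exact: measurable_box3].
Qed.

Lemma n1_coord_sqr (v : 'rV[R[i]]_3) (i : 'I_3) :
  complex.Re (v 0 i) ^+ 2 + complex.Im (v 0 i) ^+ 2 <= cnorm v ^+ 2.
Proof.
have h j : 0 <= complex.Re (v 0 j) ^+ 2 + complex.Im (v 0 j) ^+ 2.
  by rewrite addr_ge0// sqr_ge0.
rewrite /cnorm sqr_sqrtr ?sumr_ge0// (bigD1 i)//= lerDl.
by apply: sumr_ge0.
Qed.

(** A weighted Young inequality in place of Cauchy-Schwarz: the weight [k] is chosen so as to
    balance the two terms after integration. *)
Lemma n1_young (v : 'rV[R[i]]_3) (i : 'I_3) (k e : R) : 0 < k -> 0 <= e ->
  n1 (v 0 i) * e <= k * cnorm v ^+ 2 + k^-1 * e ^+ 2.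
Proof.
move=> k0 e0; have h := n1_coord_sqr v i.
apply: (@le_trans _ _ (k * (complex.Re (v 0 i) ^+ 2 + complex.Im (v 0 i) ^+ 2) + k^-1 * e ^+ 2)).
  rewrite /n1 -(real_normK (num_real (complex.Re _))) -(real_normK (num_real (complex.Im _))).
  move: (`|complex.Re (v 0 i)|) (`|complex.Im (v 0 i)|) => a b.
  have h1 := sqr_ge0 (k * a - e / 2); have h2 := sqr_ge0 (k * b - e / 2).
  have h3 := sqr_ge0 e.
  rewrite -subr_ge0.
  have -> : k * (a ^+ 2 + b ^+ 2) + k^-1 * e ^+ 2 - (a + b) * e =
     k^-1 * ((k * a - e / 2) ^+ 2 + (k * b - e / 2) ^+ 2 + e ^+ 2 / 2).
    by field; rewrite gt_eqF.
  by rewrite mulr_ge0 ?invr_ge0 ?(ltW k0)// !addr_ge0// divr_ge0.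
by rewrite lerD2r ler_wpM2l// ltW.
Qed.

Lemma L2field_cmeasurable A u i : L2field A u ->
  cmeasurable (pt @^-1` A) (fun p => u (pt p) 0 i).
Proof. by move=> [/(_ i)[h1 h2] _]; split. Qed.

Lemma L2field_cintegrable A u i (D : set (P3 R)) (g : P3 R -> R[i]) (M : R) :
  open A -> bounded_set A -> measurable D -> D `<=` pt @^-1` A -> L2field A u ->
  cmeasurable D g -> (forall p, D p -> n1 (g p) <= M) ->
  cintegrable D (fun p => u (pt p) 0 i * g p).
Proof.
move=> oA bA mD DA uL gm gM.
have mA := open_measurable_pt oA.
have [_ ui] := uL.
have M0 p : D p -> 0 <= M by move=> /gM; apply: le_trans; exact: n1_ge0.
have ic : mu.-integrable (pt @^-1` A) (EFin \o cst (`|M| ^+ 2)).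
  apply/integrableP; split; first exact/measurable_EFinP.
  rewrite /= integral_cst//; apply: lte_mul_pinfty => //; exact: leb3_bounded_lty.
have ih := integrableD mA ui ic.
apply: (@cintegrable_le _ _ _ (fun p => cnorm (u (pt p)) ^+ 2 + `|M| ^+ 2)) => //.
- apply: cmeasurableM => //.
  have [h1 h2] := L2field_cmeasurable i uL.
  by split; [exact: measurable_funS h1|exact: measurable_funS h2].
- by apply: (integrableS mA) => //; apply: eq_integrable ih.
- move=> p Dp; apply: le_trans (n1M _ _) _.
  apply: (@le_trans _ _ (n1 (u (pt p) 0 i) * `|M|)).
    by rewrite ler_wpM2l ?n1_ge0//; apply: le_trans (gM _ Dp) (ler_norm _).
  by have := n1_young (u (pt p)) i ltr01 (normr_ge0 M); rewrite invr1 !mul1r.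
Qed.

Lemma compact_support_bounded (f : 'rV[R]_3 -> R) :
  continuous f -> compact (closure [set x | f x != 0]) -> exists M : R, forall x, `|f x| <= M.
Proof.
move=> cf cs.
have [M [_ HM]] := compact_bounded (continuous_compact (continuous_subspaceT cf) cs).
exists (`|M| + 1) => x.
have [fx|fx] := eqVneq (f x) 0; first by rewrite fx normr0 addr_ge0.
apply: HM; first by rewrite (le_lt_trans (ler_norm M))// ltrDl.
by exists x => //; exact: subset_closure.
Qed.

Lemma partial_support (f : 'rV[R]_3 -> R) i x :
  ~ closure [set x | f x != 0] x -> partial i f x = 0.
Proof.
move=> nx; apply: (@partial_near_cst _ f i x 0).
have : nbhs x (~` closure [set x | f x != 0]).
  by apply: open_nbhs_nbhs; split => //; apply: closed_openC; exact: closed_closure.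
apply: filterS => y ny; apply/eqP; apply/negPn/negP => fy.
by apply: ny; exact: subset_closure.
Qed.

Lemma partial_bounded (f : 'rV[R]_3 -> R) i :
  Cinf f -> compact (closure [set x | f x != 0]) -> exists M : R, forall x, `|partial i f x| <= M.
Proof.
move=> cf cs; apply: compact_support_bounded.
  by apply: Cinf_continuous; exact: Cinf_partial.
apply: (@subclosed_compact _ _ (closure [set x | f x != 0])) => //; first exact: closed_closure.
rewrite [X in _ `<=` X]((closure_id (closure [set x | f x != 0])).1 (@closed_closure _ _)).
apply: closure_subset => x /= fx; apply/not_notP => nx.
by move: fx; rewrite partial_support ?eqxx.
Qed.

(** The product of [u] with the curl of [f] times the basis vector [j]: the curl identities are used
    one component at a time, against scalar test functions. *)
Definition curl_pair u (f : 'rV[R]_3 -> R) (j : 'I_3) (x : 'rV[R]_3) : R[i] :=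
  u x 0 (j + 1) * (partial (j + 2) f x)%:C - u x 0 (j + 2) * (partial (j + 1) f x)%:C.

Lemma ord3_shift : ((0 + 1 = 1 :> 'I_3)%R * (0 + 2 = 2 :> 'I_3)%R * (1 + 1 = 2 :> 'I_3)%R
  * (1 + 2 = 0 :> 'I_3)%R * (2 + 1 = 0 :> 'I_3)%R * (2 + 2 = 1 :> 'I_3)%R)%type.
Proof. by do !split; apply: val_inj. Qed.

Lemma cdot_delta (u : 'rV[R[i]]_3) (j : 'I_3) (c : R) : cdot u (c *: delta_mx 0 j) = u 0 j * c%:C.
Proof.
rewrite /cdot (bigD1 j)//= big1 ?addr0; first by rewrite !mxE !eqxx mulr1.
by move=> i ij; rewrite !mxE eqxx (negbTE ij) mulr0 /= mulr0.
Qed.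

Lemma cdot_scurl_delta u (f : 'rV[R]_3 -> R) (j : 'I_3) x :
  cdot (u x) (scurl (fun y => f y *: delta_mx 0 j) x) = curl_pair u f j x.
Proof.
have E (i m : 'I_3) : partial i (fun y => (f y *: delta_mx 0 j : 'rV[R]_3) 0 m) x =
    if m == j then partial i f x else 0.
  have [->|mj] := eqVneq m j.
    by congr partial; apply/funext => y; rewrite !mxE !eqxx mulr1.
  rewrite (_ : (fun y => _) = cst 0) ?/partial ?derive_cst//.
  by apply/funext => y; rewrite !mxE (negbTE mj) andbF mulr0.
rewrite /cdot sum3 /scurl !mxE !E /curl_pair.
have CN (z : R) : (- z)%:C = - z%:C by apply: complex_eqP; rewrite /= ?oppr0.
have C0 : (0 : R)%:C = 0 by [].
have eqs : ((0 == 1 :> 'I_3)%R = false) * ((0 == 2 :> 'I_3)%R = false) * ((1 == 0 :> 'I_3)%R = false)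
  * ((1 == 2 :> 'I_3)%R = false) * ((2 == 0 :> 'I_3)%R = false) * ((2 == 1 :> 'I_3)%R = false) by [].
move: j {E}; apply: ord3P; rewrite !ord3_shift !(eqxx, eqs).
- move: (partial 1 f x) (partial 2 f x) (u x 0 0) (u x 0 1) (u x 0 2) => b c d e g.
  by rewrite !subr0 sub0r CN C0 mulr0 add0r mulrN.
- move: (partial 0 f x) (partial 2 f x) (u x 0 0) (u x 0 1) (u x 0 2) => b c d e g.
  by rewrite !subr0 sub0r CN C0 mulr0 addr0 mulrN addrC.
- move: (partial 0 f x) (partial 1 f x) (u x 0 0) (u x 0 1) (u x 0 2) => b c d e g.
  by rewrite !subr0 sub0r CN C0 mulr0 addr0 mulrN.
Qed.

Lemma delta_test_field (f : 'rV[R]_3 -> R) (j : 'I_3) : Cinf f ->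
  compact (closure [set x | f x != 0]) -> test_field setT (fun y => f y *: delta_mx 0 j).
Proof.
move=> cf cs; split; last split.
- move=> i; apply: Cinf_smooth.
  rewrite (_ : (fun x => _) = fun x => f x * (@delta_mx R 1 3 0 j 0 i)); last first.
    by apply/funext => x; rewrite mxE.
  by apply: CinfM => //; exact: Cinf_cst.
- apply: (@subclosed_compact _ _ (closure [set x | f x != 0])) => //; first exact: closed_closure.
  apply: closure_subset => x /=; apply: contra => /eqP ->.
  by rewrite scale0r.
- by [].
Qed.

Lemma Hcurl_L2 A u : Hcurl A u -> L2field A (curl A u).
Proof. by move=> [_ h]; have [] := @xgetPex _ (fun=> 0) _ h. Qed.

Lemma sub_subACA (V : zmodType) (a b c d : V) : a - b - (c - d) = a - c - (b - d).
Proof. by rewrite opprD addrACA -opprD. Qed.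

(** Both traces are tested with [f] times a basis vector. Separating the curl terms from the others
    gives an identity for [u - v] without boundary term. *)
Lemma trace_identity A (u v : 'rV[R]_3 -> 'rV[R[i]]_3) (f : 'rV[R]_3 -> R) (j : 'I_3) :
  open A -> bounded_set A -> Hcurl A u -> Hcurl A v -> same_tangential_trace A u v ->
  Cinf f -> compact (closure [set x | f x != 0]) ->
  cint (pt @^-1` A) (fun p => (curl A u (pt p) - curl A v (pt p)) 0 j * (f (pt p))%:C) =
  cint (pt @^-1` A) (fun p => curl_pair (fun x => u x - v x) f j (pt p)).
Proof.
move=> oA bA hu hv tr cf cs.
have mA := open_measurable_pt oA.
have cmR (g : 'rV[R]_3 -> R) : continuous g ->
    cmeasurable (pt @^-1` A) (fun p => (g (pt p))%:C).
  move=> cg; split; first exact: continuous_measurable_pt cg mA.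
  exact: measurable_cst.
have [M HM] := compact_support_bounded (Cinf_continuous cf) cs.
have i1 (z : 'rV[R]_3 -> 'rV[R[i]]_3) : Hcurl A z ->
    cintegrable (pt @^-1` A) (fun p => curl A z (pt p) 0 j * (f (pt p))%:C).
  move=> hz; apply: (@L2field_cintegrable A _ j _ _ M) => //.
  - exact: Hcurl_L2.
  - by apply: cmR; exact: Cinf_continuous.
  - by move=> p _; rewrite n1R.
have i2 (z : 'rV[R]_3 -> 'rV[R[i]]_3) : Hcurl A z ->
    cintegrable (pt @^-1` A) (fun p => curl_pair z f j (pt p)).
  move=> [hz _]; apply: cintegrableB => //.
  - have [M' HM'] := partial_bounded (j + 2) cf cs.
    apply: (@L2field_cintegrable A _ _ _ _ M') => //.
    + by apply: cmR; apply: Cinf_continuous; exact: Cinf_partial.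
    + by move=> p _; rewrite n1R.
  - have [M' HM'] := partial_bounded (j + 1) cf cs.
    apply: (@L2field_cintegrable A _ _ _ _ M') => //.
    + by apply: cmR; apply: Cinf_continuous; exact: Cinf_partial.
    + by move=> p _; rewrite n1R.
have trE (z : 'rV[R]_3 -> 'rV[R[i]]_3) : Hcurl A z ->
    tangential_trace A z (fun y => f y *: delta_mx 0 j) =
    cint (pt @^-1` A) (fun p => curl A z (pt p) 0 j * (f (pt p))%:C) -
    cint (pt @^-1` A) (fun p => curl_pair z f j (pt p)).
  move=> hz; rewrite -cintB//; [|exact: i1|exact: i2].
  rewrite /tangential_trace -[LHS]/(cint _ (fun p => _)).
  by apply: eq_cint => p _; rewrite cdot_delta cdot_scurl_delta.
have := tr _ (delta_test_field j cf cs); rewrite !trE// => H.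
transitivity (cint (pt @^-1` A) (fun p => curl A u (pt p) 0 j * (f (pt p))%:C) -
   cint (pt @^-1` A) (fun p => curl A v (pt p) 0 j * (f (pt p))%:C)).
  rewrite -cintB//; [|exact: i1|exact: i1].
  by apply: eq_cint => p _; rewrite !mxE mulrBl.
transitivity (cint (pt @^-1` A) (fun p => curl_pair u f j (pt p)) -
   cint (pt @^-1` A) (fun p => curl_pair v f j (pt p))).
  have gen (a b c d : R[i]) : a - b = c - d -> a - c = b - d.
    by move=> h; have -> : a = c - d + b; [rewrite -h subrK|ring].
  exact: gen H.
rewrite -cintB//; [|exact: i2|exact: i2].
apply: eq_cint => p _; rewrite /curl_pair !mxE !mulrBl.
exact: sub_subACA.
Qed.

End weak_identity.

Lemma curl_pair_ring (K : comPzRingType) (i e g a b c d a' b' l z c' d' : K) :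
  a + i * c = a' * l - c' * z -> b + i * d = b' * l - d' * z ->
  (e * a - g * b) + i * (e * c - g * d) =
  e * (a' * l) - g * (b' * l) - (c' * (e * z) - d' * (g * z)).
Proof.
move=> h1 h2; transitivity (e * (a + i * c) - g * (b + i * d)); first by ring.
by rewrite h1 h2; ring.
Qed.

(** * The localized wave and the transformed curl identity *)

Section localized_wave.
Context {R : realType}.
Notation mu := (leb3 R).
Variables (x0 : 'rV[R]_3) (r : R) (U V : 'rV[R]_3).
Hypothesis r0 : 0 < r.

Definition lwave (x : 'rV[R]_3) : R[i] := wave U V (x - x0).

Definition zeta (x : 'rV[R]_3) : R[i] := (cutoff x0 r x)%:C * lwave x.

Definition crho (m : 'I_3) : R[i] := U 0 m +i* V 0 m.

Let wRe x := complex.Re (lwave x).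
Let wIm x := complex.Im (lwave x).

Lemma Cinf_lwave_Re : Cinf wRe.
Proof.
rewrite (_ : wRe = fun x => complex.Re (wave U V (- x0)) * complex.Re (wave U V x) +
    (- complex.Im (wave U V (- x0))) * complex.Im (wave U V x)); last first.
  by apply/funext => x; rewrite /wRe /lwave waveD ReM [in RHS]mulNr.
by apply: CinfD; apply: CinfM; [exact: Cinf_cst|exact: Cinf_wave_Re|exact: Cinf_cst|exact: Cinf_wave_Im].
Qed.

Lemma Cinf_lwave_Im : Cinf wIm.
Proof.
rewrite (_ : wIm = fun x => complex.Re (wave U V (- x0)) * complex.Im (wave U V x) +
    complex.Im (wave U V (- x0)) * complex.Re (wave U V x)); last first.
  by apply/funext => x; rewrite /wIm /lwave waveD ImM.
by apply: CinfD; apply: CinfM; [exact: Cinf_cst|exact: Cinf_wave_Im|exact: Cinf_cst|exact: Cinf_wave_Re].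
Qed.

Lemma Re_zeta x : complex.Re (zeta x) = cutoff x0 r x * wRe x.
Proof. by rewrite /zeta ReM /= mul0r subr0. Qed.

Lemma Im_zeta x : complex.Im (zeta x) = cutoff x0 r x * wIm x.
Proof. by rewrite /zeta ImM /= mul0r addr0. Qed.

Lemma Cinf_zeta_Re : Cinf (fun x => complex.Re (zeta x)).
Proof.
under eq_fun do rewrite Re_zeta.
by apply: CinfM; [exact: Cinf_cutoff|exact: Cinf_lwave_Re].
Qed.

Lemma Cinf_zeta_Im : Cinf (fun x => complex.Im (zeta x)).
Proof.
under eq_fun do rewrite Im_zeta.
by apply: CinfM; [exact: Cinf_cutoff|exact: Cinf_lwave_Im].
Qed.

Lemma is_derive_dot (Z x : 'rV[R]_3) (m : 'I_3) :
  is_derive x (delta_mx 0 m) (fun y => dot Z (y - x0)) (Z 0 m).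
Proof.
apply/is_derive_line.
rewrite (_ : (fun t : R => _) = (fun t : R => t * Z 0 m + dot Z (x - x0))); last first.
  apply/funext => t; rewrite -addrA [in LHS]dotDr dotZr; congr (_ * _ + _).
  rewrite /dot (bigD1 m)//= big1 ?addr0 => [|i im]; rewrite !mxE !eqxx ?mulr1//.
  by rewrite (negbTE im) mulr0.
rewrite -[X in is_derive _ _ _ X]addr0; apply: is_deriveD.
rewrite -[X in is_derive _ _ _ X](_ : 0 *: 0 + Z 0 m *: 1 = _); last first.
  by rewrite scaler0 add0r [_ *: 1]mulr1.
exact: is_deriveM.
Qed.

Lemma is_derive_expN (x : 'rV[R]_3) (m : 'I_3) :
  is_derive x (delta_mx 0 m) (fun y => expR (- dot U (y - x0)))
    (- (expR (- dot U (x - x0)) * U 0 m)).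
Proof.
have d3 (t : R) : is_derive t (1 : R) (fun s : R => expR (- s)) (- expR (- t)).
  have := @is_derive1_comp R expR (fun s => - s) t _ (- 1) (is_derive_expR _) (is_deriveN (is_derive_id _ _)).
  by rewrite mulrN1.
have := is_derive_comp1 (d3 _) (is_derive_dot U x m).
by rewrite mulNr.
Qed.

Lemma partial_lwave_Re m x : partial m wRe x = - (U 0 m * wRe x) + V 0 m * wIm x.
Proof.
have H y : is_derive y (delta_mx 0 m) wRe (- (U 0 m * wRe y) + V 0 m * wIm y); last first.
  by rewrite (is_derive_partial H).
have d1 := is_derive_expN y m.
have d2 := is_derive_comp1 (f := fun y => dot V (y - x0)) (is_derive_cos (dot V (y - x0))) (is_derive_dot V y m).
apply: (@is_derive_eq _ _ _ _ _ _ _ _ (is_deriveM d1 d2)).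
have scE (a b : R) : a *: (b : R^o) = a * b by [].
by rewrite !scE /wRe /wIm /lwave /wave /cexp /=; ring.
Qed.

Lemma partial_lwave_Im m x : partial m wIm x = - (U 0 m * wIm x) - V 0 m * wRe x.
Proof.
have H y : is_derive y (delta_mx 0 m) wIm (- (U 0 m * wIm y) - V 0 m * wRe y); last first.
  by rewrite (is_derive_partial H).
have d1 := is_derive_expN y m.
have d2 := is_derive_comp1 (f := fun y => dot V (y - x0)) (is_derive_sin (dot V (y - x0))) (is_derive_dot V y m).
apply: (@is_derive_eq _ _ _ _ _ _ _ _ (is_deriveN (is_deriveM d1 d2))).
have scE (a b : R) : a *: (b : R^o) = a * b by [].
by rewrite !scE /wRe /wIm /lwave /wave /cexp /=; ring.
Qed.

Lemma partialM (f g : 'rV[R]_3 -> R) m x : Cinf f -> Cinf g ->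
  partial m (fun y => f y * g y) x = f x * partial m g x + g x * partial m f x.
Proof.
move=> cf cg.
have H y : is_derive y (delta_mx 0 m) (fun y => f y * g y)
    (f y * partial m g y + g y * partial m f y); last by rewrite (is_derive_partial H).
exact: is_deriveM (Cinf_is_derive m y cf) (Cinf_is_derive m y cg).
Qed.

(** The wave is an eigenfunction of each partial derivative, with eigenvalue [- crho m]; the other
    term comes from the cutoff. *)
Lemma partial_zeta m x :
  partial m (fun y => complex.Re (zeta y)) x +i* partial m (fun y => complex.Im (zeta y)) x =
  (partial m (cutoff x0 r) x)%:C * lwave x - crho m * zeta x.
Proof.
have -> : (fun y => complex.Re (zeta y)) = fun y => cutoff x0 r y * wRe y.
  by apply/funext => y; exact: Re_zeta.
have -> : (fun y => complex.Im (zeta y)) = fun y => cutoff x0 r y * wIm y.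
  by apply/funext => y; exact: Im_zeta.
have cC := Cinf_cutoff x0 r0.
rewrite (partialM _ _ cC Cinf_lwave_Re) (partialM _ _ cC Cinf_lwave_Im).
rewrite partial_lwave_Re partial_lwave_Im.
rewrite /zeta /crho /wRe /wIm.
case: (lwave x) => a b; move: (cutoff _ _ _) (partial _ _ _) => c d.
by apply: complex_eqP; rewrite !ReImE /=; ring.
Qed.

Lemma zeta_eq0 x : 4 * r ^+ 2 <= sqdist x0 x -> zeta x = 0.
Proof. by move=> h; rewrite /zeta cutoff_eq0// mul0r. Qed.

Lemma compact_support_sqdist (f : 'rV[R]_3 -> R) :
  (forall x, 4 * r ^+ 2 <= sqdist x0 x -> f x = 0) -> compact (closure [set x | f x != 0]).
Proof.
move=> f0; have cd : closed [set x | sqdist x0 x <= (2 * r) ^+ 2].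
  apply: (@closed_comp _ _ (sqdist x0) [set t | t <= (2 * r) ^+ 2]); last exact: closed_le.
  by move=> x _; exact: (@Cinf_continuous _ _ (Cinf_sqdist x0) x).
apply: (@subclosed_compact _ _ [set x | sqdist x0 x <= (2 * r) ^+ 2]).
- exact: closed_closure.
- exact: compact_sqdist.
- rewrite [X in _ `<=` X]((closure_id _).1 cd); apply: closure_subset => x /=.
  apply: contra_neqT; rewrite -ltNge => h; apply: f0; apply/ltW.
  by move: h; rewrite exprMn -natrX.
Qed.

Lemma cmeasurable_lwave (D : set (P3 R)) : measurable D ->
  cmeasurable D (fun p => lwave (pt p)).
Proof.
move=> mD; split.
- exact: (continuous_measurable_pt (Cinf_continuous Cinf_lwave_Re) mD).
- exact: (continuous_measurable_pt (Cinf_continuous Cinf_lwave_Im) mD).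
Qed.

Lemma cmeasurable_zeta (D : set (P3 R)) : measurable D ->
  cmeasurable D (fun p => zeta (pt p)).
Proof.
move=> mD; split.
- exact: (continuous_measurable_pt (Cinf_continuous Cinf_zeta_Re) mD).
- exact: (continuous_measurable_pt (Cinf_continuous Cinf_zeta_Im) mD).
Qed.

Lemma n1_lwave x : n1 (lwave x) <= 2 * expR (- dot U (x - x0)).
Proof. exact: n1_cexp. Qed.

Lemma n1_zeta x : n1 (zeta x) <= 2 * expR (- dot U (x - x0)).
Proof.
apply: le_trans (n1M _ _) _; rewrite n1R ger0_norm ?cutoff_ge0//.
by apply: le_trans (n1_lwave x); rewrite ler_piMl ?n1_ge0 ?cutoff_le1.
Qed.

Variables (A : set 'rV[R]_3) (E P : 'rV[R]_3 -> 'rV[R[i]]_3).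
Hypotheses (oA : open A) (bA : bounded_set A).
Hypothesis UA : forall x, A x -> 0 <= dot U (x - x0).
Hypotheses (EL : L2field A E) (PL : L2field A P).
Hypothesis weak : forall f j, Cinf f -> (forall x, 4 * r ^+ 2 <= sqdist x0 x -> f x = 0) ->
  cint (pt @^-1` A) (fun p => P (pt p) 0 j * (f (pt p))%:C) =
  cint (pt @^-1` A) (fun p => curl_pair E f j (pt p)).

Definition hat (E : 'rV[R]_3 -> 'rV[R[i]]_3) m : R[i] :=
  cint (pt @^-1` A) (fun p => E (pt p) 0 m * zeta (pt p)).

(* Commutator of the cutoff with the curl: the integrand vanishes near [x0]. *)
Definition ghat (E : 'rV[R]_3 -> 'rV[R[i]]_3) m l : R[i] :=
  cint (pt @^-1` A) (fun p => E (pt p) 0 m *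
    ((partial l (cutoff x0 r) (pt p))%:C * lwave (pt p))).

Lemma exp_le1 x : A x -> expR (- dot U (x - x0)) <= 1.
Proof. by move=> /UA h; rewrite expR_le1 oppr_le0. Qed.

Lemma hat_integrable F m : L2field A F ->
  cintegrable (pt @^-1` A) (fun p => F (pt p) 0 m * zeta (pt p)).
Proof.
move=> FL; apply: (@L2field_cintegrable _ A _ _ _ _ 2) => //.
- exact: open_measurable_pt.
- by apply: cmeasurable_zeta; exact: open_measurable_pt.
- by move=> p Ap; apply: le_trans (n1_zeta _) _; rewrite ler_piMr// exp_le1.
Qed.

Lemma ghat_integrable F m l : L2field A F ->
  cintegrable (pt @^-1` A) (fun p => F (pt p) 0 m *
    ((partial l (cutoff x0 r) (pt p))%:C * lwave (pt p))).
Proof.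
move=> FL; have [M M0 HM] := partial_cutoff_bounded x0 r0.
have mA := open_measurable_pt oA.
apply: (@L2field_cintegrable _ A _ _ _ _ (M * 2)) => //.
- apply: cmeasurableM; last exact: cmeasurable_lwave.
  split; last exact: measurable_cst.
  apply: (continuous_measurable_pt _ mA); apply: Cinf_continuous; apply: Cinf_partial.
  exact: Cinf_cutoff.
- move=> p Ap; apply: le_trans (n1M _ _) _; rewrite n1R.
  apply: ler_pM => //; first exact: n1_ge0.
  by apply: le_trans (n1_lwave _) _; rewrite ler_piMr// exp_le1.
Qed.

Lemma curl_pair_zeta j x :
  curl_pair E (fun y => complex.Re (zeta y)) j x +
    (0 +i* 1) * curl_pair E (fun y => complex.Im (zeta y)) j x =
  E x 0 (j + 1) * ((partial (j + 2) (cutoff x0 r) x)%:C * lwave x) -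
  E x 0 (j + 2) * ((partial (j + 1) (cutoff x0 r) x)%:C * lwave x) -
  (crho (j + 2) * (E x 0 (j + 1) * zeta x) - crho (j + 1) * (E x 0 (j + 2) * zeta x)).
Proof.
have h m : (partial m (fun y => complex.Re (zeta y)) x)%:C +
    (0 +i* 1) * (partial m (fun y => complex.Im (zeta y)) x)%:C =
    (partial m (cutoff x0 r) x)%:C * lwave x - crho m * zeta x.
  by rewrite -partial_zeta; apply: complex_eqP; rewrite !ReImE /=; ring.
exact: (curl_pair_ring (E x 0 (j + 1)) (E x 0 (j + 2)) (h (j + 2)) (h (j + 1))).
Qed.

(** The components of P^ = rho x E^ + r, with rho = [crho]. Test functions are real, so the two
    parts of [zeta] are tested separately and recombined. *)
Lemma hat_identity j : hat P j =
  ghat E (j + 1) (j + 2) - ghat E (j + 2) (j + 1) -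
  (crho (j + 2) * hat E (j + 1) - crho (j + 1) * hat E (j + 2)).
Proof.
have mA := open_measurable_pt oA.
pose f1 x := complex.Re (zeta x); pose f2 x := complex.Im (zeta x).
have f10 x : 4 * r ^+ 2 <= sqdist x0 x -> f1 x = 0 by move=> h; rewrite /f1 zeta_eq0.
have f20 x : 4 * r ^+ 2 <= sqdist x0 x -> f2 x = 0 by move=> h; rewrite /f2 zeta_eq0.
have w1 := weak j Cinf_zeta_Re f10.
have w2 := weak j Cinf_zeta_Im f20.
pose I : R[i] := 0 +i* 1.
have cI (a b : R) : a%:C + I * b%:C = a +i* b.
  by rewrite /I; apply: complex_eqP; rewrite !ReImE /=; ring.
have iC (F : 'rV[R]_3 -> 'rV[R[i]]_3) m (f : 'rV[R]_3 -> R) : L2field A F -> continuous f ->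
    compact (closure [set x | f x != 0]) ->
    cintegrable (pt @^-1` A) (fun p => F (pt p) 0 m * (f (pt p))%:C).
  move=> FL cf cs; have [M HM] := compact_support_bounded cf cs.
  apply: (@L2field_cintegrable _ A _ _ _ _ M) => //.
  - split; first exact: continuous_measurable_pt cf mA.
    exact: measurable_cst.
  - by move=> p _; rewrite n1R.
have cs1 := compact_support_sqdist f10; have cs2 := compact_support_sqdist f20.
have iCp f l m : Cinf f -> compact (closure [set x | f x != 0]) ->
    cintegrable (pt @^-1` A) (fun p => E (pt p) 0 m * (partial l f (pt p))%:C).
  move=> cf cs; have [M HM] := partial_bounded l cf cs.
  apply: (@L2field_cintegrable _ A _ _ _ _ M) => //.
  - split; last exact: measurable_cst.
    by apply: (continuous_measurable_pt _ mA); apply: Cinf_continuous; exact: Cinf_partial.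
  - by move=> p _; rewrite n1R.
have iP1 := iC P j f1 PL (Cinf_continuous Cinf_zeta_Re) cs1.
have iP2 := iC P j f2 PL (Cinf_continuous Cinf_zeta_Im) cs2.
have iE1 : cintegrable (pt @^-1` A) (fun p => curl_pair E f1 j (pt p)).
  by apply: cintegrableB => //; apply: iCp => //; exact: Cinf_zeta_Re.
have iE2 : cintegrable (pt @^-1` A) (fun p => curl_pair E f2 j (pt p)).
  by apply: cintegrableB => //; apply: iCp => //; exact: Cinf_zeta_Im.
transitivity (cint (pt @^-1` A) (fun p => P (pt p) 0 j * (f1 (pt p))%:C) +
    I * cint (pt @^-1` A) (fun p => P (pt p) 0 j * (f2 (pt p))%:C)).
  rewrite -cintZ// -cintD//; last exact: cintegrableZ.
  apply: eq_cint => p _; rewrite [I * _]mulrCA -mulrDr cI; congr (_ * _).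
rewrite w1 w2 -cintZ// -cintD//; last exact: cintegrableZ.
have h1 := ghat_integrable (j + 1) (j + 2) EL; have h2 := ghat_integrable (j + 2) (j + 1) EL.
have h3 := hat_integrable (j + 1) EL; have h4 := hat_integrable (j + 2) EL.
rewrite /ghat /hat -!cintZ// -!cintB//; try (by exact: cintegrableZ); last 2 first.
- exact: cintegrableB.
- by apply: cintegrableB => //; exact: cintegrableZ.
apply: eq_cint => p _.
exact: curl_pair_zeta.
Qed.

End localized_wave.

(** * Decay estimates *)

Section decay.
Context {R : realType}.
Implicit Types (z w : R -> R[i]) (k m : nat).

(* With [t = sqrt tau] all decay rates are integer powers of [t]. *)
Definition decay k z := exists2 C : R, 0 <= C & forall t, 1 <= t -> t ^+ k * n1 (z t) <= C.

Lemma decayD k z w : decay k z -> decay k w -> decay k (fun t => z t + w t).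
Proof.
move=> [C C0 HC] [D D0 HD]; exists (C + D); first exact: addr_ge0.
move=> t t1; apply: le_trans (lerD (HC t t1) (HD t t1)).
by rewrite -mulrDr ler_wpM2l ?n1D// exprn_ge0// (le_trans ler01).
Qed.

Lemma decayZ k (c : R[i]) z : decay k z -> decay k (fun t => c * z t).
Proof.
move=> [C C0 HC]; exists (n1 c * C); first by rewrite mulr_ge0 ?n1_ge0.
move=> t t1; apply: (@le_trans _ _ (n1 c * (t ^+ k * n1 (z t)))); last first.
  by rewrite ler_wpM2l ?n1_ge0 ?HC.
by rewrite mulrCA ler_wpM2l ?n1M// exprn_ge0// (le_trans ler01).
Qed.

Lemma decayN k z : decay k z -> decay k (fun t => - z t).
Proof. by move=> [C C0 HC]; exists C => // t t1; rewrite n1N HC. Qed.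

Lemma decayB k z w : decay k z -> decay k w -> decay k (fun t => z t - w t).
Proof. by move=> dz dw; apply: decayD => //; exact: decayN. Qed.

Lemma decayW k m z : (m <= k)%N -> decay k z -> decay m z.
Proof.
move=> mk [C C0 HC]; exists C => // t t1; apply: le_trans (HC t t1).
by rewrite ler_wpM2r ?n1_ge0// ler_weXn2l.
Qed.

Lemma decay_div k m z w : (forall t, 1 <= t -> (t ^+ m)%:C * w t = z t) -> decay k z -> decay (k + m) w.
Proof.
move=> zw [C C0 HC]; exists C => // t t1; apply: le_trans (HC t t1).
have t0 : 0 <= t by exact: le_trans t1.
rewrite exprD -mulrA ler_wpM2l ?exprn_ge0// -zw// /n1 !ReImE/= !mul0r subr0 addr0.
by rewrite !normrM -mulrDr (ger0_norm (exprn_ge0 m t0)).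
Qed.

Lemma eq_decay k z w : (forall t, 1 <= t -> w t = z t) -> decay k z -> decay k w.
Proof. by move=> zw [C C0 HC]; exists C => // t t1; rewrite zw ?HC. Qed.

(** Through the modulus, which is multiplicative and satisfies |z| <= [n1 z] <= sqrt(2) |z|. It
    serves to separate rho.F(x0) from the transform of the cone. *)
Lemma n1_mul_le (z w : R[i]) : n1 z * n1 w <= 2 * n1 (z * w).
Proof.
rewrite -(ler_pXn2r (n := 2)) ?nnegrE ?mulr_ge0 ?n1_ge0//.
have sq (x y : R) : x ^+ 2 + y ^+ 2 <= (`|x| + `|y|) ^+ 2 /\
    (`|x| + `|y|) ^+ 2 <= 2 * (x ^+ 2 + y ^+ 2).
  rewrite -(real_normK (num_real x)) -(real_normK (num_real y)).
  move: (normr_ge0 x) (normr_ge0 y); move: (`|x|) (`|y|); clear => a b a0 b0.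
  have := mulr_ge0 a0 b0; have := sqr_ge0 (a - b); rewrite !expr2.
  by split; lra.
rewrite /n1 !ReImE; case: z => a b; case: w => c d /=.
rewrite !exprMn; apply: (@le_trans _ _ ((2 * (a ^+ 2 + b ^+ 2)) * (2 * (c ^+ 2 + d ^+ 2)))).
  by apply: ler_pM; rewrite ?sqr_ge0//; [exact: (sq a b).2|exact: (sq c d).2].
rewrite (_ : _ * _ = 2 ^+ 2 * ((a * c - b * d) ^+ 2 + (a * d + b * c) ^+ 2)); last by ring.
by rewrite ler_wpM2l ?sqr_ge0//; exact: (sq _ _).1.
Qed.

End decay.

(** * Upper bounds for the transforms *)

Section localized_bounds.
Context {R : realType}.
Notation mu := (leb3 R).
Variables (x0 : 'rV[R]_3) (r : R) (u v : 'rV[R]_3) (del : R).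
Hypotheses (r0 : 0 < r) (del0 : 0 < del).
Variables (A : set 'rV[R]_3).
Hypotheses (oA : open A) (bA : bounded_set A).
Hypothesis uA : forall x, A x -> del * S1 (x - x0) <= dot u (x - x0).

Let mA : measurable (pt @^-1` A : set (P3 R)).
Proof. exact: open_measurable_pt. Qed.

Let t2_gt0 (t : R) : 1 <= t -> 0 < t ^+ 2.
Proof. by move=> t1; rewrite exprn_gt0// (lt_le_trans ltr01). Qed.

Lemma lwave_decay (t : R) x : 1 <= t -> del * S1 (x - x0) <= dot u (x - x0) ->
  expR (- dot (t ^+ 2 *: u) (x - x0)) <= expR (- (del * t ^+ 2) * S1 (x - x0)).
Proof.
move=> t1 h; rewrite ler_expR mulNr lerN2 dotZl (mulrC del) -mulrA.
by rewrite ler_wpM2l// ltW// t2_gt0.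
Qed.

Lemma n1_zeta_le (t : R) x : 1 <= t -> A x ->
  n1 (zeta x0 r (t ^+ 2 *: u) (t ^+ 2 *: v) x) <= 2 * expR (- (del * t ^+ 2) * S1 (x - x0)).
Proof.
move=> t1 Ax; apply: le_trans; first exact: n1_zeta.
by rewrite ler_wpM2l// lwave_decay// uA.
Qed.

Lemma dot_scale_ge0 (t : R) x : 1 <= t -> A x -> 0 <= dot (t ^+ 2 *: u) (x - x0).
Proof.
move=> t1 Ax; rewrite dotZl mulr_ge0 ?(ltW (t2_gt0 t1))//.
by apply: le_trans (uA Ax); rewrite mulr_ge0 ?S1_ge0// ltW.
Qed.

Lemma hat_integrable_scaled (t : R) F m : 1 <= t -> L2field A F ->
  cintegrable (pt @^-1` A) (fun p => F (pt p) 0 m * zeta x0 r (t ^+ 2 *: u) (t ^+ 2 *: v) (pt p)).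
Proof.
by move=> t1 FL; apply: hat_integrable => // x Ax; exact: dot_scale_ge0.
Qed.

Lemma zeta_integrable (t : R) : 1 <= t ->
  cintegrable (pt @^-1` A) (fun p => zeta x0 r (t ^+ 2 *: u) (t ^+ 2 *: v) (pt p)).
Proof.
move=> t1; have a0 : 0 < del * t ^+ 2 by rewrite mulr_gt0// t2_gt0.
apply: (@cintegrable_le _ _ _ (fun p => 2 * expR (- (del * t ^+ 2) * S1 (pt p - x0)))) => //.
- exact: cmeasurable_zeta.
- exact: (integrableZl mA 2 (integrable_expS1 x0 a0 mA)).
- by move=> p Ap; exact: n1_zeta_le.
Qed.

(** The Cauchy-Schwarz rate: the exponential has L2 norm of order tau^(-3/2), which is t^(-3). *)
Lemma decay_hat E m : L2field A E ->
  decay 3 (fun t => hat x0 r (t ^+ 2 *: u) (t ^+ 2 *: v) A E m).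
Proof.
move=> EL; have [_ iE] := EL.
pose K := \int[mu]_(p in pt @^-1` A) (cnorm (E (pt p)) ^+ 2).
have K0 : 0 <= K by apply: Rintegral_ge0 => p _; exact: sqr_ge0.
exists (2 * (K + 4 / del ^+ 3)); first by rewrite mulr_ge0// addr_ge0// divr_ge0// exprn_ge0// ltW.
move=> t t1; have t0 : 0 < t by exact: lt_le_trans t1.
have t30 : 0 < t ^+ 3 by rewrite exprn_gt0.
pose a := del * t ^+ 2; have a0 : 0 < a by rewrite mulr_gt0// t2_gt0.
have a20 : 0 < 2 * a by rewrite mulr_gt0.
have i1 := integrableZl mA (t ^+ 3)^-1 iE.
have i2 := integrableZl mA (4 * t ^+ 3) (integrable_expS1 x0 a20 mA).
have ih := integrableD mA i1 i2.
have h := cint_le mA (hat_integrable_scaled m t1 EL) (h := fun p => (t ^+ 3)^-1 * cnorm (E (pt p)) ^+ 2 +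
   (4 * t ^+ 3) * expR (- (2 * a) * S1 (pt p - x0))).
have {}h := h _ _.
apply: (@le_trans _ _ (t ^+ 3 * (2 * ((t ^+ 3)^-1 * K + (4 * t ^+ 3) * (2 / (2 * a)) ^+ 3)))).
  rewrite ler_wpM2l ?(ltW t30)//; apply: le_trans (h _ _) _.
  - exact: eq_integrable ih.
  - apply: aeW => p Ap; apply: le_trans (n1M _ _) _.
    apply: (@le_trans _ _ (n1 (E (pt p) 0 m) * (2 * expR (- a * S1 (pt p - x0))))).
      by rewrite ler_wpM2l ?n1_ge0// n1_zeta_le.
    (* The squared exponential integrates to order t^(-6), so the weight t^(-3) gives both terms the
       order t^(-3). *)
    have := n1_young (E (pt p)) m (k := (t ^+ 3)^-1) (e := 2 * expR (- a * S1 (pt p - x0))).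
    rewrite invr_gt0 t30 mulr_ge0 ?expR_ge0// => /(_ isT isT) /le_trans; apply.
    rewrite invrK exprMn -expRM_natr lerD2l.
    rewrite (_ : - a * _ * 2 = - (2 * a) * S1 (pt p - x0)); last by ring.
    by rewrite mulrA [t ^+ 3 * _]mulrC -natrX.
  - rewrite ler_wpM2l// RintegralD// !RintegralZl//.
    + rewrite lerD2l ler_wpM2l//; first by rewrite mulr_ge0 ?(ltW t30).
      exact: Rintegral_expS1_le.
    + exact: integrable_expS1.
rewrite le_eqVlt; apply/orP; left; apply/eqP; rewrite /a.
by field; rewrite !gt_eqF.
Qed.

(** Where the cutoff has a nonzero derivative, the distance to [x0] is at least [r] and the wave is
    at most a multiple of exp(-del r tau). Every power would do; 7 is wanted later, and ['X^4] in
    tau yields 8. *)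
Lemma decay_ghat E m l : L2field A E ->
  decay 8 (fun t => ghat x0 r (t ^+ 2 *: u) (t ^+ 2 *: v) A E m l).
Proof.
move=> EL; have [_ iE] := EL.
have [M M0 HM] := partial_cutoff_bounded x0 r0.
have dr : 0 < del * r by rewrite mulr_gt0.
have [C C0 HC] := poly_expR_bounded 'X^4 dr.
pose B := 2 * M * C; have B0 : 0 <= B by rewrite !mulr_ge0.
pose K := \int[mu]_(p in pt @^-1` A) (cnorm (E (pt p)) ^+ 2 + B ^+ 2).
have ib : mu.-integrable (pt @^-1` A) (EFin \o cst (B ^+ 2)).
  apply/integrableP; split; first exact/measurable_EFinP.
  by rewrite /= integral_cst//; apply: lte_mul_pinfty => //; exact: leb3_bounded_lty.
have iK : mu.-integrable (pt @^-1` A) (EFin \o (fun p => cnorm (E (pt p)) ^+ 2 + B ^+ 2)).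
  by apply: eq_integrable (integrableD mA iE ib).
exists (2 * K).
  by rewrite mulr_ge0//; apply: Rintegral_ge0 => p _; rewrite addr_ge0// sqr_ge0.
move=> t t1; have t0 : 0 < t by exact: lt_le_trans t1.
have t80 : 0 < t ^+ 8 by rewrite exprn_gt0.
rewrite -ler_pdivlMl// mulrCA -RintegralZl//.
apply: cint_le => //.
- by apply: ghat_integrable => // x Ax; exact: dot_scale_ge0.
- exact: (integrableZl mA _ iK).
- apply: aeW => p Ap; set S := S1 (pt p - x0).
  rewrite ler_pdivlMl// mulrC.
  apply: (@le_trans _ _ (n1 (E (pt p) 0 m) * B)); last first.
    by have := n1_young (E (pt p)) m ltr01 B0; rewrite invr1 !mul1r.
  apply: (@le_trans _ _ (n1 (E (pt p) 0 m) * n1 ((partial l (cutoff x0 r) (pt p))%:C *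
      lwave x0 (t ^+ 2 *: u) (t ^+ 2 *: v) (pt p)) * t ^+ 8)).
    by rewrite ler_wpM2r ?(ltW t80)// n1M.
  rewrite -mulrA ler_wpM2l ?n1_ge0//.
  have [Sr|Sr] := ltP (sqdist x0 (pt p)) (r ^+ 2).
    by rewrite partial_cutoff_in// mul0r n10 mul0r.
  have rS : r <= S.
    apply: le_trans (enorm_le_S1 _); rewrite -(ler_pXn2r (n := 2)) ?nnegrE ?enorm_ge0 ?(ltW r0)//.
    by rewrite enorm_sqr.
  apply: (@le_trans _ _ ((M * (2 * expR (- (del * r * t ^+ 2)))) * t ^+ 8)).
    rewrite ler_wpM2r ?(ltW t80)//; apply: le_trans (n1M _ _) _; rewrite n1R.
    apply: ler_pM => //; first exact: n1_ge0.
    apply: le_trans (n1_lwave _ _ _ _) _; rewrite ler_wpM2l//.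
    apply: le_trans (lwave_decay t1 (uA Ap)) _; rewrite ler_expR mulNr lerN2 mulrAC.
    by rewrite ler_wpM2l// mulr_ge0 ?ltW ?t2_gt0.
  rewrite /B (_ : _ * t ^+ 8 = 2 * M * (t ^+ 8 * expR (- (del * r * t ^+ 2)))); last by ring.
  rewrite ler_wpM2l ?mulr_ge0//.
  have := HC (t ^+ 2) (ltW (t2_gt0 t1)).
  by rewrite hornerXn -exprM ger0_norm// (ltW t80).
Qed.

End localized_bounds.

(** * The leading term and the error of the cutoff *)

Section localized_limits.
Context {R : realType}.
Notation mu := (leb3 R).
Variables (x0 : 'rV[R]_3) (r : R) (u v : 'rV[R]_3) (del : R).
Hypotheses (r0 : 0 < r) (del0 : 0 < del).
Variables (A : set 'rV[R]_3).
Hypotheses (oA : open A) (bA : bounded_set A).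
Hypothesis uA : forall x, A x -> del * S1 (x - x0) <= dot u (x - x0).

Let mA : measurable (pt @^-1` A : set (P3 R)).
Proof. exact: open_measurable_pt. Qed.

Let t2_gt0 (t : R) : 1 <= t -> 0 < t ^+ 2.
Proof. by move=> t1; rewrite exprn_gt0// (lt_le_trans ltr01). Qed.

Local Notation zt t := (zeta x0 r (t ^+ 2 *: u) (t ^+ 2 *: v)).

Lemma mul_expR_le (a s : R) : 0 < a -> 0 <= s ->
  s * expR (- a * s) <= 2 / a * expR (- (a / 2) * s).
Proof.
move=> a0 s0; have -> : - a * s = - (a / 2) * s + - (a / 2 * s) by field.
rewrite expRD mulrCA mulrC ler_wpM2r ?expR_ge0//.
rewrite expRN ler_pdivrMr ?expR_gt0//.
have h := expR_ge1Dx (a / 2 * s).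
have -> : s = 2 / a * (a / 2 * s) by field; rewrite gt_eqF.
have a2 : 0 <= 2 / a by rewrite divr_ge0// ltW.
rewrite ler_wpM2l//.
rewrite (_ : 2 / a * (a / 2 * s) = s); last by field; rewrite gt_eqF.
by apply: le_trans h; rewrite lerDr.
Qed.

(* The first term survives multiplication by [t ^+ 6] uniformly in [eps]; the
   second is a factor [t ^- 2] smaller, whatever [C]. *)
Lemma cint_zeta_le : exists2 K : R, 0 <= K &
  forall (phi : P3 R -> R[i]) (eps C t : R), 1 <= t -> 0 <= eps -> 0 <= C ->
  cintegrable (pt @^-1` A) (fun p => phi p * zt t (pt p)) ->
  {ae mu, forall p, (pt @^-1` A) p -> n1 (phi p) <= eps + C * S1 (pt p - x0)} ->
  t ^+ 6 * n1 (cint (pt @^-1` A) (fun p => phi p * zt t (pt p))) <= K * (eps + C / t ^+ 2).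
Proof.
exists (4 * (8 / del ^+ 3 + 128 / del ^+ 4)).
  by rewrite mulr_ge0// addr_ge0// divr_ge0// exprn_ge0// ltW.
move=> phi eps C t t1 e0 C0 iphi hphi.
have t0 : 0 < t by exact: lt_le_trans t1.
have t60 : 0 < t ^+ 6 by rewrite exprn_gt0.
pose a := del * t ^+ 2; have a0 : 0 < a by rewrite mulr_gt0// t2_gt0.
have a20 : 0 < a / 2 by rewrite divr_gt0.
have i1 := integrableZl mA (2 * eps) (integrable_expS1 x0 a0 mA).
have i2 := integrableZl mA (4 * C / a) (integrable_expS1 x0 a20 mA).
pose h (p : P3 R) := 2 * eps * expR (- a * S1 (pt p - x0)) + 4 * C / a * expR (- (a / 2) * S1 (pt p - x0)).
have ih : mu.-integrable (pt @^-1` A) (EFin \o h) by exact: eq_integrable (integrableD mA i1 i2).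
apply: (@le_trans _ _ (t ^+ 6 * (2 * \int[mu]_(p in pt @^-1` A) h p))).
  rewrite ler_wpM2l ?(ltW t60)//; apply: cint_le => //.
  apply: (@filterS _ _ (ae_filter_ringOfSetsType _) _ _ _ hphi) => p hp Ap; apply: le_trans (n1M _ _) _.
  have n0 : 0 <= 2 * expR (- a * S1 (pt p - x0)) by rewrite mulr_ge0 ?expR_ge0.
  apply: (@le_trans _ _ ((eps + C * S1 (pt p - x0)) * (2 * expR (- a * S1 (pt p - x0))))).
    apply: ler_pM; rewrite ?n1_ge0 ?hp//; exact: (n1_zeta_le _ r0 uA).
  rewrite mulrDl /h mulrCA mulrA lerD2l.
  have := mul_expR_le a0 (S1_ge0 (pt p - x0)).
  move/(ler_wpM2l (mulr_ge0 (ler0n R 2) C0)).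
  by congr (_ <= _); ring.
apply: (@le_trans _ _ (t ^+ 6 * (2 * (2 * eps * (2 / a) ^+ 3 + 4 * C / a * (2 / (a / 2)) ^+ 3)))).
  rewrite ler_wpM2l ?(ltW t60)// ler_wpM2l// RintegralD// !RintegralZl//.
  - apply: lerD; apply: ler_wpM2l; try exact: Rintegral_expS1_le.
      by rewrite mulr_ge0.
    by rewrite divr_ge0 ?mulr_ge0// ltW.
  - exact: integrable_expS1.
  - exact: integrable_expS1.
have d3 : 0 <= 8 / del ^+ 3 by rewrite divr_ge0// exprn_ge0// ltW.
have d4 : 0 <= 128 / del ^+ 4 by rewrite divr_ge0// exprn_ge0// ltW.
have C2 : 0 <= C / t ^+ 2 by rewrite divr_ge0// ltW// t2_gt0.
rewrite (_ : t ^+ 6 * _ = 4 * (8 / del ^+ 3) * eps + 4 * (128 / del ^+ 4) * (C / t ^+ 2)); last first.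
  by rewrite /a; field; rewrite !gt_eqF.
move: d3 d4 C2 e0; move: (8 / _) (128 / _) (C / _) => y z c y0 z0 c0 {}e0.
have := mulr_ge0 y0 c0; have := mulr_ge0 z0 e0.
have -> : 4 * (y + z) * (eps + c) = 4 * y * eps + 4 * z * c + 4 * (y * c + z * eps) by ring.
by move=> h1 h2; rewrite lerDl mulr_ge0// addr_ge0.
Qed.

Variable K : set (P3 R).
Hypotheses (mK : measurable K) (AK : pt @^-1` A `<=` K).
Hypothesis uK : forall p, K p -> del * S1 (pt p - x0) <= dot u (pt p - x0).
Hypothesis KA : forall p, K p -> sqdist x0 (pt p) <= r ^+ 2 -> A (pt p).

(** The integrands coincide within distance [r] of [x0]. Farther out, half of the exponent yields
    the power of [t], and the other half keeps the integral over the unbounded cone finite. *)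
Lemma decay_cutoff_error : decay 8 (fun t =>
  cint K (fun p => lwave x0 (t ^+ 2 *: u) (t ^+ 2 *: v) (pt p)) -
  cint (pt @^-1` A) (fun p => zt t (pt p))).
Proof.
have dr : 0 < del * r / 2 by rewrite divr_gt0// mulr_gt0.
have [C C0 HC] := poly_expR_bounded 'X^4 dr.
exists (2 * (2 * C * (4 / del) ^+ 3)).
  by rewrite !mulr_ge0// ?invr_ge0 ?(ltW del0).
move=> t t1; have t0 : 0 < t by exact: lt_le_trans t1.
have t80 : 0 < t ^+ 8 by rewrite exprn_gt0.
pose a := del * t ^+ 2; have a0 : 0 < a by rewrite mulr_gt0// t2_gt0.
have a20 : 0 < a / 2 by rewrite divr_gt0.
pose zA p := if p \in pt @^-1` A then zt t (pt p) else 0.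
have bl p : K p -> n1 (lwave x0 (t ^+ 2 *: u) (t ^+ 2 *: v) (pt p)) <= 2 * expR (- a * S1 (pt p - x0)).
  move=> Kp; apply: le_trans (n1_lwave _ _ _ _) _.
  by rewrite ler_wpM2l//; apply: lwave_decay => //; exact: uK.
have il : cintegrable K (fun p => lwave x0 (t ^+ 2 *: u) (t ^+ 2 *: v) (pt p)).
  apply: (@cintegrable_le _ _ _ (fun p => 2 * expR (- a * S1 (pt p - x0)))) => //.
  - exact: cmeasurable_lwave.
  - exact: (integrableZl mK 2 (integrable_expS1 x0 a0 mK)).
have mz : cmeasurable setT zA.
  have [m1 m2] := cmeasurable_zeta x0 (t ^+ 2 *: u) (t ^+ 2 *: v) r0 mA.
  split.
  - have := (measurable_restrictT _ mA).1 m1; congr measurable_fun.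
    by apply/funext => p; rewrite /zA /patch; case: ifP.
  - have := (measurable_restrictT _ mA).1 m2; congr measurable_fun.
    by apply/funext => p; rewrite /zA /patch; case: ifP.
have mzK : cmeasurable K zA by case: mz => m1 m2; split; [exact: measurable_funS m1|exact: measurable_funS m2].
have bz p : K p -> n1 (zA p) <= 2 * expR (- a * S1 (pt p - x0)).
  rewrite /zA => Kp; case: ifPn => [/set_mem Ap|_]; first exact: (n1_zeta_le _ r0 uA).
  by rewrite n10 mulr_ge0 ?expR_ge0.
have iz : cintegrable K zA.
  apply: (@cintegrable_le _ _ _ (fun p => 2 * expR (- a * S1 (pt p - x0)))) => //.
  exact: (integrableZl mK 2 (integrable_expS1 x0 a0 mK)).
rewrite (_ : cint (pt @^-1` A) _ = cint K zA); last first.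
  by rewrite -cint_mkcondr (setIidr AK).
rewrite -cintB//.
pose c := 2 * C / t ^+ 8; have c0 : 0 <= c by rewrite divr_ge0 ?mulr_ge0// ltW.
have ie := integrable_expS1 x0 a20 mK.
apply: (@le_trans _ _ (t ^+ 8 * (2 * \int[mu]_(p in K) (c * expR (- (a / 2) * S1 (pt p - x0)))))).
  rewrite ler_wpM2l ?(ltW t80)//; apply: cint_le => //.
  - exact: cintegrableB.
  - exact: (integrableZl mK c ie).
  - apply: aeW => p Kp; set S := S1 (pt p - x0).
    have [Sr|Sr] := leP (sqdist x0 (pt p)) (r ^+ 2).
      rewrite /zA ifT; last by apply/mem_set; exact: KA.
      by rewrite /zeta cutoff_eq1// mul1r subrr n10 mulr_ge0 ?expR_ge0.
    have rS : r <= S.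
      apply: le_trans (enorm_le_S1 _); rewrite -(ler_pXn2r (n := 2)) ?nnegrE ?enorm_ge0 ?(ltW r0)//.
      by rewrite enorm_sqr ltW.
    apply: (@le_trans _ _ (2 * expR (- a * S))).
      rewrite /zA; case: ifPn => [/set_mem Ap|_]; last by rewrite subr0 bl.
      rewrite /zeta -[X in X - _]mul1r -mulrBl; apply: le_trans (n1M _ _) _.
      apply: le_trans (bl _ Kp); rewrite ler_piMl ?n1_ge0//.
      rewrite /n1 !ReImE/= subr0 normr0 addr0 ger0_norm ?subr_ge0 ?cutoff_le1//.
      by rewrite gerBl cutoff_ge0.
    rewrite (_ : - a * S = - (a / 2 * S) + - (a / 2) * S); last by field.
    rewrite expRD mulrA ler_wpM2r ?expR_ge0// (_ : c = 2 * (C / t ^+ 8)); last by rewrite /c mulrA.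
    rewrite ler_wpM2l//.
    rewrite ler_pdivlMr// mulrC.
    have := HC (t ^+ 2) (ltW (t2_gt0 t1)).
    rewrite hornerXn -exprM ger0_norm ?(ltW t80)//; apply: le_trans.
    rewrite ler_wpM2l ?(ltW t80)// ler_expR lerN2 /a.
    rewrite (_ : del * r / 2 * t ^+ 2 = del * t ^+ 2 / 2 * r); last by field.
    by rewrite ler_wpM2l// divr_ge0// mulr_ge0 ?ltW ?t2_gt0.
rewrite RintegralZl//.
apply: (@le_trans _ _ (t ^+ 8 * (2 * (c * (2 / (a / 2)) ^+ 3)))).
  by rewrite ler_wpM2l ?(ltW t80)// ler_wpM2l// ler_wpM2l// Rintegral_expS1_le.
rewrite (_ : t ^+ 8 * _ = 2 * (2 * C * (2 / (a / 2)) ^+ 3)); last first.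
  by rewrite /c; field; rewrite !gt_eqF.
rewrite ler_wpM2l// ler_wpM2l ?mulr_ge0//.
rewrite lerXn2r ?nnegrE ?divr_ge0 ?(ltW a0) ?(ltW del0)//.
rewrite (_ : 2 / (a / 2) = 4 / a); last by field; rewrite gt_eqF.
rewrite ler_wpM2l// lef_pV2 ?posrE// /a ler_peMr ?exprn_ege1 ?(ltW del0) ?del0//.
Qed.

End localized_limits.

(** * Vector algebra with a null vector *)

Section dot3.
Context {R : realType}.

Definition dot3 {K : pzRingType} (a b : 'I_3 -> K) : K := a 0 * b 0 + a 1 * b 1 + a 2 * b 2.

Lemma decay_dot3 k (a : 'I_3 -> R[i]) (z : 'I_3 -> R -> R[i]) :
  (forall j, decay k (z j)) -> decay k (fun t => dot3 a (fun j => z j t)).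
Proof. by move=> dz; apply: decayD; [apply: decayD|]; exact: decayZ. Qed.

Lemma n1_dot3 (a b : 'I_3 -> R[i]) (M : R) : (forall j, n1 (b j) <= M) ->
  n1 (dot3 a b) <= (n1 (a 0) + n1 (a 1) + n1 (a 2)) * M.
Proof.
move=> bM; have h j : n1 (a j * b j) <= n1 (a j) * M.
  by apply: le_trans (n1M _ _) _; rewrite ler_wpM2l ?n1_ge0.
rewrite (mulrDl _ (n1 (a 2))) (mulrDl (n1 (a 0))).
apply: le_trans (n1D _ _) _; apply: lerD => //.
by apply: le_trans (n1D _ _) _; exact: lerD.
Qed.

Variables (K : comPzRingType) (tau : K) (rho : 'I_3 -> K).

Definition cross3 (b : 'I_3 -> K) (j : 'I_3) : K := rho (j + 1) * b (j + 2) - rho (j + 2) * b (j + 1).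

Variables (p q e : 'I_3 -> K).

Lemma dot3_sub_lin (a g h : 'I_3 -> K) (c d : K) : (forall j, p j = c * h j + d * e j) ->
  dot3 a (fun j => g j - p j) = dot3 a g - (c * dot3 a h + d * dot3 a e).
Proof. by move=> ph; rewrite /dot3 !ph; ring. Qed.

(** In vector form, p = q + tau rho x e. *)
Hypothesis pE : forall j, p j = q j - (tau * rho (j + 2) * e (j + 1) - tau * rho (j + 1) * e (j + 2)).

Lemma dot3_rho : dot3 rho p = dot3 rho q.
Proof. by rewrite /dot3 !pE !ord3_shift; ring. Qed.

(** The triple product: b.(rho x e) = -(rho x b).e. *)
Lemma dot3_cross3 (b : 'I_3 -> K) :
  tau * dot3 (cross3 b) e = dot3 b (fun j => q j - p j).
Proof. by rewrite /dot3 /cross3 !pE !ord3_shift; ring. Qed.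

(** (rho x b).(rho x e) = (rho.rho)(b.e) - (rho.b)(rho.e), where nullity removes the first term. *)
Lemma dot3_cross3_cross3 (b : 'I_3 -> K) : dot3 rho rho = 0 -> dot3 rho b = 1 ->
  tau * dot3 rho e = dot3 (cross3 b) (fun j => q j - p j).
Proof.
move=> rr rb; transitivity (tau * (dot3 rho b * dot3 rho e - dot3 rho rho * dot3 b e)).
  by rewrite rr rb mul0r subr0 mul1r.
by rewrite /dot3 /cross3 !pE !ord3_shift; ring.
Qed.

End dot3.

(** [C] may depend on [eps]: first [eps] makes the first term at most [a / 4], then [t] does so for
    the second. *)
Lemma le0_of_decay {R : realType} (a K : R) : 0 <= K ->
  (forall eps, 0 < eps -> exists2 C : R, 0 <= C & forall t, 1 <= t -> a <= K * eps + C / t) -> a <= 0.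
Proof.
move=> K0 H; rewrite leNgt; apply/negP => a0.
have K1 : 0 < 4 * (K + 1) by rewrite mulr_gt0// ltr_wpDl.
have [C C0 HC] := H (a / (4 * (K + 1))) (divr_gt0 a0 K1).
have t1 : 1 <= 1 + 4 * C / a by rewrite lerDl divr_ge0 ?mulr_ge0// ltW.
have t0 := lt_le_trans ltr01 t1.
have := HC _ t1.
have h1 : K * (a / (4 * (K + 1))) <= a / 4.
  rewrite (_ : a / 4 = (K + 1) * (a / (4 * (K + 1)))); last by field; rewrite gt_eqF// ltr_wpDl.
  by rewrite ler_wpM2r ?lerDl// ltW// divr_gt0.
have h2 : C / (1 + 4 * C / a) <= a / 4.
  rewrite ler_pdivrMr// mulrDr mulr1.
  rewrite (_ : a / 4 * (4 * C / a) = C); last by field; rewrite gt_eqF.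
  by rewrite lerDr divr_ge0// ltW.
have h3 : a / 4 + a / 4 < a by lra.
move=> h4; have := le_trans h4 (lerD h1 h2).
by rewrite leNgt h3.
Qed.

(** * Orthogonality of the value at the apex to null vectors *)

Section null_vectors.
Context {R : realType}.
Notation mu := (leb3 R).
Variables (x0 : 'rV[R]_3) (r : R) (u v : 'rV[R]_3) (del : R).
Hypotheses (r0 : 0 < r) (del0 : 0 < del).
Hypotheses (uv0 : dot u v = 0) (uuvv : dot u u = dot v v) (u0 : dot u u != 0).
Variables (A : set 'rV[R]_3).
Hypotheses (oA : open A) (bA : bounded_set A).
Variable K : set (P3 R).
Hypotheses (mK : measurable K) (AK : pt @^-1` A `<=` K).
Hypothesis uK : forall p, K p -> del * S1 (pt p - x0) <= dot u (pt p - x0).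
Hypothesis KA : forall p, K p -> sqdist x0 (pt p) <= r ^+ 2 -> A (pt p).
Hypothesis wave_lb : forall t : R, 1 <= t ->
  1 <= t ^+ 6 * n1 (cint K (fun p => lwave x0 (t ^+ 2 *: u) (t ^+ 2 *: v) (pt p))).

Definition local_curl (E P : 'rV[R]_3 -> 'rV[R[i]]_3) : Prop :=
  forall f j, Cinf f -> (forall x, 4 * r ^+ 2 <= sqdist x0 x -> f x = 0) ->
    cint (pt @^-1` A) (fun p => P (pt p) 0 j * (f (pt p))%:C) =
    cint (pt @^-1` A) (fun p => curl_pair E f j (pt p)).

(** The field c1^-1 P - m0 H is F, close to [F0] near the apex, and c2^-1 Q - e0 E is the bounded
    field G. Abstract constants let one argument treat F and, with the roles exchanged, G. *)
Variables (E H P Q : 'rV[R]_3 -> 'rV[R[i]]_3) (c1 c2 m0 e0 : R[i]) (F0 : 'rV[R[i]]_3).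
Hypotheses (EL : L2field A E) (HL : L2field A H) (PL : L2field A P) (QL : L2field A Q).
Hypotheses (EP : local_curl E P) (HQ : local_curl H Q).
Hypothesis c2n0 : c2 != 0.
Hypothesis hF : forall eps : R, 0 < eps -> exists2 C : R, 0 <= C &
  {ae mu, forall p, (pt @^-1` A) p -> forall j,
    n1 (c1^-1 * P (pt p) 0 j - m0 * H (pt p) 0 j - F0 0 j) <= eps + C * S1 (pt p - x0)}.
Hypothesis hG : exists2 M : R, 0 <= M &
  {ae mu, forall p, (pt @^-1` A) p -> forall j,
    n1 (c2^-1 * Q (pt p) 0 j - e0 * E (pt p) 0 j) <= M}.

Let rho (j : 'I_3) : R[i] := u 0 j +i* v 0 j.
Local Notation ht X t := (hat x0 r (t ^+ 2 *: u) (t ^+ 2 *: v) A X).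
Local Notation gt X t j := (ghat x0 r (t ^+ 2 *: u) (t ^+ 2 *: v) A X (j + 1) (j + 2) -
  ghat x0 r (t ^+ 2 *: u) (t ^+ 2 *: v) A X (j + 2) (j + 1)).
Local Notation zt t := (zeta x0 r (t ^+ 2 *: u) (t ^+ 2 *: v)).

Let mA : measurable (pt @^-1` A : set (P3 R)).
Proof. exact: open_measurable_pt. Qed.

Let uA x : A x -> del * S1 (x - x0) <= dot u (x - x0).
Proof. by rewrite -(tpK x) => Ax; exact: uK (AK Ax). Qed.

Lemma crhoE (t : R) j : crho (t ^+ 2 *: u) (t ^+ 2 *: v) j = (t ^+ 2)%:C * rho j.
Proof. by rewrite /crho /rho !mxE; apply: complex_eqP; rewrite !ReImE /=; ring. Qed.

Lemma hat_scaled X Y t j : L2field A X -> L2field A Y -> local_curl X Y -> 1 <= t ->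
  ht Y t j = gt X t j - ((t ^+ 2)%:C * rho (j + 2) * ht X t (j + 1) -
                         (t ^+ 2)%:C * rho (j + 1) * ht X t (j + 2)).
Proof.
move=> XL YL XY t1; rewrite -!crhoE; apply: hat_identity => // x Ax.
exact: (dot_scale_ge0 del0 uA).
Qed.

(** The real vector u / |u|^2; rho.b = 1 because [v] is orthogonal to [u]. *)
Let b (j : 'I_3) : R[i] := ((dot u u)^-1 * u 0 j)%:C.

Lemma rho_rho : dot3 rho rho = 0.
Proof.
apply: complex_eqP; rewrite /dot3 /rho !ReImE /=.
- by transitivity (dot u u - dot v v); [rewrite !dotE; ring|rewrite uuvv subrr].
- by transitivity (2 * dot u v); [rewrite !dotE; ring|rewrite uv0 mulr0].
Qed.

Lemma rho_b : dot3 rho b = 1.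
Proof.
have h : dot3 rho b = ((dot u u)^-1 * dot u u) +i* ((dot u u)^-1 * dot u v).
  rewrite !dotE /dot3 /rho /b; apply: complex_eqP; rewrite !ReImE /=.
    by rewrite dotE; move: (_^-1) => y; ring.
  by rewrite dotE; move: (_^-1) => y; ring.
by rewrite h uv0 mulr0 mulVf.
Qed.

Lemma hat_lin X Y (c d e : R[i]) t j : 1 <= t -> L2field A X -> L2field A Y ->
  cintegrable (pt @^-1` A) (fun p => (c * X (pt p) 0 j - d * Y (pt p) 0 j - e) * zt t (pt p)) /\
  cint (pt @^-1` A) (fun p => (c * X (pt p) 0 j - d * Y (pt p) 0 j - e) * zt t (pt p)) =
  c * ht X t j - d * ht Y t j - e * cint (pt @^-1` A) (fun p => zt t (pt p)).
Proof.
move=> t1 XL YL.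
have iX0 := hat_integrable_scaled v r0 del0 oA bA uA j t1 XL.
have iY0 := hat_integrable_scaled v r0 del0 oA bA uA j t1 YL.
have iz0 := zeta_integrable v r0 del0 oA uA t1.
have [iX iY] := (cintegrableZ c mA iX0, cintegrableZ d mA iY0).
have iz := cintegrableZ e mA iz0.
have E3 p : (c * X (pt p) 0 j - d * Y (pt p) 0 j - e) * zt t (pt p) =
  c * (X (pt p) 0 j * zt t (pt p)) - d * (Y (pt p) 0 j * zt t (pt p)) - e * zt t (pt p).
  by rewrite !mulrBl !mulrA.
split.
  have := cintegrableB mA (cintegrableB mA iX iY) iz.
  by apply: eq_cintegrable => // p _; rewrite E3.
rewrite /hat -(cintZ c mA iX0) -(cintZ d mA iY0) -(cintZ e mA iz0).
by rewrite -!cintB//; [apply: eq_cint => p _; rewrite E3|exact: cintegrableB].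
Qed.

Lemma decay_hat_curl m : decay 3 (fun t => ht P t m).
Proof. exact: (decay_hat v r0 del0 oA bA uA). Qed.

Lemma decay_commutator X j : L2field A X -> decay 8 (fun t => gt X t j).
Proof. by move=> XL; apply: decayB; exact: (decay_ghat v r0 del0 oA bA uA). Qed.

(** A bounded field has a transform of order tau^(-3) = t^(-6). The estimate is used with the bound
    [M] in the place of [eps] and with slope 0. *)
Lemma decay_contrast j : decay 6 (fun t => c2^-1 * ht Q t j - e0 * ht E t j).
Proof.
have [M M0 HM] := hG; have [C C0 HC] := cint_zeta_le v r0 del0 oA uA.
exists (C * M); first exact: mulr_ge0.
move=> t t1; have [ig eg] := hat_lin c2^-1 e0 0 j t1 QL EL.
have {eg} := eg; rewrite mul0r subr0 => <-.
have := HC _ M 0 t t1 M0 (lexx 0) ig; rewrite mul0r addr0; apply.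
apply: (@filterS _ _ (ae_filter_ringOfSetsType _) _ _ _ HM) => p hp Ap.
by rewrite subr0 mul0r addr0 hp.
Qed.

(* The curl identities determine [(rho x b) . E^] and [rho . H^] from the transforms of
   the curls, with a gain of [t ^- 2] each. *)
Lemma decay_dot_rho : decay 7 (fun t => dot3 rho (ht H t)).
Proof.
have d1 : decay 5 (fun t => dot3 (cross3 rho b) (ht E t)).
  apply: (@decay_div _ 3 2 (fun t => dot3 b (fun j => gt E t j - ht P t j))).
    move=> t t1; apply: dot3_cross3 => j; exact: hat_scaled.
  apply: decay_dot3 => j; apply: decayB; last exact: decay_hat_curl.
  by apply: decayW (decay_commutator j EL).
(* The transform of [E] is the slowest of the three terms: 5, against 6 for the contrast and 8 for
   the commutator. *)
apply: (@decay_div _ 5 2 (fun t => dot3 (cross3 rho b) (fun j => gt H t j - ht Q t j))).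
  move=> t t1; apply: dot3_cross3_cross3 => [j||]; [exact: hat_scaled|exact: rho_rho|exact: rho_b].
apply: (@eq_decay _ _ (fun t => dot3 (cross3 rho b) (fun j => gt H t j) -
   (c2 * dot3 (cross3 rho b) (fun j => c2^-1 * ht Q t j - e0 * ht E t j) +
    c2 * e0 * dot3 (cross3 rho b) (ht E t)))).
  move=> t t1; apply: dot3_sub_lin => j.
  by rewrite mulrBr mulrA divff// mul1r mulrA subrK.
apply: decayB.
  apply: decay_dot3 => j; exact: decayW (decay_commutator j HL).
apply: decayD; last exact: decayZ.
apply: decayZ; apply: decayW (decay_dot3 _ decay_contrast) => //.
Qed.

(** With Y = rho.F0, the product Y L is a term of order t^(-7) minus the transform of rho.(F - F0),
    which is at most a multiple of (eps + C t^(-2)) t^(-6). Since t^6 |L| is bounded below, large t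
    and then small eps leave Y = 0. *)
Lemma null_vector_orthogonality : dot3 rho (fun j => F0 0 j) = 0.
Proof.
pose X t := cint (pt @^-1` A) (fun p => zt t (pt p)).
pose L t := cint K (fun p => lwave x0 (t ^+ 2 *: u) (t ^+ 2 *: v) (pt p)).
pose f t j := c1^-1 * ht P t j - m0 * ht H t j.
pose Y := dot3 rho (fun j => F0 0 j).
have dLX : decay 8 (fun t => L t - X t) by exact: (decay_cutoff_error v r0 del0 oA uA mK AK uK KA).
(* The product with [rho] removes tau rho x E^ from P^ and leaves the commutator. *)
have df : decay 7 (fun t => dot3 rho (f t)).
  apply: (@eq_decay _ _ (fun t => c1^-1 * dot3 rho (fun j => gt E t j) - m0 * dot3 rho (ht H t))).
    move=> t t1; rewrite -(dot3_rho (p := ht P t) (q := fun j => gt E t j) (e := ht E t) (tau := (t ^+ 2)%:C)); last first.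
      by move=> j; exact: hat_scaled.
    by rewrite /dot3 /f; ring.
  apply: decayB; last by apply: decayZ; exact: decay_dot_rho.
  by apply: decayZ; apply: decay_dot3 => j; apply: decayW (decay_commutator j EL).
have dW : decay 7 (fun t => dot3 rho (f t) + Y * (L t - X t)).
  by apply: decayD => //; apply: decayZ; apply: decayW dLX.
apply: n1_eq0; apply/eqP; rewrite eq_le n1_ge0 andbT -/Y.
have [D D0 HD] := cint_zeta_le v r0 del0 oA uA.
pose N := n1 (rho 0) + n1 (rho 1) + n1 (rho 2).
have N0 : 0 <= N by rewrite !addr_ge0// n1_ge0.
apply: (@le0_of_decay _ _ (2 * N * D)); first by rewrite !mulr_ge0.
move=> eps e0'.
have [C C0 HC] := hF e0'; have [W W0 HW] := dW.
exists (2 * W + 2 * N * D * C); first by rewrite addr_ge0// !mulr_ge0.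
move=> t t1; have t0 : 0 < t by exact: lt_le_trans t1.
have t60 : 0 <= t ^+ 6 by rewrite exprn_ge0// ltW.
have YL : Y * L t = (dot3 rho (f t) + Y * (L t - X t)) - dot3 rho (fun j => f t j - F0 0 j * X t).
  by rewrite /Y /dot3; ring.
have h1 : t ^+ 6 * n1 (dot3 rho (f t) + Y * (L t - X t)) <= W / t.
  by rewrite ler_pdivlMr// mulrAC -exprSr HW.
have h2 : t ^+ 6 * n1 (dot3 rho (fun j => f t j - F0 0 j * X t)) <= N * (D * (eps + C / t ^+ 2)).
  rewrite -ler_pdivlMl ?exprn_gt0// mulrCA; apply: n1_dot3 => j.
  rewrite ler_pdivlMl ?exprn_gt0//.
  have [ig eg] := hat_lin c1^-1 m0 (F0 0 j) j t1 PL HL.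
  rewrite /f /X -eg; apply: HD => //; first exact: ltW.
  by apply: (@filterS _ _ (ae_filter_ringOfSetsType _) _ _ _ HC) => p hp Ap; exact: hp.
have h3 : n1 Y <= 2 * (t ^+ 6 * n1 (Y * L t)).
  apply: (@le_trans _ _ (n1 Y * (t ^+ 6 * n1 (L t)))).
    by rewrite ler_peMr ?n1_ge0// wave_lb.
  by rewrite mulrCA [leRHS]mulrCA ler_wpM2l// n1_mul_le.
have h4 : t ^+ 6 * n1 (Y * L t) <= W / t + N * (D * (eps + C / t ^+ 2)).
  rewrite YL; apply: le_trans (lerD h1 h2); rewrite -mulrDr ler_wpM2l//.
  exact: n1B.
have h5 : C / t ^+ 2 <= C / t.
  by rewrite ler_wpM2l// lef_pV2 ?posrE ?exprn_gt0// ler_eXnr.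
apply: (le_trans h3); apply: (@le_trans _ _ (2 * (W / t + N * (D * (eps + C / t))))).
  rewrite ler_wpM2l//; apply: le_trans h4 _.
  by rewrite lerD2l !ler_wpM2l// lerD2l.
by rewrite le_eqVlt; apply/orP; left; apply/eqP; ring.
Qed.

End null_vectors.

(** * Vanishing at the corner *)

Section quadratic.
Context {R : realType}.

(** A polynomial of degree 2 in [s], with coefficients [x - z], [2 * y] and [- (x + z)], that
    vanishes at [h], [h / 2] and [h / 4]. *)
Lemma quadratic_eq0 (h x y z : R) : 0 < h ->
  (forall s, 0 < s <= h -> (1 - s ^+ 2) * x + 2 * s * y - (1 + s ^+ 2) * z = 0) ->
  [/\ x = 0, y = 0 & z = 0].
Proof.
move=> h0 H.
have e1 := H h; have e2 := H (h / 2); have e3 := H (h / 4).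
have {}e1 : (1 - h ^+ 2) * x + 2 * h * y - (1 + h ^+ 2) * z = 0.
  by apply: e1; rewrite h0 lexx.
have {}e2 : (1 - (h / 2) ^+ 2) * x + 2 * (h / 2) * y - (1 + (h / 2) ^+ 2) * z = 0.
  by apply: e2; apply/andP; split; lra.
have {}e3 : (1 - (h / 4) ^+ 2) * x + 2 * (h / 4) * y - (1 + (h / 4) ^+ 2) * z = 0.
  by apply: e3; apply/andP; split; lra.
have hxz : h ^+ 2 * (x + z) = 0.
  move: e1 e2 e3; rewrite !expr2 => e1 e2 e3.
  by lra.
have hy : h * y = 0 by move: e1 e2 e3; rewrite !expr2 => e1 e2 e3; lra.
have xz : x - z = 0 by move: e1 e2 e3; rewrite !expr2 => e1 e2 e3; lra.
have y0 : y = 0 by move/eqP: hy; rewrite mulf_eq0 gt_eqF//= => /eqP.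
have xz' : x + z = 0 by move/eqP: hxz; rewrite mulf_eq0 expf_eq0/= gt_eqF//= => /eqP.
by split => //; lra.
Qed.

Lemma dot_frame_eq0 (a d x : 'rV[R]_3) : dot a a = 1 -> dot d d = 1 -> dot d a = 0 ->
  dot a x = 0 -> dot d x = 0 -> dot (cross a d) x = 0 -> x = 0.
Proof.
move=> aa dd da ax dx ex.
by rewrite (orthonormal_decomp x aa dd da) ax dx ex !scale0r !addr0.
Qed.

(** One extremal ray suffices. The real and imaginary parts of rho.F0 are quadratic in [s], and
    their coefficients determine all six coordinates of the two parts of [F0] in the frame a, d, a x
    d. *)
Lemma null_vectors_span (a d : 'rV[R]_3) (F0 : 'rV[R[i]]_3) (h : R) : 0 < h ->
  dot a a = 1 -> dot d d = 1 -> dot d a = 0 ->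
  (forall s, 0 < s <= h ->
     let u := (1 - s ^+ 2) *: d + (2 * s) *: a in
     let v := (1 + s ^+ 2) *: cross a d in
     dot3 (fun j => u 0 j +i* v 0 j) (fun j => F0 0 j) = 0) ->
  F0 = 0.
Proof.
move=> h0 aa dd da H.
pose A : 'rV[R]_3 := \row_j complex.Re (F0 0 j).
pose B : 'rV[R]_3 := \row_j complex.Im (F0 0 j).
have split_dot (u v : 'rV[R]_3) : dot3 (fun j => u 0 j +i* v 0 j) (fun j => F0 0 j) =
    (dot u A - dot v B) +i* (dot u B + dot v A).
  rewrite /dot3 !dotE /A /B !mxE; move: (F0 0 0) (F0 0 1) (F0 0 2) => z0 z1 z2.
  by apply: complex_eqP; rewrite !ReImE /=; ring.
have [d1 a1 e1] : [/\ dot d A = 0, dot a A = 0 & dot (cross a d) B = 0].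
  apply: (quadratic_eq0 h0) => s hs; have := H s hs.
  by rewrite /= split_dot => -[h1 _]; move: h1; rewrite !dotDl !dotZl.
have [d2 a2 e2] : [/\ dot d B = 0, dot a B = 0 & - dot (cross a d) A = 0].
  apply: (quadratic_eq0 h0) => s hs; have := H s hs.
  rewrite /= split_dot => -[_ h1]; move: h1; rewrite !dotDl !dotZl.
  by rewrite mulrN opprK.
move/eqP: e2; rewrite oppr_eq0 => /eqP e2.
have A0 := dot_frame_eq0 aa dd da a1 d1 e2.
have B0 := dot_frame_eq0 aa dd da a2 d2 e1.
apply/rowP => j; rewrite mxE; apply: complex_eqP.
  by have /rowP/(_ j) := A0; rewrite !mxE.
by have /rowP/(_ j) := B0; rewrite !mxE.
Qed.

End quadratic.

(** * Openness of the cone *)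

Section cones.
Context {R : realType}.
Implicit Types (x y : 'rV[R]_3).

Lemma open_eball x0 (r : R) : 0 < r -> open (eball x0 r : set 'rV[R]_3).
Proof.
move=> r0; rewrite (_ : eball x0 r = [set x | sqdist x0 x < r ^+ 2]).
  apply: (@open_comp _ _ (sqdist x0) [set t | t < r ^+ 2]); last exact: open_lt.
  by move=> x _; exact: (@Cinf_continuous _ _ (Cinf_sqdist x0) x).
apply/seteqP; split => x; rewrite /eball /= /sqdist -enorm_sqr.
  by rewrite ltr_pXn2r// ?nnegrE ?enorm_ge0// ltW.
by rewrite ltr_pXn2r// ?nnegrE ?enorm_ge0// ltW.
Qed.

Variables (n : nat) (w : 'I_n -> 'rV[R]_3).

Lemma cone_shift x0 x : cone w x0 (x0 + x) <-> cone w 0 x.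
Proof.
split=> -[c c0 e]; exists c => //.
  by rewrite add0r; exact: (addrI _ e).
by rewrite e add0r.
Qed.

Lemma coneZ x (c : R) : 0 < c -> cone w 0 x -> cone w 0 (c *: x).
Proof.
move=> c0 [b b0 ->]; exists (fun j => c * b j) => [j|]; first exact: mulr_gt0.
by rewrite !add0r scaler_sumr; apply: eq_bigr => j _; rewrite scalerA.
Qed.

Lemma affine_continuous (a b : 'rV[R]_3) (c : R) : continuous (fun y : 'rV[R]_3 => b + c *: (y - a)).
Proof.
move=> y; have ny := @nbhs_filter 'rV[R]_3 y.
have h := @cvgB _ _ _ _ ny _ _ _ _ (@cvg_id 'rV[R]_3 (nbhs y)) (@cst_continuous 'rV[R]_3 'rV[R]_3 a y).
exact: (@cvgD _ _ _ _ ny _ _ _ _ (@cst_continuous 'rV[R]_3 'rV[R]_3 b y) (@cvgZl_tmp _ _ _ _ ny c _ _ h)).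
Qed.

(** Openness is given for the truncated cone, which inherits it from the domain. A suitable scaling
    carries any point of the cone into it. *)
Lemma open_cone_apex0 x0 (r : R) : 0 < r -> open (tcone w x0 r) -> open (cone w 0).
Proof.
move=> r0 oA; rewrite openE => x cx.
have [c c0 hc] : exists2 c : R, 0 < c & enorm (c *: x) < r.
  have e1 : 0 < enorm x + 1 by rewrite ltr_wpDl// enorm_ge0.
  have c0 : 0 < r / (enorm x + 1) by rewrite divr_gt0.
  exists (r / (enorm x + 1)) => //.
  have -> : enorm (r / (enorm x + 1) *: x) = r / (enorm x + 1) * enorm x.
    rewrite /enorm dotZl dotZr mulrA -expr2 sqrtrM ?sqr_ge0//.
    by rewrite sqrtr_sqr ger0_norm// ltW.
  by rewrite mulrAC ltr_pdivrMr// ltr_pM2l// ltrDl.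
have : open ((fun y : 'rV[R]_3 => x0 + c *: (y - 0)) @^-1` tcone w x0 r).
  by apply: (@open_comp _ _ (fun y : 'rV[R]_3 => x0 + c *: (y - 0))) => // y _; exact: affine_continuous.
rewrite openE => /(_ x) H; have : (x0 + c *: (x - 0)) \in tcone w x0 r.
  apply/mem_set; rewrite subr0; split; first by apply/cone_shift; exact: coneZ.
  by rewrite /eball /= addrC addKr.
move=> /set_mem /H; rewrite /interior; apply: filterS => y /= [+ _].
rewrite subr0 => /cone_shift /(coneZ (c := c^-1)); rewrite invr_gt0 => /(_ c0).
by rewrite scalerA mulVf ?scale1r// gt_eqF.
Qed.

Lemma open_cone x0 : open (cone w 0) -> open (cone w x0).
Proof.
move=> oK.
have -> : cone w x0 = (fun y : 'rV[R]_3 => 0 + 1 *: (y - x0)) @^-1` cone w 0.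
  apply/seteqP; split => y /=.
    by rewrite add0r scale1r => cy; apply/(cone_shift x0); rewrite addrC subrK.
  by rewrite add0r scale1r => /(cone_shift x0); rewrite addrC subrK.
by apply: open_comp => // y _; exact: affine_continuous.
Qed.

End cones.

Section corner_vanishing.
Context {R : realType}.
Notation mu := (leb3 R).
Variables (n : nat) (w : 'I_n -> 'rV[R]_3) (x0 : 'rV[R]_3) (r0 r : R).
Notation A := (tcone w x0 r0).
Hypotheses (pw : polyhedral_cone w x0) (rgt0 : 0 < r) (rr0 : 2 * r < r0).
Hypotheses (oA : open A) (bA : bounded_set A).
Variables (E H P Q : 'rV[R]_3 -> 'rV[R[i]]_3) (c1 c2 m0 e0 : R[i]) (F0 : 'rV[R[i]]_3).
Hypotheses (EL : L2field A E) (HL : L2field A H) (PL : L2field A P) (QL : L2field A Q).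
Hypotheses (EP : local_curl x0 r A E P) (HQ : local_curl x0 r A H Q).
Hypothesis c2n0 : c2 != 0.
Hypothesis hF : forall eps : R, 0 < eps -> exists2 C : R, 0 <= C &
  {ae mu, forall p, (pt @^-1` A) p -> forall j,
    n1 (c1^-1 * P (pt p) 0 j - m0 * H (pt p) 0 j - F0 0 j) <= eps + C * S1 (pt p - x0)}.
Hypothesis hG : exists2 M : R, 0 <= M &
  {ae mu, forall p, (pt @^-1` A) p -> forall j,
    n1 (c2^-1 * Q (pt p) 0 j - e0 * E (pt p) 0 j) <= M}.

Lemma corner_vanishing : F0 = 0.
Proof.
have r00 : 0 < r0 by apply: lt_trans rr0; rewrite mulr_gt0.
have oK0 := open_cone_apex0 r00 oA.
have mK0 := open_measurable_pt oK0.
have mK := open_measurable_pt (open_cone (x0 := x0) oK0).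
have [j0 [k [l [d [al [be [ga frame]]]]]]] := cone_frame_exists pw.
have aa := cf_a frame; have dd := cf_d frame; have da := cf_da frame.
have [s1 s10 Hs] := cone_lower_bound frame mK0.
apply: (@null_vectors_span _ (w j0) d F0 (s1 / 2)) => //; first by rewrite divr_gt0.
move=> s /andP[s0 s1'] u v.
have ss1 : 0 < s < s1 by rewrite s0/= (le_lt_trans s1')//; lra.
have [[del del0 Hdel] Hlb] := Hs s ss1.
have cs p : cone w x0 (pt p) -> cone w 0 (pt p - x0).
  by move=> h; apply/(cone_shift w x0); rewrite addrC subrK.
(* (1 - s^2)^2 + (2 s)^2 = (1 + s^2)^2, so u and v have equal length, and rho = u + i v is null. *)
have uE : dot u u = (1 + s ^+ 2) ^+ 2.
  by rewrite /u !dotDl !dotDr !dotZl !dotZr (dotC (w j0) d) aa dd da; ring.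
have vE : dot v v = (1 + s ^+ 2) ^+ 2.
  rewrite /v dotZl dotZr dot_cross aa dd (dotC (w j0) d) da; ring.
have uv : dot u v = 0.
  rewrite /u /v dotDl !dotZl !dotZr (dotC d) (dotC (w j0)) dot_crossl dot_crossr; ring.
have u0 : dot u u != 0.
  by rewrite uE gt_eqF// exprn_gt0// ltr_wpDr// sqr_ge0.
have AK : pt @^-1` A `<=` (pt @^-1` cone w x0 : set (P3 R)) by move=> p [].
have uK p : (pt @^-1` cone w x0) p -> del * S1 (pt p - x0) <= dot u (pt p - x0).
  by move=> /cs; exact: Hdel.
have KA p : (pt @^-1` cone w x0) p -> sqdist x0 (pt p) <= r ^+ 2 -> A (pt p).
  move=> Kp h; split => //; rewrite /eball /=.
  have : enorm (pt p - x0) <= r.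
    by rewrite -(ler_pXn2r (n := 2)) ?nnegrE ?enorm_ge0 ?(ltW rgt0)// enorm_sqr.
  by move/le_lt_trans; apply; apply: le_lt_trans rr0; rewrite ler_peMl ?ler1n// ltW.
apply: (null_vector_orthogonality rgt0 del0 uv _ u0 oA bA mK AK uK KA _ EL HL PL QL EP HQ c2n0 hF hG).
  by rewrite uE vE.
move=> t t1; have t0 : 0 < t ^+ 2 by rewrite exprn_gt0// (lt_le_trans ltr01).
have := Hlb _ t0; rewrite -exprM => /le_trans; apply.
set z := cint _ _; set z' := cint _ _.
have <- : z' = z => //.
have preK : shift3 x0 @^-1` (pt @^-1` cone w x0) = (pt @^-1` cone w 0 : set (P3 R)).
  apply/seteqP; split => p /=; rewrite pt_shift3 addrC.
    by move/cone_shift.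
  by move=> h; apply/cone_shift.
rewrite /z' (cint_shift (y := x0))// ?preK.
- by apply: eq_cint => p _ /=; rewrite /lwave pt_shift3 addrK.
- exact: cmeasurable_lwave.
- apply: (eq_cintegrable (f := fun p => wave (t ^+ 2 *: u) (t ^+ 2 *: v) (pt p))) => //.
    by move=> p _ /=; rewrite /lwave pt_shift3 addrK.
  apply: (@cintegrable_wave _ _ _ _ (del * t ^+ 2)) => //; first exact: mulr_gt0.
  move=> p Kp; rewrite dotZl (mulrC del) -mulrA ler_wpM2l ?(ltW t0)//.
  exact: Hdel.
Qed.

End corner_vanishing.

(** * Restriction of the fields to the corner *)

Section L2_fields.
Context {R : realType}.
Notation mu := (leb3 R).
Implicit Types (A B : set 'rV[R]_3) (u v : 'rV[R]_3 -> 'rV[R[i]]_3).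

Lemma cnorm_sqr (z : 'rV[R[i]]_3) :
  cnorm z ^+ 2 = \sum_i (complex.Re (z 0 i) ^+ 2 + complex.Im (z 0 i) ^+ 2).
Proof. by rewrite /cnorm sqr_sqrtr// sumr_ge0// => i _; rewrite addr_ge0// sqr_ge0. Qed.

Lemma n1_le_cnorm (z : 'rV[R[i]]_3) j : n1 (z 0 j) <= 2 * cnorm z.
Proof.
have h := n1_coord_sqr z j; have c0 : 0 <= cnorm z by exact: sqrtr_ge0.
rewrite mulr2n mulrDl mul1r /n1 lerD// -(ler_pXn2r (n := 2)) ?nnegrE// real_normK ?num_real//;
  by apply: le_trans h; rewrite ?lerDl ?lerDr sqr_ge0.
Qed.

Lemma L2fieldS A B u : open A -> open B -> B `<=` A -> L2field A u -> L2field B u.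
Proof.
move=> oA oB BA [mu_ iu]; have [mA mB] := (open_measurable_pt oA, open_measurable_pt oB).
have sub : pt @^-1` B `<=` (pt @^-1` A : set (P3 R)) by move=> p; exact: BA.
split; last exact: integrableS iu.
by move=> j; have [h1 h2] := mu_ j; split; [exact: measurable_funS h1|exact: measurable_funS h2].
Qed.

Lemma L2fieldB A u v : open A -> L2field A u -> L2field A v -> L2field A (fun x => u x - v x).
Proof.
move=> oA [mu_ iu] [mv iv]; have mA := open_measurable_pt oA.
have mD j : measurable_in A (fun x => complex.Re ((u x - v x) 0 j)) /\
    measurable_in A (fun x => complex.Im ((u x - v x) 0 j)).
  have [u1 u2] := mu_ j; have [v1 v2] := mv j; split.
    have := measurable_funB u1 v1; congr measurable_fun.
    by apply/funext => p /=; rewrite !mxE !ReImE.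
  have := measurable_funB u2 v2; congr measurable_fun.
  by apply/funext => p /=; rewrite !mxE !ReImE.
split => //.
have iuv := integrableD mA (integrableD mA iu iu) (integrableD mA iv iv).
apply: (le_integrable mA _ _ iuv).
  apply/measurable_EFinP; under eq_fun do rewrite cnorm_sqr.
  apply: measurable_sum => j; have [h1 h2] := mD j.
  by apply: measurable_funD; exact: measurable_funX.
move=> p _ /=; rewrite lee_fin !ger0_norm ?addr_ge0 ?sqr_ge0//.
rewrite !cnorm_sqr -!big_split/=; apply: ler_sum => j _.
rewrite !mxE !ReImE; move: (u _ 0 j) (v _ 0 j) => [a b] [c d] /=.
have := sqr_ge0 (a + c); have := sqr_ge0 (b + d); rewrite !expr2; lra.
Qed.

(** The test function vanishes at distance [2 * r] and beyond, hence near every point outside the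
    ball of radius [r0]. There [f] and its derivatives are 0, and the identity on the domain reduces
    to the corner. *)
Lemma local_curl_difference (Om : set 'rV[R]_3) u v x0 (r r0 : R) :
  open Om -> bounded_set Om -> Hcurl Om u -> Hcurl Om v -> same_tangential_trace Om u v ->
  0 < r -> 2 * r < r0 ->
  local_curl x0 r (Om `&` eball x0 r0) (fun x => u x - v x) (fun x => curl Om u x - curl Om v x).
Proof.
move=> oO bO hu hv tr rgt0 rr0 f j cf f0.
have far x : ~ eball x0 r0 x -> 4 * r ^+ 2 < sqdist x0 x.
  rewrite /eball /= => /negP; rewrite -leNgt => h.
  rewrite /sqdist -enorm_sqr (_ : 4 * r ^+ 2 = (2 * r) ^+ 2); last by rewrite exprMn -natrX.
  rewrite ltr_pXn2r ?nnegrE ?enorm_ge0 ?mulr_ge0 ?(ltW rgt0)//.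
  exact: lt_le_trans rr0 h.
have pf x i : ~ eball x0 r0 x -> partial i f x = 0.
  move=> /far h; apply: (@partial_near_cst _ _ _ _ 0).
  have : \forall y \near x, 4 * r ^+ 2 < sqdist x0 y.
    exact: (@Cinf_continuous _ _ (Cinf_sqdist x0) x _ (lt_nbhsr h)).
  by apply: filterS => y /ltW; exact: f0.
rewrite preimage_setI !cint_mkcondr.
have := trace_identity j oO bO hu hv tr cf (compact_support_sqdist f0).
congr (_ = _); apply: eq_cint => p _; case: ifPn => // /negP np.
  by rewrite f0 ?mulr0// ltW// far// => /mem_set.
by rewrite /curl_pair !pf ?mulr0 ?subr0// => /mem_set.
Qed.

End L2_fields.

(** * Hoelder continuity at the apex *)

Section holder_bound.
Context {R : realType}.

(** Below a threshold [y] the left side is at most [eps]; between [y] and [d] it is at most a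
    constant, hence at most a multiple of [s]. In this form the transform estimates involve integer
    powers only. *)
Lemma powR_le_affine (K alpha d eps : R) : 0 <= K -> 0 < alpha -> 0 < eps ->
  exists2 C : R, 0 <= C & forall s, 0 <= s <= d -> K * s `^ alpha <= eps + C * s.
Proof.
move=> K0 a0 e0; pose y := (eps / (K + 1)) `^ alpha^-1.
have K1 : 0 < K + 1 by rewrite ltr_wpDl.
have ek : 0 < eps / (K + 1) by rewrite divr_gt0.
have y0 : 0 < y by exact: powR_gt0.
have ya : y `^ alpha = eps / (K + 1) by rewrite /y -powRrM mulVf ?gt_eqF// powRr1// ltW.
exists (K * d `^ alpha / y); first by rewrite divr_ge0 ?mulr_ge0 ?powR_ge0// ltW.
move=> s /andP[s0 sd]; have [sy|sy] := leP s y.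
  apply: (@le_trans _ _ (K * y `^ alpha)).
    by rewrite ler_wpM2l// ge0_ler_powR ?nnegrE// ltW.
  rewrite ya mulrCA; apply: (@le_trans _ _ eps).
    by rewrite ler_piMr ?(ltW e0)// ler_pdivrMr// mul1r lerDl.
  by rewrite lerDl !mulr_ge0 ?powR_ge0// invr_ge0 ltW.
apply: (@le_trans _ _ (K * d `^ alpha)).
  by rewrite ler_wpM2l// ge0_ler_powR ?nnegrE ?(le_trans s0 sd) ?(ltW a0).
apply: (@le_trans _ _ (K * d `^ alpha / y * s)); last by rewrite lerDr ltW.
by rewrite -mulrA ler_peMr ?mulr_ge0 ?powR_ge0// mulrC ler_pdivlMr// mul1r ltW.
Qed.

Lemma holder_apex_bound (A : set 'rV[R]_3) (F : 'rV[R]_3 -> 'rV[R[i]]_3) x0 (r0 alpha eps : R) :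
  0 < alpha -> A `<=` eball x0 r0 -> closure A x0 -> holder alpha (closure A) F -> 0 < eps ->
  exists2 C : R, 0 <= C &
    forall x, A x -> forall j, n1 (F x 0 j - F x0 0 j) <= eps + C * S1 (x - x0).
Proof.
move=> a0 AB cx0 [K HK] e0.
have [C C0 HC] := powR_le_affine r0 (mulr_ge0 (ler0n R 2) (normr_ge0 K)) a0 e0.
exists C => // x Ax j; have := n1_le_cnorm (F x - F x0) j; rewrite !mxE => /le_trans; apply.
apply: (@le_trans _ _ (2 * `|K| * enorm (x - x0) `^ alpha)).
  rewrite -mulrA ler_wpM2l//; apply: le_trans (HK x x0 _ cx0) _; first exact: subset_closure.
  by rewrite ler_wpM2r ?powR_ge0 ?ler_norm.
apply: le_trans (HC _ _) _; first by rewrite enorm_ge0/= ltW//; exact: AB.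
by rewrite lerD2l ler_wpM2l// enorm_le_S1.
Qed.

End holder_bound.

Lemma transmission_corner {R : realType} n (w : 'I_n -> 'rV[R]_3) (x0 : 'rV[R]_3) (r0 r alpha : R)
    (E H P Q F G : 'rV[R]_3 -> 'rV[R[i]]_3) (c1 c2 m0 e0 : R[i]) :
  let A := tcone w x0 r0 in
  polyhedral_cone w x0 -> 0 < r -> 2 * r < r0 -> open A -> bounded_set A -> closure A x0 ->
  L2field A E -> L2field A H -> L2field A P -> L2field A Q ->
  local_curl x0 r A E P -> local_curl x0 r A H Q -> c2 != 0 -> 0 < alpha ->
  holder alpha (closure A) F -> holder alpha (closure A) G ->
  ae_in A (fun x => forall j, c1^-1 * P x 0 j - m0 * H x 0 j = F x 0 j) ->
  ae_in A (fun x => forall j, c2^-1 * Q x 0 j - e0 * E x 0 j = G x 0 j) ->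
  F x0 = 0.
Proof.
move=> A pw rgt0 rr0 oA bA cx0 EL HL PL QL EP HQ c2n0 a0 hF hG PF QG.
have Ab : A `<=` eball x0 r0 by move=> x [].
apply: (corner_vanishing (c1 := c1) (m0 := m0) (e0 := e0) pw rgt0 rr0 oA bA EL HL PL QL EP HQ c2n0).
  move=> eps eps0; have [C C0 HC] := holder_apex_bound a0 Ab cx0 hF eps0.
  exists C => //; apply: (@filterS _ _ (ae_filter_ringOfSetsType _) _ _ _ PF) => p pF Ap j.
  by rewrite pF// HC.
have [C C0 HC] := holder_apex_bound a0 Ab cx0 hG (ltr01 : 0 < 1 :> R).
have N0 j : 0 <= n1 (G x0 0 j) by exact: n1_ge0.
have r00 : 0 <= r0 by rewrite ltW// (lt_trans _ rr0)// mulr_gt0.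
exists (1 + C * (2 * r0) + (n1 (G x0 0 0) + n1 (G x0 0 1) + n1 (G x0 0 2))).
  by rewrite !addr_ge0// !mulr_ge0.
apply: (@filterS _ _ (ae_filter_ringOfSetsType _) _ _ _ QG) => p qG Ap j; rewrite qG//.
rewrite -[G (pt p) 0 j](subrK (G x0 0 j)); apply: le_trans (n1D _ _) _; apply: lerD.
  apply: le_trans (HC _ Ap j) _; rewrite lerD2l ler_wpM2l//.
  by apply: le_trans (S1_le_enorm _) _; rewrite ler_wpM2l// ltW//; exact: Ab.
move: j; apply: ord3P; have := N0 0; have := N0 1; have := N0 2.
- by move=> h2 h1 _; rewrite -addrA lerDl addr_ge0.
- by move=> h2 _ h0; rewrite -addrA addrCA lerDl addr_ge0.
- by move=> _ h1 h0; rewrite lerDr addr_ge0.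
Qed.

(** With the curls replaced by Maxwell's equations, the background field [h0] cancels and the
    contrast times the full field remains. *)
Lemma maxwell_difference (K : fieldType) (c m m0 h h0 : K) : c != 0 ->
  c^-1 * (c * m * h - c * m0 * h0) - m0 * (h - h0) = (m - m0) * h.
Proof. by move=> c0; field. Qed.
Theorem theorem4p1 (R : realType) (Om : set 'rV[R]_3)
    (eps0 mu0 : R) (eps mu sigma : 'rV[R]_3 -> R) (omega : R)
    (Et Ht E0 H0 : 'rV[R]_3 -> 'rV[R[i]]_3)
    (n : nat) (w : 'I_n -> 'rV[R]_3) (x0 : 'rV[R]_3) (r0 alpha : R)
    (F G : 'rV[R]_3 -> 'rV[R[i]]_3)
    (hOm : bounded_lipschitz_domain Om)
    (hOmC : connected (~` closure Om))
    (heps0 : 0 < eps0) (hmu0 : 0 < mu0)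
    (heps : Linfty Om eps /\ ae_in Om (fun x => 0 < eps x))
    (hmu : Linfty Om mu /\ ae_in Om (fun x => 0 < mu x))
    (hsigma : Linfty Om sigma /\ ae_in Om (fun x => 0 <= sigma x))
    (homega : 0 < omega)
    (heig : transmission_eigenfunctions Om eps0 mu0 eps mu sigma omega
              Et Ht E0 H0)
    (hcorner : has_corner Om w x0 r0)
    (halpha : 0 < alpha < 1)
    (hF : holder_version alpha (tcone w x0 r0)
            (fun x => (mu x - mu0)%:C *: Ht x) F)
    (hG : holder_version alpha (tcone w x0 r0)
            (fun x => (gam eps sigma omega x - eps0%:C) *: Et x) G) :
  F x0 = 0 /\ G x0 = 0.
Proof.
have [oO _ _ bO _] := hOm.
have [[cEt cHt cE0 cH0] _ [mt1 mt2] [m01 m02] [trE trH]] := heig.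
have [pw r00 bx AE] := hcorner.
have [hF1 hF2] := hF; have [hG1 hG2] := hG.
have /andP[a0 _] := halpha.
pose A := tcone w x0 r0.
have AO : A `<=` Om by rewrite /A -AE => x [].
have oA : open A by rewrite /A -AE; apply: openI => //; exact: open_eball.
have bA : bounded_set A.
  by have [M [Mr HM]] := bO; exists M; split => // y My x /AO; exact: HM.
have cA : closure A x0.
  (* [x0] lies in the closure of the domain, which near [x0] is the truncated cone. *)
  move=> B Bx; have nb : nbhs x0 (eball x0 r0 `&` B).
    apply: filterI => //; apply: open_nbhs_nbhs; split; first exact: open_eball.
    by rewrite /eball /= subrr /enorm dot0r sqrtr0.
  by have [y [Oy [ey By]]] := bx.1 _ nb; exists y; split => //; rewrite /A -AE.
(* The cutoff then lives within distance [2 * r = r0 / 2] of [x0], inside the ball of the corner. *)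
pose r := r0 / 4; have rgt0 : 0 < r by rewrite divr_gt0.
have rr0 : 2 * r < r0 by rewrite /r; lra.
pose c : R[i] := 0 +i* omega.
have c0 : c != 0 by apply/eqP => -[] /eqP; rewrite gt_eqF.
have oL (u v : 'rV[R]_3 -> 'rV[R[i]]_3) : L2field Om u -> L2field Om v ->
    L2field A (fun x => u x - v x).
  by move=> uL vL; apply: (L2fieldS oO oA AO); exact: L2fieldB.
have lcE := local_curl_difference (x0 := x0) oO bO cEt cE0 trE rgt0 rr0.
have lcH := local_curl_difference (x0 := x0) oO bO cHt cH0 trH rgt0 rr0.
rewrite AE -/A in lcE lcH.
have EL := oL _ _ cEt.1 cE0.1; have HL := oL _ _ cHt.1 cH0.1.
have PL := oL _ _ (Hcurl_L2 cEt) (Hcurl_L2 cE0).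
have QL := oL _ _ (Hcurl_L2 cHt) (Hcurl_L2 cH0).
have PF : ae_in A (fun x => forall j, c^-1 * (curl Om Et x - curl Om E0 x) 0 j -
    mu0%:C * (Ht x - H0 x) 0 j = F x 0 j).
  move: mt1 m01 hF2; rewrite /ae_in => h1 h2 h3.
  have ff := ae_filter_ringOfSetsType (leb3 R).
  apply: (@filterS3 _ _ ff _ _ _ _ _ h1 h2 h3) => p e1 e2 e3 Ap j.
  rewrite -(e3 Ap) (subr0_eq (e1 (AO _ Ap))) (subr0_eq (e2 (AO _ Ap))) !mxE.
  rewrite (_ : (mu (pt p) - mu0)%:C = (mu (pt p))%:C - mu0%:C); last exact: rmorphB.
  exact: maxwell_difference.
(* The second Maxwell equation has the opposite sign, hence [- c]. *)
have QG : ae_in A (fun x => forall j, (- c)^-1 * (curl Om Ht x - curl Om H0 x) 0 j -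
    eps0%:C * (Et x - E0 x) 0 j = G x 0 j).
  move: mt2 m02 hG2; rewrite /ae_in => h1 h2 h3.
  have ff := ae_filter_ringOfSetsType (leb3 R).
  apply: (@filterS3 _ _ ff _ _ _ _ _ h1 h2 h3) => p e1 e2 e3 Ap j.
  move: (e1 (AO _ Ap)) (e2 (AO _ Ap)) => /eqP + /eqP; rewrite !addr_eq0 => /eqP -> /eqP ->.
  rewrite -(e3 Ap) -[- (_ *: Et _)]scaleNr -[- (_ *: E0 _)]scaleNr
    -[- (_ * gam _ _ _ _)]mulNr -[- (_ * eps0%:C)]mulNr !mxE.
  apply: maxwell_difference; by rewrite oppr_eq0.
have cN0 : - c != 0 by rewrite oppr_eq0.
(* The second claim exchanges the electric and magnetic fields, and with them [c] and [- c]. *)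
split.
- exact: (transmission_corner pw rgt0 rr0 oA bA cA EL HL PL QL lcE lcH cN0 a0 hF1 hG1 PF QG).
- exact: (transmission_corner pw rgt0 rr0 oA bA cA HL EL QL PL lcH lcE c0 a0 hG1 hF1 QG PF).
Qed.
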